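(* Let $x\ge a_0/\gamma_0$ and let $T(x)=\inf\{t:\ X(t)<a_0/\gamma_0\}$, where $X(0)=x$. Put $$z=z(x)=\frac{a_0/\gamma_0-x}{a_0/\gamma_0-a_1/\gamma_1},\qquad b_0'(0)=\frac{\lambda_0+\lambda_1}{\lambda_0\gamma_1+\lambda_1\gamma_0}>0 .$$ (Here $b_0'(0)$ is the derivative at $q=0$ of the smaller root $b_0(q)$ defined in the context.) (A) In each of the following two cases: (1) $a_0/\gamma_0\le x<2a_0/\gamma_0-a_1/\gamma_1$; (2) $x=2a_0/\gamma_0-a_1/\gamma_1$ and $\lambda_1<\gamma_1$; the mean values of $T(x)$ are given by the series $$\mathbb E\{T(x)\mid\varepsilon(0)=0\}=-b_0'(0)\sum_{n=1}^\infty\frac{(\lambda_0/\gamma_0+\lambda_1/\gamma_1)_n}{(1+\lambda_0/\gamma_0)_n}\cdot\frac{z^n}{n}+\frac1{\lambda_0}<\infty,\qquad (\mathrm{E}_0)$$ $$\mathbb E\{T(x)\mid\varepsilon(0)=1\}=-b_0'(0)\sum_{n=1}^\infty\frac{(\lambda_0/\gamma_0+\lambda_1/\gamma_1)_n}{(\lambda_0/\gamma_0)_n}\cdot\frac{z^n}{n}<\infty.\qquad (\mathrm{E}_1)$$ (B) If $x=2a_0/\gamma_0-a_1/\gamma_1$ and $\gamma_1\le\lambda_1<2\gamma_1$, then, of these two series, only the series $(\mathrm{E}_0)$ for $\mathbb E\{T(x)\mid\varepsilon(0)=0\}$ is finite (convergent). (C) In all other cases, the expectations $\mathbb E\{T(x)\mid\varepsilon(0)=0\}$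 and $\mathbb E\{T(x)\mid\varepsilon(0)=1\}$ are obtained from the analytic continuation in $z$ of the Laplace transforms, i.e. $\mathbb E\{T(x)\mid\varepsilon(0)=i\}=-\frac{\partial}{\partial q}\widehat Q_i(q,x)\big|_{q=0}$ with $$\widehat Q_0(q,x)=\frac{\lambda_0}{\lambda_0+q}F\bigl(b_0(q),b_1(q);\beta_0(q)+1;z(x)\bigr),\qquad \widehat Q_1(q,x)=F\bigl(b_0(q),b_1(q);\beta_0(q);z(x)\bigr),$$ $F$ being understood by analytic continuation.
   Context: Let $\varepsilon=\varepsilon(t)\in\{0,1\}$, $t\ge0$, be a time-homogeneous two-state Markov process with positive switching intensities $\lambda_0,\lambda_1$: $\mathbb P\{\varepsilon(t+dt)=i\mid\varepsilon(t)=i\}=1-\lambda_i\,dt+o(dt)$, $dt\to 0$. Let $a_0,a_1\in\mathbb R$ and $\gamma_0,\gamma_1>0$ with $a_0/\gamma_0>a_1/\gamma_1$. The Ornstein-Uhlenbeck process of bounded variation $X=X(t)$ is the path-continuous solution of $$dX(t)=\bigl(a_{\varepsilon(t)}-\gamma_{\varepsilon(t)}X(t)\bigr)\,dt,\quad t>0,\qquad X(0)=x.$$ Notation: $(b)_n=b(b+1)\cdots(b+n-1)$, $(b)_0=1$, is the Pochhammer symbol; $\beta_0(q)=(\lambda_0+q)/\gamma_0$, $\beta_1(q)=(\lambda_1+q)/\gamma_1$; $b_0(q)\le b_1(q)$ are the two numbers $\frac12\bigl(\beta_0(q)+\beta_1(q)\mp\sqrt{(\beta_0(q)-\beta_1(q))^2+4\beta_0(0)\beta_1(0)}\bigr)$.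 The Gaussian hypergeometric function is $F(b_0,b_1;\beta;z)=1+\sum_{n\ge1}\frac{(b_0)_n(b_1)_n}{(\beta)_n\,n!}z^n$ for $|z|<1$, extended by analytic continuation to $z\le-1$. The Laplace transforms are $\widehat Q_i(q,x)=\mathbb E[\exp(-qT(x))\mid\varepsilon(0)=i]$. *)

(* Defs.v *)
From HB Require Import structures.
From mathcomp Require Export all_boot all_order all_algebra.
From mathcomp Require Export all_classical all_reals all_analysis.

Set Implicit Arguments.
Unset Strict Implicit.
Unset Printing Implicit Defensive.

Export Order.TTheory GRing.Theory Num.Theory.
Export numFieldNormedType.Exports.

Global Open Scope classical_set_scope.
Global Open Scope ring_scope.

Section Hypergeometric.
Variable R : realType.
Implicit Types b c z : R.

Definition pochhammer b n : R := \prod_(k < n) (b + k%:R).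

Definition hypergeo_coef b0 b1 c n : R :=
  pochhammer b0 n * pochhammer b1 n / (pochhammer c n * n`!%:R).

Definition analytic_at (G : R -> R) z0 : Prop :=
  exists u : R^nat, \forall z \near z0, pseries u (z - z0) @ \oo --> G z.

(* The Gauss series on ]-1, 1[, continued analytically to ]-oo, 1[. *)
Definition is_hypergeo b0 b1 c (G : R -> R) : Prop :=
  (forall z, `|z| < 1 -> pseries (hypergeo_coef b0 b1 c) z @ \oo --> G z) /\
  (forall z0, z0 < 1 -> analytic_at G z0).

(* On ]-oo, 1[ the values do not depend on the choice made by [get], by the
   identity theorem; the values on [1, +oo[ are meaningless. *)
Definition hypergeo b0 b1 c : R -> R := get (is_hypergeo b0 b1 c).

End Hypergeometric.

Section ModelConstants.
Variables (R : realType) (lam gam a : 'I_2 -> R).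

Definition beta (i : 'I_2) (q : R) : R := (lam i + q) / gam i.

Definition discr (q : R) : R :=
  (beta 0 q - beta 1 q) ^+ 2 + 4 * beta 0 0 * beta 1 0.

Definition b0 (q : R) : R := (beta 0 q + beta 1 q - Num.sqrt (discr q)) / 2.
Definition b1 (q : R) : R := (beta 0 q + beta 1 q + Num.sqrt (discr q)) / 2.

Definition b0'0 : R := (lam 0 + lam 1) / (lam 0 * gam 1 + lam 1 * gam 0).

Definition zvar (x : R) : R := (a 0 / gam 0 - x) / (a 0 / gam 0 - a 1 / gam 1).

Definition mean_series (c z : R) : R^nat := fun N =>
  \sum_(1 <= n < N)
    pochhammer (lam 0 / gam 0 + lam 1 / gam 1) n / pochhammer c n
      * (z ^+ n / n%:R).

Definition Qhat0 (x q : R) : R :=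
  lam 0 / (lam 0 + q) * hypergeo (b0 q) (b1 q) (beta 0 q + 1) (zvar x).

Definition Qhat1 (x q : R) : R :=
  hypergeo (b0 q) (b1 q) (beta 0 q) (zvar x).

End ModelConstants.

Section Probability.
Context {R : realType} {d : measure_display} {Omega : measurableType d}.
Variable P : probability Omega R.

(* Elementary conditioning on an event; meaningful only when [0 < P A]. *)
Definition cond_prob (A B : set Omega) : R := fine (P (A `&` B)) / fine (P A).

Definition cond_expect (A : set Omega) (f : Omega -> \bar R) : \bar R :=
  (((fine (P A))^-1)%:E * \int[P]_(w in A) f w)%E.

Definition in_state (eps : R -> Omega -> 'I_2) (t : R) (i : 'I_2) : set Omega :=
  [set w | eps t w = i].

Definition past (eps : R -> Omega -> 'I_2) (s : R) : set (set Omega) :=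
  <<s [set A | exists u i, 0 <= u <= s /\ A = in_state eps u i] >>.

(* Time is [0, +oo[: the values of [eps] at negative times are never used.
   The transition probabilities [p h i j] do not depend on the current time
   (homogeneity) nor on the past (Markov property). *)
Record two_state_markov (lam : 'I_2 -> R) (eps : R -> Omega -> 'I_2) : Prop := {
  tsm_measurable : forall t i, 0 <= t -> measurable (in_state eps t i);
  tsm_right_continuous : forall w t, 0 <= t ->
    \forall s \near t^'+, eps s w = eps t w;
  tsm_left_limit : forall w t, 0 < t ->
    exists i, \forall s \near t^'-, eps s w = i;
  tsm_transition : exists p : R -> 'I_2 -> 'I_2 -> R,
    (forall s h i j A, 0 <= s -> 0 <= h -> past eps s A ->
       (0 < P (A `&` in_state eps s i))%E ->
       cond_prob (A `&` in_state eps s i) (in_state eps (s + h) j) = p h i j) /\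
    (forall i, (p h i i - (1 - lam i * h)) / h @[h --> 0^'+] --> 0)
}.

End Probability.

Section Path.
Variable R : realType.

(* Path-continuous solution of dX = (a_e - gam_e X) dt, X(0) = x, read as an
   integral equation since the right-hand side jumps with e. *)
Definition ou_path (a gam : 'I_2 -> R) (x : R) (e : R -> 'I_2) (X : R -> R)
    : Prop :=
  {within `[0, +oo[, continuous X} /\ X 0 = x /\
  forall t, 0 <= t ->
    X t = x + \int[lebesgue_measure]_(s in `[0, t]) (a (e s) - gam (e s) * X s).

Definition hitting_time (level : R) (X : R -> R) : \bar R :=
  ereal_inf [set t%:E | t in [set t | 0 <= t /\ X t < level]].

End Path.

(* Main.v *)
Require Import Defs.
From mathcomp Require Import measurable_realfun ring lra.

Set Implicit Arguments.
Unset Strict Implicit.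
Unset Printing Implicit Defensive.

(**
Let l0 = a_0/gamma_0 and l1 = a_1/gamma_1.  In either state i the process
relaxes exponentially towards l_i, so it falls below l0 in state 1 only, and
it never comes back.  Let f_0, f_1 solve the backward equations
  (a_i - gamma_i y) f_i'(y) + lambda_i (f_j(y) - f_i(y)) - q f_i(y) = - sg
(j is the other state) for y >= l0.  Then exp(-qt) f(eps(t), X(t)) + sg t,
stopped at T, has constant expectation when q = 0 or sg = 0 ([dynkin]), and
at time T the value of f is f_1(l0).  Letting t grow, f is the mean of T for
q = 0, sg = 1, f_1(l0) = 0 ([hit_mean]), and its Laplace transform for q > 0,
sg = 0, f_1(l0) = 1 ([hit_laplace]).  So it is enough to exhibit bounded
smooth solutions of the backward equations on [l0, x].

Constancy of the expectation is proved by cutting [0, t] into n + 1 steps of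
length h.  The law of one step is known up to o(h), the smooth test function
moves along the flow up to O(h^2), and the step is exact except where the
state switches inside it; on each path the number of such steps stays bounded
as h tends to 0 ([sum_resid]).  X(s) is a limit of functionals of the states
at finitely many times before s, so the Markov property applies to it
([markov_X]).

In the variable z(y) the backward equations become the system [zsys], with
regular singular points z = 0 (y = l0) and z = 1 (y = l1).  The further
change w = z/(z - 1) sends the half line z < 1/2 into |w| < 1, where the
solution with sources 1/gamma_i and second component 0 at the level is one
power series ([W0], [W1]); in this way every x >= l0 is reached without
continuation.  Call this solution U(q, z).  Then 1 - q U(q, z) solves the
equations without source and has second component 1 at the level.

The solution at the singular point 0 is unique given the value of its second
component ([zsys_unique0]).  For -1 < z <= 0 this identifies 1 - q U with the
Gauss series, because b0(q) and b1(q) are the roots of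
(b - beta_0)(b - beta_1) = lambda_0 lambda_1/(gamma_0 gamma_1), and U(0, .)
with the series of the statement.  Solutions of [zsys] are real analytic at
ordinary points, so by the identity theorem 1 - q U is the analytic
continuation of the Gauss series, and its derivative at q = 0 is - U(0, z),
that is, minus the mean of T.

At z = -1 the terms of the two series alternate in sign and have the sizes
n^(lambda_1/gamma_1 - 2) and n^(lambda_1/gamma_1 - 1).  When these decrease
to 0, Abel's limit theorem extends the formula from z > -1 ([pseq_abel]);
when they stay away from 0 the series diverges ([pseq_diverges]).
*)

(** * Power series *)

Section PowerSeries.
Variable R : realType.
Implicit Types (c u v : R^nat) (x r rho : R).

(** The radius of convergence of c is at least rho, in the form delivered by
    majorants: each c n * r ^+ n with r < rho is bounded. *)
Definition radius_ge rho c := forall r, 0 <= r -> r < rho ->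
  exists M, forall n, `|c n| * r ^+ n <= M.

Definition psum c x : R := limn (pseries c x).

Lemma exists_between (p q : R) : p < q -> exists2 r, p < r & r < q.
Proof. by move=> pq; exists ((p + q) / 2); lra. Qed.

Lemma rad_cvg rho c x : radius_ge rho c -> `|x| < rho -> cvgn (pseries c x).
Proof.
move=> rc xrho; have x0 := normr_ge0 x; have [r xr rrho] := exists_between xrho.
have r0 : 0 < r by exact: le_lt_trans xr.
have [M HM] := rc _ (ltW r0) rrho.
apply: normed_cvg.
apply: (@series_le_cvg _ _ (geometric M (`|x| / r))).
- by move=> n /=; exact: normr_ge0.
- move=> n /=; rewrite mulr_ge0// ?exprn_ge0 ?divr_ge0 ?(ltW r0)//.
  by have := HM 0; rewrite expr0 mulr1; apply: le_trans.
- move=> n /=; rewrite normrM normrX expr_div_n mulrA ler_pdivlMr ?exprn_gt0//.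
  by rewrite mulrAC ler_wpM2r ?exprn_ge0.
- apply: is_cvg_geometric_series.
  by rewrite ger0_norm ?divr_ge0 ?(ltW r0)// ltr_pdivrMr// mul1r.
Qed.

Lemma rad_psum rho c x : radius_ge rho c -> `|x| < rho ->
  pseries c x @ \oo --> psum c x.
Proof. exact: rad_cvg. Qed.

(** n th^n is at most th^0 + ... + th^(n-1), which is below 1/(1 - th). *)
Lemma nat_expr_le (th : R) n : 0 <= th -> th < 1 ->
  n%:R * th ^+ n <= (1 - th)^-1.
Proof.
move=> t0 t1; have p : 0 < 1 - th by lra.
rewrite -[leRHS]mul1r ler_pdivlMr//.
have -> : n%:R * th ^+ n = \sum_(k < n) th ^+ n.
  by rewrite sumr_const card_ord mulr_natl.
apply: (@le_trans _ _ ((\sum_(k < n) th ^+ k) * (1 - th))).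
  apply: ler_wpM2r; first exact: ltW.
  by apply: ler_sum => i _; rewrite ler_wiXn2l ?(ltW t1)// ltnW.
have := subrX1 th n => e.
have -> : (\sum_(k < n) th ^+ k) * (1 - th) = 1 - th ^+ n by rewrite mulrC; lra.
by have := exprn_ge0 n t0; lra.
Qed.

Lemma rad_diffs rho c : radius_ge rho c -> radius_ge rho (pseries_diffs c).
Proof.
move=> rc r r0 rrho; have [s rs srho] := exists_between rrho.
have s0 : 0 < s by exact: le_lt_trans rs.
have [M HM] := rc _ (ltW s0) srho.
pose th := r / s.
have th0 : 0 <= th by rewrite divr_ge0// ltW.
have th1 : th < 1 by rewrite ltr_pdivrMr// mul1r.
have M0 : 0 <= M by have := HM 0; rewrite expr0 mulr1; apply: le_trans.
have [M1 HM1] : exists M1, forall n, n.+1%:R * th ^+ n <= M1.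
  exists ((1 - th)^-1 + 1) => n; rewrite -natr1 mulrDl mul1r.
  by rewrite lerD// ?nat_expr_le// exprn_ile1// ltW.
exists (M / s * M1) => n.
have -> : `|pseries_diffs c n| * r ^+ n =
   (`|c n.+1| * s ^+ n.+1) / s * (n.+1%:R * th ^+ n).
  rewrite /pseries_diffs normrM normr_nat /th expr_div_n exprS.
  by field; rewrite expf_neq0 ?gt_eqF.
apply: ler_pM; rewrite ?HM1 ?divr_ge0 ?mulr_ge0 ?exprn_ge0 ?ler0n ?(ltW s0)//.
by rewrite ler_wpM2r ?invr_ge0 ?(ltW s0).
Qed.

Lemma psum_is_derive rho c x : radius_ge rho c -> `|x| < rho ->
  is_derive x (1 : R) (psum c) (psum (pseries_diffs c) x).
Proof.
move=> rc xrho; have x0 := normr_ge0 x; have [r xr rrho] := exists_between xrho.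
have nr : `|r| < rho by rewrite ger0_norm//; lra.
apply: (@pseries_snd_diffs _ _ r).
- exact: rad_cvg nr.
- by apply: rad_cvg nr; exact: rad_diffs.
- by apply: rad_cvg nr; do 2 apply: rad_diffs.
- by rewrite (ger0_norm (ltW (le_lt_trans x0 xr))).
Qed.

Lemma psum_continuous rho c x : radius_ge rho c -> `|x| < rho ->
  {for x, continuous (psum c)}.
Proof.
move=> rc xr; apply: differentiable_continuous; apply/derivable1_diffP.
by have [] := psum_is_derive rc xr.
Qed.

Definition cshift c : R^nat := fun n => if n is m.+1 then c m else 0.

Lemma cvg_cshift c x l : pseries c x @ \oo --> l ->
  pseries (cshift c) x @ \oo --> x * l.
Proof.
move=> cl; rewrite -cvg_shiftS.
rewrite [X in X @ _ --> _](_ : _ = fun n => x * pseries c x n).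
  by apply: cvgM => //; exact: cvg_cst.
apply/funext => n; rewrite /pseries /series/= big_nat_recl//= mul0r add0r mulr_sumr.
by apply: eq_bigr => i _; rewrite exprS; ring.
Qed.

Lemma cvg_pseriesD c d x l l' : pseries c x @ \oo --> l ->
  pseries d x @ \oo --> l' -> pseries (fun n => c n + d n) x @ \oo --> l + l'.
Proof.
move=> cl dl; rewrite [X in X @ _ --> _](_ : _ = pseries c x + pseries d x).
  exact: cvgD.
apply/funext => n; rewrite /pseries /series/= fctE -big_split/=.
by apply: eq_bigr => i _; rewrite mulrDl.
Qed.

Lemma cvg_pseriesZ c x l k : pseries c x @ \oo --> l ->
  pseries (fun n => k * c n) x @ \oo --> k * l.
Proof.
move=> cl; rewrite [X in X @ _ --> _](_ : _ = fun n => k * pseries c x n).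
  by apply: cvgM => //; exact: cvg_cst.
apply/funext => n; rewrite /pseries /series/= mulr_sumr.
by apply: eq_bigr => i _; rewrite mulrA.
Qed.

Lemma cvg_pseries0 x k :
  pseries (fun n => (n == 0)%:R * k) x @ \oo --> (k : R).
Proof.
rewrite -cvg_shiftS [X in X @ _ --> _](_ : _ = fun=> k); first exact: cvg_cst.
apply/funext => n; rewrite /pseries /series/= big_nat_recl//= expr0 mulr1 mul1r.
by rewrite big1 ?addr0// => i _; rewrite !mul0r.
Qed.

Lemma psum_at0 c : psum c 0 = c 0.
Proof.
apply: cvg_lim => //.
rewrite -cvg_shiftS [X in X @ _ --> _](_ : _ = fun=> c 0); first exact: cvg_cst.
apply/funext => n; rewrite /pseries /series/= big_nat_recl//= expr0 mulr1.
by rewrite big1 ?addr0// => i _; rewrite expr0n/= mulr0.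
Qed.

(** Coefficients of a first order equation whose leading factor is a quadratic
    polynomial: each solution below is obtained by comparing coefficients, and
    this lemma turns the recursion into the equation. *)
Lemma ode_psum rho u v (al be ka A B k : R) x :
  radius_ge rho u -> radius_ge rho v -> `|x| < rho ->
  (forall n, al * (n.+1%:R * u n.+1) + be * (n%:R * u n)
       + ka * (n.-1%:R * u n.-1) = A * u n + B * v n + (n == 0)%:R * k) ->
  (al + be * x + ka * (x * x)) * psum (pseries_diffs u) x
     = A * psum u x + B * psum v x + k.
Proof.
move=> ru rv xr rec.
have cu := rad_psum ru xr; have cv := rad_psum rv xr.
have cd := rad_psum (rad_diffs ru) xr.
have cl := cvg_pseriesD (cvg_pseriesD (@cvg_pseriesZ _ _ _ al cd)
  (@cvg_pseriesZ _ _ _ be (cvg_cshift cd)))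
  (@cvg_pseriesZ _ _ _ ka (cvg_cshift (cvg_cshift cd))).
have cr := cvg_pseriesD (cvg_pseriesD (@cvg_pseriesZ _ _ _ A cu)
  (@cvg_pseriesZ _ _ _ B cv)) (@cvg_pseries0 x k).
have E : (fun n => A * u n + B * v n + (n == 0)%:R * k) =
    (fun n => al * pseries_diffs u n + be * cshift (pseries_diffs u) n +
       ka * cshift (cshift (pseries_diffs u)) n).
  apply/funext => n; rewrite -rec.
  by case: n => [|[|n]]; rewrite /cshift /pseries_diffs/= ?mul0r ?mulr0.
rewrite E in cr.
rewrite -(cvg_lim _ cr)// (cvg_lim _ cl)//; ring.
Qed.

Lemma eventually_nonincr_bounded (s : R^nat) n0 :
  (forall n, 0 <= s n) -> (forall n, (n0 <= n)%N -> s n.+1 <= s n) ->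
  exists M, forall n, s n <= M.
Proof.
move=> s0 sdec; exists (\sum_(k < n0.+1) s k).
have le1 k : (k <= n0)%N -> s k <= \sum_(k < n0.+1) s k.
  move=> kn; rewrite (bigD1 (Ordinal (kn : (k < n0.+1)%N)))//= lerDl.
  by rewrite sumr_ge0.
move=> n; have [|nn] := leqP n n0; first exact: le1.
rewrite -(subnK (ltnW nn)); elim: (n - n0)%N => [|m IH]; first exact: le1.
by rewrite addSn; apply: le_trans IH; apply: sdec; rewrite leq_addl.
Qed.

(** The Taylor coefficients of (1 - x)^(-C). *)
Fixpoint majorant (C : R) n : R :=
  if n is m.+1 then majorant C m * (C + m%:R) / m.+1%:R else 1.

Lemma majo_ge0 C n : 0 <= C -> 0 <= majorant C n.
Proof.
move=> C0; elim: n => //= n IH.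
by rewrite divr_ge0// mulr_ge0// addr_ge0.
Qed.

Lemma majo_homo C n : 1 <= C -> majorant C n <= majorant C n.+1.
Proof.
move=> C1 /=; rewrite -mulrA ler_peMr ?majo_ge0//; first by lra.
by rewrite ler_pdivlMr// mul1r -natr1; lra.
Qed.

Lemma majo_ge1 C n : 1 <= C -> 1 <= majorant C n.
Proof.
move=> C1; elim: n => // n IH; exact: le_trans IH (majo_homo _ C1).
Qed.

Lemma rad_majo C : 1 <= C -> radius_ge 1 (majorant C).
Proof.
move=> C1 r r0 r1.
have C0 : 0 <= C by lra.
(* from n0 on, (C + n) r <= n + 1 *)
pose n0 := (Num.bound (r * C / (1 - r))).
apply: (@eventually_nonincr_bounded _ n0) => n.
  by rewrite mulr_ge0// exprn_ge0.
move=> nn; rewrite !ger0_norm ?majo_ge0//=.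
have -> : majorant C n * (C + n%:R) / n.+1%:R * r ^+ n.+1 =
   (majorant C n * r ^+ n) * ((C + n%:R) * r / n.+1%:R).
  by rewrite exprS; field.
rewrite ler_piMr ?mulr_ge0 ?majo_ge0 ?exprn_ge0//.
rewrite ler_pdivrMr// mul1r -natr1.
have := archi_boundP (divr_ge0 (mulr_ge0 r0 C0) (ltac:(lra) : 0 <= 1 - r)).
rewrite ltr_pdivrMr; last by lra.
have : (n0%:R : R) <= n%:R by rewrite ler_nat.
rewrite -/n0; move: (n0%:R : R) (n%:R : R) => a b; nra.
Qed.

Lemma rad_le rho c d K : radius_ge rho d -> (forall n, `|c n| <= K * d n) ->
  (forall n, 0 <= d n) -> radius_ge rho c.
Proof.
move=> rd cd d0 r r0 rr; have [M HM] := rd _ r0 rr.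
exists (`|K| * M) => n.
apply: (@le_trans _ _ (`|K| * (`|d n| * r ^+ n))).
  rewrite mulrA ler_wpM2r ?exprn_ge0//; apply: le_trans (cd n) _.
  by rewrite (ger0_norm (d0 n)) ler_wpM2r// ler_norm.
by rewrite ler_wpM2l.
Qed.

Lemma rad_geo K : 0 < K -> radius_ge K^-1 (fun n => K ^+ n).
Proof.
move=> K0 r r0 rK; exists 1 => n.
rewrite ger0_norm ?exprn_ge0 ?(ltW K0)// -exprMn exprn_ile1//.
  by rewrite mulr_ge0// ltW.
by rewrite mulrC -ler_pdivlMr// mul1r ltW.
Qed.

(** Method of majorants: consecutive majorant coefficients have the ratio
    (C + n)/(n + 1), and C is so large that a step of the recursion multiplies
    the bound by no more.  The bounds depend on b and b' through bm and B only,
    which makes them uniform when b and b' move with a parameter. *)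
Lemma majo_rec (u v su sv : R^nat) (b b' c c' S bm B : R) :
  0 < bm -> bm <= b -> `|b'| <= B -> 0 <= c -> 0 <= c' -> 0 <= S ->
  v 0 = 0 ->
  (forall n, (n%:R + b) * u n = n.-1%:R * u n.-1 + c * v n + su n) ->
  (forall n, n.+1%:R * v n.+1 = (n%:R - b') * v n + c' * u n + sv n) ->
  (forall n, `|su n| <= S * majorant (B + c' * (c + 1) / bm + 1) n) ->
  (forall n, `|sv n| <= S * majorant (B + c' * (c + 1) / bm + 1) n) ->
  forall n, `|u n| <= (c + 1) / bm * S * majorant (B + c' * (c + 1) / bm + 1) n /\
            `|v n| <= S * majorant (B + c' * (c + 1) / bm + 1) n.
Proof.
move=> bm0 bmb bB c0 c'0 S0 v0 ru rv hu hv.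
set C := B + _ + 1; set K := (c + 1) / bm.
have B0 : 0 <= B by apply: le_trans bB.
have K0 : 0 <= K by rewrite divr_ge0// ?(ltW bm0)//; lra.
have C1 : 1 <= C by rewrite lerDr addr_ge0// divr_ge0 ?mulr_ge0 ?(ltW bm0)//; lra.
have P0 n : 0 <= majorant C n by apply: majo_ge0; lra.
have Kb : K * bm = c + 1 by rewrite /K divfK// gt_eqF.
have step n : `|v n| <= S * majorant C n ->
   (n = 0%N \/ `|u n.-1| <= K * S * majorant C n) -> `|u n| <= K * S * majorant C n.
  move=> hvn hun.
  have nb : 0 < n%:R + b by rewrite ltr_wpDl//; lra.
  rewrite -(ler_pM2l nb) -[X in X * `|_| <= _](gtr0_norm nb) -normrM ru.
  have : `|n.-1%:R * u n.-1| <= n%:R * (K * S * majorant C n).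
    case: hun => [->|hun]; first by rewrite !mul0r normr0.
    by rewrite normrM normr_nat ler_pM// ler_nat leq_pred.
  have : `|c * v n| <= c * (S * majorant C n).
    by rewrite normrM (ger0_norm c0) ler_wpM2l.
  have := hu n => h1 h2 h3.
  rewrite (le_trans (ler_normD _ _))//.
  apply: (@le_trans _ _ (n%:R * (K * S * majorant C n) + c * (S * majorant C n) + S * majorant C n)).
    by rewrite lerD// (le_trans (ler_normD _ _))// lerD.
  have -> : (n%:R + b) * (K * S * majorant C n) = n%:R * (K * S * majorant C n) +
     (K * b) * (S * majorant C n) by ring.
  rewrite -addrA lerD2l -[X in _ + X]mul1r -mulrDl ler_wpM2r ?mulr_ge0//.
  by rewrite -Kb ler_wpM2l.
have base : `|v 0| <= S * majorant C 0 by rewrite v0 normr0 mulr_ge0.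
suff H n : `|v n| <= S * majorant C n /\ `|u n| <= K * S * majorant C n.
  by move=> n; have [] := H n.
elim: n => [|n [IHv IHu]]; first by split => //; apply: step => //; left.
have hvS : `|v n.+1| <= S * majorant C n.+1.
  have n1 : 0 < n.+1%:R :> R by [].
  rewrite -(ler_pM2l n1) -[X in X * `|_| <= _](gtr0_norm n1) -normrM rv.
  have -> : n.+1%:R * (S * majorant C n.+1) = S * majorant C n * (C + n%:R).
    by rewrite /=; field.
  have h1 : `|(n%:R - b') * v n| <= (n%:R + B) * (S * majorant C n).
    rewrite normrM ler_pM// (le_trans (ler_normB _ _))// normr_nat lerD2l//.
  have h2 : `|c' * u n| <= c' * (K * S * majorant C n).
    by rewrite normrM (ger0_norm c'0) ler_wpM2l.
  rewrite (le_trans (ler_normD _ _))//.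
  apply: (@le_trans _ _ ((n%:R + B) * (S * majorant C n) + c' * (K * S * majorant C n) + S * majorant C n)).
    by rewrite lerD// (le_trans (ler_normD _ _))// lerD.
  by rewrite le_eqVlt; apply/orP; left; apply/eqP; rewrite /C /K; ring.
split=> //; apply: step => //; right.
by apply: le_trans IHu _; apply: ler_wpM2l; [exact: mulr_ge0|exact: majo_homo].
Qed.

End PowerSeries.

(** * The linear system behind the backward equations *)

Section RealDerivatives.
Variable R : realType.
Implicit Types (f g : R -> R) (x y a b d k : R).

Lemma sqr_norm x : `|x| ^+ 2 = x ^+ 2.
Proof. exact/real_normK/num_real. Qed.

Lemma derD f g x a b : is_derive x (1 : R) f a -> is_derive x (1 : R) g b ->
  is_derive x (1 : R) (fun y => f y + g y) (a + b).
Proof. by move=> fa gb; exact: is_deriveD. Qed.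

Lemma derB f g x a b : is_derive x (1 : R) f a -> is_derive x (1 : R) g b ->
  is_derive x (1 : R) (fun y => f y - g y) (a - b).
Proof. by move=> fa gb; exact: is_deriveB. Qed.

Lemma derM f g x a b : is_derive x (1 : R) f a -> is_derive x (1 : R) g b ->
  is_derive x (1 : R) (fun y => f y * g y) (a * g x + f x * b).
Proof.
move=> fa gb; apply: (@is_derive_eq _ _ _ _ _ _ _ _ (is_deriveM fa gb)).
by rewrite addrC [X in X + _]mulrC.
Qed.

Lemma derC k x : is_derive x (1 : R) (fun=> k) (0 : R).
Proof. exact: is_derive_cst. Qed.

Lemma derid x : is_derive x (1 : R) (fun y : R => y) (1 : R).
Proof. exact: is_derive_id. Qed.

Lemma derZ f x k a : is_derive x (1 : R) f a ->
  is_derive x (1 : R) (fun y => k * f y) (k * a).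
Proof.
move=> fa; apply: is_derive_eq (derM (derC k x) fa) _; ring.
Qed.

Lemma der_comp f g x a b : is_derive (g x) (1 : R) f a -> is_derive x (1 : R) g b ->
  is_derive x (1 : R) (fun y => f (g y)) (a * b).
Proof. by move=> fa gb; exact: is_derive1_comp. Qed.

Lemma derV f x a : f x != 0 -> is_derive x (1 : R) f a ->
  is_derive x (1 : R) (fun y => (f y)^-1) (- a / f x ^+ 2).
Proof.
move=> f0 fa; apply: is_derive_eq (is_deriveV f0 fa) _.
by rewrite mulNr mulrC -mulNr.
Qed.

Lemma der_cont f x a : is_derive x (1 : R) f a -> {for x, continuous f}.
Proof.
by case=> dfx _; apply: differentiable_continuous; apply/derivable1_diffP.
Qed.

Lemma der_within f (p q : R) (df : R -> R) :
  (forall x, p <= x <= q -> is_derive x (1 : R) f (df x)) ->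
  {within `[p, q], continuous f}.
Proof.
move=> h; apply: continuous_in_subspaceT => x.
by rewrite inE/= in_itv/= => /h /der_cont.
Qed.

Lemma is_derive_MVT f (df : R -> R) (p q : R) : p <= q ->
  (forall x, p <= x <= q -> is_derive x (1 : R) f (df x)) ->
  exists2 c, p <= c <= q & f q - f p = df c * (q - p).
Proof.
move=> pq h; have [|c] := @MVT_segment _ f df p q pq _ (der_within h).
  by move=> x; rewrite in_itv/= => /andP[/ltW p1 /ltW q1]; apply: h; rewrite p1 q1.
by rewrite in_itv/=; exists c.
Qed.

Lemma der_incr_at f y d e : is_derive y (1 : R) f d -> 0 < d -> 0 < e ->
  exists z, [/\ y < z, z < y + e & f y < f z].
Proof.
move=> [dfy dfE] d0 e0.
have : (fun h : R => h^-1 *: ((f \o shift y) (h *: (1 : R)) - f y)) @ 0^'+ --> d.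
  rewrite -dfE; apply: cvg_dnbhs_at_right; exact: dfy.
move=> /cvgr_gt/(_ _ d0) hd.
have he : \forall h \near (0 : R)^'+, h < e by exact: nbhs_right_lt.
have hp : \forall h \near (0 : R)^'+, 0 < h by exact: nbhs_right_gt.
near (0 : R)^'+ => h.
have h0 : 0 < h by near: h.
have h1 : h < e by near: h.
have : 0 < h^-1 *: ((f \o shift y) (h *: (1 : R)) - f y) by near: h.
rewrite /= /GRing.scale/= mulr1 pmulr_rgt0 ?invr_gt0// subr_gt0 addrC => fy.
by exists (y + h); split => //; rewrite ?ltrDl ?ltrD2l.
Unshelve. all: by end_near. Qed.

(** E(z) exp(-Kz) decreases and E(z) exp(Kz) increases, so a zero of the
    nonnegative E spreads to the right and to the left. *)
Lemma gronwall_zero (E dE : R -> R) K (p q z0 : R) : p <= z0 <= q ->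
  (forall z, p <= z <= q -> is_derive z (1 : R) E (dE z)) ->
  (forall z, p <= z <= q -> 0 <= E z) ->
  (forall z, p <= z <= q -> `|dE z| <= K * E z) ->
  E z0 = 0 -> forall z, p <= z <= q -> E z = 0.
Proof.
move=> /andP[pz zq] dEE E0 hK Ez z /andP[pz' zq'].
have dexp k y : is_derive y (1 : R) (fun t => expR (k * t)) (expR (k * y) * k).
  have h : is_derive y (1 : R) (fun t => k * t) k.
    by apply: is_derive_eq (derZ k (derid y)) _; rewrite mulr1.
  exact: (der_comp (is_derive_expR (k * y)) h).
have dF k y : p <= y <= q -> is_derive y (1 : R) (fun t => E t * expR (k * t))
    ((dE y + k * E y) * expR (k * y)).
  move=> hy; apply: is_derive_eq (derM (dEE _ hy) (dexp k y)) _; ring.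
have [zz|/ltW zz] := leP z0 z.
  have sub y : z0 <= y <= z -> p <= y <= q.
    by move=> /andP[h1 h2]; rewrite (le_trans pz h1) (le_trans h2 zq').
  have [c /andP[c1 c2] e] := is_derive_MVT zz (fun y hy => dF (- K) y (sub y hy)).
  have hc : p <= c <= q by rewrite (le_trans pz c1) (le_trans c2 zq').
  have : E z * expR (- K * z) <= 0.
    move: e; rewrite Ez mul0r subr0 => ->.
    rewrite mulr_le0_ge0 ?subr_ge0// mulr_le0_ge0 ?expR_ge0//.
    by have := ler_normlW (hK _ hc); lra.
  have hz : p <= z <= q by rewrite pz' zq'.
  rewrite pmulr_lle0 ?expR_gt0// => h; apply/eqP; rewrite eq_le h; exact: E0.
have sub y : z <= y <= z0 -> p <= y <= q.
  by move=> /andP[h1 h2]; rewrite (le_trans pz' h1) (le_trans h2 zq).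
have [c /andP[c1 c2] e] := is_derive_MVT zz (fun y hy => dF K y (sub y hy)).
have hc : p <= c <= q by rewrite (le_trans pz' c1) (le_trans c2 zq).
have : E z * expR (K * z) <= 0.
  have : 0 <= (dE c + K * E c) * expR (K * c) * (z0 - z).
    rewrite mulr_ge0 ?subr_ge0// mulr_ge0 ?expR_ge0//.
    by have := hK _ hc; rewrite ler_norml => /andP[]; lra.
  by rewrite -e Ez mul0r; lra.
have hz : p <= z <= q by rewrite pz' zq'.
rewrite pmulr_lle0 ?expR_gt0// => h; apply/eqP; rewrite eq_le h; exact: E0.
Qed.

End RealDerivatives.

Section System.
Variable R : realType.
Variables (B0 B1 c0 c1 : R).

(** The backward equations in the variable z of the hypergeometric series:
    Bi = (lam_i + q)/gam_i, ci = lam_i/gam_i, and si is the source divided by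
    gam_i. *)
Definition zsys (s0 s1 : R) (f0 f1 df0 df1 : R -> R) (z : R) :=
  [/\ is_derive z (1 : R) f0 (df0 z), is_derive z (1 : R) f1 (df1 z),
     z * df0 z = - B0 * f0 z + c0 * f1 z + s0 &
     (1 - z) * df1 z = B1 * f1 z - c1 * f0 z - s1].

Lemma zsysB s0 s1 s0' s1' f0 f1 df0 df1 g0 g1 dg0 dg1 z :
  zsys s0 s1 f0 f1 df0 df1 z -> zsys s0' s1' g0 g1 dg0 dg1 z ->
  zsys (s0 - s0') (s1 - s1') (fun y => f0 y - g0 y) (fun y => f1 y - g1 y)
    (fun y => df0 y - dg0 y) (fun y => df1 y - dg1 y) z.
Proof.
move=> [a b c d] [a' b' c' d']; split; try exact: derB.
  by rewrite mulrBr c c'; ring.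
by rewrite mulrBr d d'; ring.
Qed.

(** Away from the singular points 0 and 1 the function D0^2 + D1^2 satisfies the
    differential inequality of [gronwall_zero]. *)
Lemma zsys_unique (D0 D1 dD0 dD1 : R -> R) (p q z0 : R) :
  p <= z0 <= q -> q < 1 -> 0 < p \/ q < 0 ->
  (forall z, p <= z <= q -> zsys 0 0 D0 D1 dD0 dD1 z) ->
  D0 z0 = 0 -> D1 z0 = 0 ->
  forall z, p <= z <= q -> D0 z = 0 /\ D1 z = 0.
Proof.
move=> pzq q1 pq sys D00 D10.
have [m m0 hm] : exists2 m, 0 < m & forall z, p <= z <= q -> m <= `|z| /\ m <= 1 - z.
  case: pq => [p0|q0].
    exists (Num.min p (1 - q)); first by rewrite lt_min p0 subr_gt0.
    move=> z /andP[h1 h2]; rewrite !ge_min ger0_norm ?h1; last by apply: le_trans h1; exact: ltW.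
    by split=> //; apply/orP; right; lra.
  exists (Num.min (- q) 1); first by rewrite lt_min oppr_gt0 q0 ltr01.
  move=> z /andP[h1 h2]; rewrite !ge_min ler0_norm; last by apply: le_trans h2 _; exact: ltW.
  by split; apply/orP; [left|right]; lra.
pose E z := D0 z * D0 z + D1 z * D1 z.
pose dE z := (dD0 z * D0 z + D0 z * dD0 z) + (dD1 z * D1 z + D1 z * dD1 z).
pose K := 2 / m * (`|B0| + `|c0| + `|B1| + `|c1|).
have EE : forall z, p <= z <= q -> E z = 0.
  apply: (@gronwall_zero _ E dE K p q z0) => //.
  - move=> z /sys[a b _ _]; apply: derD; exact: derM.
  - by move=> z _; rewrite /E addr_ge0// -expr2 sqr_ge0.
  - move=> z hz; have [_ _ e0 e1] := sys _ hz; have [m1 m2] := hm _ hz.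
    have a0 : `|dD0 z| <= m^-1 * (`|B0| * `|D0 z| + `|c0| * `|D1 z|).
      rewrite mulrC ler_pdivlMr// mulrC.
      apply: (@le_trans _ _ (`|z| * `|dD0 z|)); first by rewrite ler_wpM2r.
      rewrite -normrM e0 addr0 (le_trans (ler_normD _ _))//.
      by rewrite !normrM normrN.
    have a1 : `|dD1 z| <= m^-1 * (`|B1| * `|D1 z| + `|c1| * `|D0 z|).
      rewrite mulrC ler_pdivlMr// mulrC.
      apply: (@le_trans _ _ ((1 - z) * `|dD1 z|)); first by rewrite ler_wpM2r.
      rewrite -[X in X * _]ger0_norm; last by apply: le_trans m2; exact: ltW.
      rewrite -normrM e1 subr0 (le_trans (ler_normB _ _))//.
      by rewrite !normrM.
    have -> : dE z = 2 * (D0 z * dD0 z + D1 z * dD1 z) by rewrite /dE; ring.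
    rewrite normrM ger0_norm// /K /E -!mulrA ler_wpM2l//.
    rewrite (le_trans (ler_normD _ _))// !normrM -[D0 z * D0 z]expr2 -[D1 z * D1 z]expr2.
    rewrite -(sqr_norm (D0 z)) -(sqr_norm (D1 z)).
    have n0 := normr_ge0 (D0 z); have n1 := normr_ge0 (D1 z).
    move: a0 a1 n0 n1; set x := `|D0 z|; set y := `|D1 z| => a0 a1 n0 n1.
    apply: (@le_trans _ _ (x * (m^-1 * (`|B0| * x + `|c0| * y)) +
        y * (m^-1 * (`|B1| * y + `|c1| * x)))).
      by rewrite lerD// ler_wpM2l.
    have mi : 0 < m^-1 by rewrite invr_gt0.
    rewrite -subr_ge0.
    have -> : m^-1 * ((`|B0| + `|c0| + `|B1| + `|c1|) * (x ^+ 2 + y ^+ 2)) -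
      (x * (m^-1 * (`|B0| * x + `|c0| * y)) + y * (m^-1 * (`|B1| * y + `|c1| * x)))
      = m^-1 * (`|B0| * y ^+ 2 + `|B1| * x ^+ 2 + (`|c0| + `|c1|) * (x ^+ 2 + y ^+ 2 - x * y)).
      by ring.
    have xy : 0 <= x ^+ 2 + y ^+ 2 - x * y by nra.
    by rewrite mulr_ge0 ?(ltW mi)// !addr_ge0 ?mulr_ge0 ?sqr_ge0// addr_ge0.
  - by rewrite /E D00 D10 mulr0 addr0.
move=> z /EE; rewrite /E => /eqP.
rewrite paddr_eq0 -?expr2 ?sqr_ge0// !sqrf_eq0 => /andP[/eqP -> /eqP ->].
by [].
Qed.

Hypothesis B0_gt0 : 0 < B0.

(** Uniqueness at the singular point 0.  Where |D0| is maximal on [-s, 0] the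
    derivative of D0^2 is at most 0, and the first equation, whose left side is
    z times a derivative, gives |D0| <= |c0|/B0 max |D1|.  Since D1 vanishes
    at 0, the second equation gives max |D1| <= s K max |D1|, so both vanish
    for small s.  Then [zsys_unique] continues to the left. *)
Lemma zsys_unique0 (D0 D1 dD0 dD1 : R -> R) (r : R) : 0 < r ->
  (forall z, - r <= z <= 0 -> zsys 0 0 D0 D1 dD0 dD1 z) -> D1 0 = 0 ->
  forall z, - r <= z <= 0 -> D0 z = 0 /\ D1 z = 0.
Proof.
move=> r0 sys D10.
have D00 : D0 0 = 0.
  have [|_ _ e _] := sys 0; first by rewrite oppr_le0 (ltW r0) lexx.
  move: e; rewrite mul0r D10 mulr0 !addr0 => /esym/eqP.
  by rewrite mulf_eq0 oppr_eq0 gt_eqF//= => /eqP.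
pose k := `|c0| / B0.
have k0 : 0 <= k by rewrite divr_ge0// ltW.
pose K := `|B1| + `|c1| * k.
have K0 : 0 <= K by rewrite addr_ge0// mulr_ge0.
(* small enough for s * K <= 1/2 *)
pose s := Num.min r (2 * K + 1)^-1.
have s0 : 0 < s by rewrite lt_min r0 invr_gt0; lra.
have sr : s <= r by rewrite ge_min lexx.
have sK : s * K <= 1 / 2.
  apply: (@le_trans _ _ ((2 * K + 1)^-1 * K)).
    by rewrite ler_wpM2r// ge_min lexx orbT.
  by rewrite mulrC ler_pdivrMr; lra.
have inr z : - s <= z <= 0 -> - r <= z <= 0.
  by move=> /andP[a b]; rewrite b andbT; lra.
have ss : - s <= 0 by rewrite oppr_le0 ltW.
have small : forall z, - s <= z <= 0 -> D0 z = 0 /\ D1 z = 0.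
  have c0' : {within `[- s, 0], continuous (fun z => D0 z * D0 z)}.
    apply: (@der_within _ _ _ _ (fun z => dD0 z * D0 z + D0 z * dD0 z)) => x /inr/sys[a _ _ _].
    exact: derM.
  have c1' : {within `[- s, 0], continuous (fun z => D1 z * D1 z)}.
    apply: (@der_within _ _ _ _ (fun z => dD1 z * D1 z + D1 z * dD1 z)) => x /inr/sys[_ a _ _].
    exact: derM.
  have [p0 p0s hp0] := EVT_max ss c0'.
  have [p1 p1s hp1] := EVT_max ss c1'.
  have M0 z : - s <= z <= 0 -> `|D0 z| <= `|D0 p0|.
    by move=> hz; rewrite -ler_sqr ?nnegrE// !sqr_norm !expr2 hp0// in_itv.
  have M1 z : - s <= z <= 0 -> `|D1 z| <= `|D1 p1|.
    by move=> hz; rewrite -ler_sqr ?nnegrE// !sqr_norm !expr2 hp1// in_itv.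
  move: p0s p1s; rewrite !in_itv/= => p0s p1s.
  have H0 : `|D0 p0| <= k * `|D1 p1|.
    have [p00|p00] := eqVneq p0 0.
      by rewrite p00 D00 normr0 mulr_ge0.
    have [a _ e _] := sys _ (inr _ p0s).
    have pneg : p0 < 0 by rewrite lt_neqAle p00; case/andP: p0s.
    have dle : dD0 p0 * D0 p0 + D0 p0 * dD0 p0 <= 0.
      rewrite leNgt; apply/negP => dpos.
      have [z [z1 z2 z3]] := der_incr_at (derM a a) dpos (ltac:(lra) : 0 < - p0).
      have : D0 z * D0 z <= D0 p0 * D0 p0.
        by apply: hp0; rewrite in_itv/=; case/andP: p0s => ? ?; apply/andP; split; lra.
      by rewrite leNgt z3.
    have : B0 * `|D0 p0| ^+ 2 <= `|c0| * `|D0 p0| * `|D1 p0|.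
      apply: (@le_trans _ _ (c0 * D0 p0 * D1 p0)); last first.
        by rewrite (le_trans (ler_norm _))// !normrM.
      rewrite sqr_norm.
      have : 0 <= p0 * (dD0 p0 * D0 p0 + D0 p0 * dD0 p0) by apply: mulr_le0 => //; exact: ltW.
      have -> : p0 * (dD0 p0 * D0 p0 + D0 p0 * dD0 p0) = 2 * D0 p0 * (p0 * dD0 p0) by ring.
      by rewrite e expr2; lra.
    have [->|n0] := eqVneq (D0 p0) 0; first by rewrite normr0 mulr_ge0.
    have -> : B0 * `|D0 p0| ^+ 2 = `|D0 p0| * (`|D0 p0| * B0) by ring.
    have -> : `|c0| * `|D0 p0| * `|D1 p0| = `|D0 p0| * (`|c0| * `|D1 p0|) by ring.
    rewrite ler_pM2l ?normr_gt0// => h.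
    rewrite /k mulrAC ler_pdivlMr//; apply: le_trans h _.
    by rewrite ler_wpM2l// M1.
  have H1 : `|D1 p1| <= s * K * `|D1 p1|.
    have p10 : p1 <= 0 by case/andP: p1s.
    have [|c /andP[h1 h2] e] := @is_derive_MVT _ D1 dD1 p1 0 p10.
      move=> x /andP[h1 h2]; have [|_ ? _ _] := sys x => //.
      by apply: inr; rewrite h2 (le_trans _ h1)//; case/andP: p1s.
    have hc : - s <= c <= 0 by rewrite h2 (le_trans _ h1)//; case/andP: p1s.
    have {}e : D1 p1 = dD1 c * p1 by move: e; rewrite D10 !sub0r mulrN => /oppr_inj.
    rewrite [X in `|X| <= _]e.
    have [_ _ _ e1] := sys _ (inr _ hc).
    rewrite normrM [X in X <= _]mulrC -mulrA.
    apply: ler_pM => //.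
      by rewrite ler0_norm//; case/andP: p1s; lra.
    apply: (@le_trans _ _ (`|(1 - c) * dD1 c|)).
      by rewrite normrM ler_peMl// ger0_norm; lra.
    rewrite e1 subr0 (le_trans (ler_normB _ _))// !normrM /K mulrDl.
    rewrite lerD// ?ler_wpM2l ?M1// -mulrA ler_wpM2l// (le_trans _ H0)//.
    exact: M0.
  have D1p : `|D1 p1| = 0.
    have n1 := normr_ge0 (D1 p1).
    have : s * K * `|D1 p1| <= 1 / 2 * `|D1 p1| by rewrite ler_wpM2r.
    by lra.
  move=> z hz; split; apply/eqP; rewrite -normr_le0.
    by rewrite (le_trans (M0 _ hz))// (le_trans H0)// D1p mulr0.
  by rewrite (le_trans (M1 _ hz))// D1p.
move=> z /andP[z1 z2].
have [zs|zs] := leP (- s) z; first by apply: small; rewrite zs.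
have [D0s D1s] := small (- s) (ltac:(rewrite lexx; lra)).
have neg : - s < 0 by rewrite oppr_lt0.
apply: (@zsys_unique D0 D1 dD0 dD1 (- r) (- s) (- s)) => //.
- by rewrite lexx andbT lerN2.
- by lra.
- by right.
- by move=> y /andP[y1 y2]; apply: sys; rewrite y1; lra.
- by rewrite z1 (ltW zs).
Qed.

End System.

(** * Power series solutions *)

Section WSeries.
Variable R : realType.
Variables (c0 c1 s0 s1 : R).
Implicit Types (B w z : R).
Hypotheses (c0_ge0 : 0 <= c0) (c1_ge0 : 0 <= c1).

(** The two coefficient sequences of the solution in powers of w = z/(z - 1),
    computed together: the coefficient of the second component comes first, as
    the other one depends on it.  The second component is 0 at w = 0. *)
Fixpoint wcoef (B0 B1 : R) n : R * R :=
  if n is m.+1 then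
    let p := wcoef B0 B1 m in
    let v := ((m%:R - B1) * p.2 + c1 * p.1 + (m == 0)%:R * s1) / m.+1%:R in
    ((m%:R * p.1 + c0 * v) / (m.+1%:R + B0), v)
  else (s0 / B0, 0).

Definition wu B0 B1 n := (wcoef B0 B1 n).1.
Definition wv B0 B1 n := (wcoef B0 B1 n).2.
Definition W0 B0 B1 := psum (wu B0 B1).
Definition W1 B0 B1 := psum (wv B0 B1).

Lemma wu_rec B0 B1 n : 0 < B0 ->
  (n%:R + B0) * wu B0 B1 n =
  n.-1%:R * wu B0 B1 n.-1 + c0 * wv B0 B1 n + (n == 0)%:R * s0.
Proof.
move=> B00; case: n => [|n].
  by rewrite /wu /wv/= !mul0r !add0r mulr0 add0r mul1r mulrC divfK// gt_eqF.
by rewrite /wu /wv/= mul0r addr0 mulrC divfK// gt_eqF// ltr_wpDl.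
Qed.

Lemma wv_rec B0 B1 n : n.+1%:R * wv B0 B1 n.+1 =
  (n%:R - B1) * wv B0 B1 n + c1 * wu B0 B1 n + (n == 0)%:R * s1.
Proof. by rewrite /wu /wv/= mulrC divfK. Qed.

Let Cst (bm B : R) := B + c1 * (c0 + 1) / bm + 1.

Lemma Cst_ge1 bm B : 0 < bm -> 0 <= B -> 1 <= Cst bm B.
Proof.
move=> b0 B_0; rewrite /Cst lerDr addr_ge0// divr_ge0 ?mulr_ge0 ?(ltW b0)//.
by rewrite addr_ge0.
Qed.

Lemma wcoef_bound bm B B0 B1 n : 0 < bm -> bm <= B0 -> `|B1| <= B ->
  `|wu B0 B1 n| <= (c0 + 1) / bm * (`|s0| + `|s1|) * majorant (Cst bm B) n /\
  `|wv B0 B1 n| <= (`|s0| + `|s1|) * majorant (Cst bm B) n.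
Proof.
move=> bm0 bB hB.
have C1 : 1 <= Cst bm B by rewrite Cst_ge1// (le_trans _ hB).
have ge1 k : 1 <= majorant (Cst bm B) k by exact: majo_ge1.
apply: (@majo_rec R (wu B0 B1) (wv B0 B1) (fun n => (n == 0)%:R * s0)
  (fun n => (n == 0)%:R * s1) B0 B1) => //.
- by move=> k; rewrite wu_rec//; exact: lt_le_trans bB.
- by move=> k; rewrite wv_rec.
- move=> k; rewrite normrM normr_nat; apply: (@le_trans _ _ (`|s0| + `|s1|)).
    by case: (k == 0); rewrite ?mul1r ?mul0r ?lerDl ?addr_ge0.
  by rewrite ler_peMr ?addr_ge0.
- move=> k; rewrite normrM normr_nat; apply: (@le_trans _ _ (`|s0| + `|s1|)).
    by case: (k == 0); rewrite ?mul1r ?mul0r ?lerDr ?addr_ge0.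
  by rewrite ler_peMr ?addr_ge0.
Qed.

Lemma rad_wu B0 B1 : 0 < B0 -> radius_ge 1 (wu B0 B1).
Proof.
move=> B00; have C1 := @Cst_ge1 B0 `|B1| B00 (normr_ge0 _).
apply: (@rad_le _ _ _ (majorant (Cst B0 `|B1|)) ((c0 + 1) / B0 * (`|s0| + `|s1|))).
- exact: rad_majo.
- by move=> n; have [] := @wcoef_bound B0 `|B1| B0 B1 n B00 (lexx _) (lexx _).
- by move=> n; apply: majo_ge0; lra.
Qed.

Lemma rad_wv B0 B1 : 0 < B0 -> radius_ge 1 (wv B0 B1).
Proof.
move=> B00; have C1 := @Cst_ge1 B0 `|B1| B00 (normr_ge0 _).
apply: (@rad_le _ _ _ (majorant (Cst B0 `|B1|)) (`|s0| + `|s1|)).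
- exact: rad_majo.
- by move=> n; have [] := @wcoef_bound B0 `|B1| B0 B1 n B00 (lexx _) (lexx _).
- by move=> n; apply: majo_ge0; lra.
Qed.

(** The difference of the coefficients for two parameters satisfies the same
    recursion, with sources proportional to the parameter difference. *)
Lemma wcoef_lip B0' B1' : 0 < B0' -> exists K C, [/\ 0 <= K, 1 <= C &
  forall B0 B1 n, B0' / 2 <= B0 -> `|B1| <= `|B1'| + 1 ->
   `|wu B0 B1 n - wu B0' B1' n| <= K * (`|B0 - B0'| + `|B1 - B1'|) * majorant C n /\
   `|wv B0 B1 n - wv B0' B1' n| <= K * (`|B0 - B0'| + `|B1 - B1'|) * majorant C n].
Proof.
move=> B0'0; pose bm := B0' / 2; pose B := `|B1'| + 1.
have bm0 : 0 < bm by rewrite divr_gt0.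
have hB : 0 <= B by rewrite addr_ge0.
have C1 := Cst_ge1 bm0 hB.
set M := ((c0 + 1) / bm + 1) * (`|s0| + `|s1|).
have kb : 0 <= (c0 + 1) / bm by rewrite divr_ge0 ?(ltW bm0)// addr_ge0.
have M0 : 0 <= M by rewrite mulr_ge0 ?addr_ge0.
exists (((c0 + 1) / bm + 1) * M), (Cst bm B); split => //.
  by rewrite mulr_ge0// addr_ge0.
move=> B0 B1 n h0 h1.
have P0 k : 0 <= majorant (Cst bm B) k by apply: majo_ge0; lra.
have bnd k : `|wu B0' B1' k| <= M * majorant (Cst bm B) k /\
             `|wv B0' B1' k| <= M * majorant (Cst bm B) k.
  have [|| a b] := @wcoef_bound bm B B0' B1' k bm0; rewrite /bm /B; [lra|lra|].
  split; [apply: le_trans a _|apply: le_trans b _]; rewrite ler_wpM2r//.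
    by rewrite /M [leRHS]mulrDl mul1r lerDl addr_ge0.
  by rewrite /M [leRHS]mulrDl mul1r lerDr mulr_ge0// addr_ge0.
set S := M * (`|B0 - B0'| + `|B1 - B1'|).
have [||||||a b] := @majo_rec R (fun n => wu B0 B1 n - wu B0' B1' n)
  (fun n => wv B0 B1 n - wv B0' B1' n)
  (fun n => - (B0 - B0') * wu B0' B1' n) (fun n => - (B1 - B1') * wv B0' B1' n)
  B0 B1 c0 c1 S bm B bm0 h0 h1 c0_ge0 c1_ge0 _ _ _ _ _ _ n.
- by rewrite mulr_ge0// addr_ge0.
- by rewrite /wv/= subrr.
- move=> k.
  have B00 : 0 < B0 by exact: lt_le_trans h0.
  have := @wu_rec B0 B1 k B00; have := @wu_rec B0' B1' k B0'0 => e e'.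
  by rewrite !mulrBr; lra.
- by move=> k; rewrite mulrBr !wv_rec; ring.
- move=> k; rewrite normrM normrN; have [hk _] := bnd k.
  rewrite [X in X <= _]mulrC; apply: (@le_trans _ _ (M * majorant (Cst bm B) k * `|B0 - B0'|)).
    by rewrite ler_wpM2r.
  by rewrite /S mulrAC ler_wpM2r// ler_wpM2l// lerDl.
- move=> k; rewrite normrM normrN; have [_ hk] := bnd k.
  rewrite [X in X <= _]mulrC; apply: (@le_trans _ _ (M * majorant (Cst bm B) k * `|B1 - B1'|)).
    by rewrite ler_wpM2r.
  by rewrite /S mulrAC ler_wpM2r// ler_wpM2l// lerDr.
have S0 : 0 <= S by rewrite mulr_ge0// addr_ge0.
rewrite -!(mulrA _ M) -/S; split.
  by apply: le_trans a _; rewrite ler_wpM2r// ler_wpM2r// lerDl.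
by apply: le_trans b _; rewrite ler_wpM2r// ler_peMl// lerDr.
Qed.

Lemma W0_ode B0 B1 w : 0 < B0 -> `|w| < 1 ->
  w * (1 - w) * psum (pseries_diffs (wu B0 B1)) w =
  - B0 * W0 B0 B1 w + c0 * W1 B0 B1 w + s0.
Proof.
move=> B00 w1.
rewrite -(@ode_psum _ 1 _ (wv B0 B1) 0 1 (-1) (- B0) c0 s0 w (rad_wu _ B00) (rad_wv _ B00) w1).
  by congr (_ * _); ring.
by move=> n; have := @wu_rec B0 B1 n B00 => e; lra.
Qed.

Lemma W1_ode B0 B1 w : 0 < B0 -> `|w| < 1 ->
  (1 - w) * psum (pseries_diffs (wv B0 B1)) w =
  - B1 * W1 B0 B1 w + c1 * W0 B0 B1 w + s1.
Proof.
move=> B00 w1.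
rewrite -(@ode_psum _ 1 _ (wu B0 B1) 1 (-1) 0 (- B1) c1 s1 w (rad_wv _ B00) (rad_wu _ B00) w1).
  by congr (_ * _); ring.
by move=> n; have := @wv_rec B0 B1 n => e; lra.
Qed.

Definition wz (z : R) : R := z * (z - 1)^-1.

(** The half line z < 1/2 contains all z <= 0 and a neighbourhood of the level,
    where the flow may end up just after it crosses. *)
Lemma wz_lt1 z : z < 1 / 2 -> `|wz z| < 1.
Proof.
move=> z1; rewrite /wz normrM normfV.
have h : z - 1 < 0 by lra.
rewrite (ltr0_norm h) ltr_pdivrMr ?oppr_gt0// mul1r ltr_norml; apply/andP; split; lra.
Qed.

Lemma wz_der z : z < 1 / 2 -> is_derive z (1 : R) wz (- ((z - 1) ^- 2)).
Proof.
move=> z1; have h : z - 1 != 0 by rewrite lt_eqF//; lra.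
have d1 : is_derive z (1 : R) (fun y => y - 1) (1 : R).
  by apply: is_derive_eq (derB (derid z) (derC 1 z)) _; rewrite subr0.
rewrite (_ : wz = fun y => y * (y - 1)^-1)//.
by apply: is_derive_eq (derM (derid z) (@derV R (fun y => y - 1) z 1 h d1)) _; field.
Qed.

Definition dW0 B0 B1 (z : R) : R :=
  psum (pseries_diffs (wu B0 B1)) (wz z) * (- ((z - 1) ^- 2)).
Definition dW1 B0 B1 (z : R) : R :=
  psum (pseries_diffs (wv B0 B1)) (wz z) * (- ((z - 1) ^- 2)).

Lemma dW_continuous B0 B1 z : 0 < B0 -> z < 1 / 2 ->
  {for z, continuous (dW0 B0 B1)} /\ {for z, continuous (dW1 B0 B1)}.
Proof.
move=> B00 z1; have w1 := wz_lt1 z1; have h : z - 1 != 0 by rewrite lt_eqF//; lra.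
have dz : is_derive z (1 : R) (fun y => y - 1) (1 : R).
  by apply: is_derive_eq (derB (derid z) (derC 1 z)) _; rewrite subr0.
have dq : is_derive z (1 : R) (fun y => - ((y - 1) ^- 2)) (2 * (z - 1)^-1 ^+ 3).
  have h2 : (z - 1) ^+ 2 != 0 by rewrite expf_neq0.
  have := derV (f := fun y => (y - 1) ^+ 2) h2 (derM dz dz).
  move=> /(derB (derC 0 z)) dd.
  rewrite (_ : (fun y => - ((y - 1) ^- 2)) = (fun y => 0 - ((y - 1) ^+ 2)^-1)).
    by apply: is_derive_eq dd _; field.
  by apply/funext => y; rewrite sub0r.
have cu := psum_is_derive (rad_diffs (rad_wu B1 B00)) w1.
have cv := psum_is_derive (rad_diffs (rad_wv B1 B00)) w1.
split.
  exact: (der_cont (derM (@der_comp R (psum (pseries_diffs (wu B0 B1))) wz z _ _ cu (wz_der z1)) dq)).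
exact: (der_cont (derM (@der_comp R (psum (pseries_diffs (wv B0 B1))) wz z _ _ cv (wz_der z1)) dq)).
Qed.

Lemma W_zsys B0 B1 : 0 < B0 -> forall z, z < 1 / 2 ->
  zsys B0 B1 c0 c1 s0 s1 (fun z => W0 B0 B1 (wz z)) (fun z => W1 B0 B1 (wz z))
    (dW0 B0 B1) (dW1 B0 B1) z.
Proof.
move=> B00.
move=> z z1; have w1 := wz_lt1 z1; have h : z - 1 != 0 by rewrite lt_eqF//; lra.
split.
- exact: (der_comp (psum_is_derive (rad_wu _ B00) w1) (wz_der z1)).
- exact: (der_comp (psum_is_derive (rad_wv _ B00) w1) (wz_der z1)).
- rewrite /dW0 -W0_ode// [RHS]mulrC -[LHS]mulrCA; congr (_ * _).
  by rewrite /wz; field.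
- have := W1_ode B1 B00 w1 => e.
  have -> : (1 - z) * dW1 B0 B1 z = - ((1 - wz z) * psum (pseries_diffs (wv B0 B1)) (wz z)).
    by rewrite /dW1 /wz; field.
  by rewrite e; ring.
Qed.

End WSeries.

Section ZSeries.
Variable R : realType.
Variables (B0 B1 c0 c1 nu s0 s1 : R).
Hypotheses (B0_gt0 : 0 < B0) (c0_ge0 : 0 <= c0) (c1_ge0 : 0 <= c1).

Definition zu_of (v : R) n : R := (c0 * v + (n == 0)%:R * s0) / (n%:R + B0).
(** The solution in powers of z with value nu of the second component at 0.
    Its radius is only 1; it is the one whose coefficients are explicit. *)
Fixpoint zv n : R :=
  if n is m.+1 then
    ((m%:R + B1) * zv m - c1 * zu_of (zv m) m - (m == 0)%:R * s1) / m.+1%:R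
  else nu.
Definition zu n := zu_of (zv n) n.
Definition Z0 := psum zu.
Definition Z1 := psum zv.

Lemma zu_rec n : (n%:R + B0) * zu n = c0 * zv n + (n == 0)%:R * s0.
Proof. by rewrite /zu /zu_of mulrC divfK// gt_eqF// ltr_wpDl. Qed.

Lemma zv_rec n : n.+1%:R * zv n.+1 =
  (n%:R + B1) * zv n - c1 * zu n - (n == 0)%:R * s1.
Proof. by rewrite /= mulrC divfK. Qed.

(** Majorants again; here the first component is a multiple of the second up
    to the source, so a single recursion has to be bounded. *)
Lemma rad_z : radius_ge 1 zu /\ radius_ge 1 zv.
Proof.
pose C := `|B1| + c1 * ((c0 + 1) / B0) + 1 + 1.
pose S := `|nu| + `|s0| + `|s1|.
have k0 : 0 <= (c0 + 1) / B0 by rewrite divr_ge0 ?(ltW B0_gt0)// addr_ge0.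
have C1 : 1 <= C by rewrite lerDr !addr_ge0// mulr_ge0.
have S0 : 0 <= S by rewrite !addr_ge0.
have ge1 k : 1 <= majorant C k by exact: majo_ge1.
have ge0 k : 0 <= majorant C k by apply: le_trans (ge1 k).
have src (s : R) k : `|s| <= S -> `|(k == 0)%:R * s| <= S * majorant C k.
  move=> hs; rewrite normrM normr_nat; apply: (@le_trans _ _ S); last by rewrite ler_peMr.
  by case: (k == 0); rewrite ?mul1r ?mul0r.
have hs0 : `|s0| <= S by rewrite /S; have := normr_ge0 nu; have := normr_ge0 s1; lra.
have hs1 : `|s1| <= S by rewrite /S; have := normr_ge0 nu; have := normr_ge0 s0; lra.
have hnu : `|nu| <= S by rewrite /S; have := normr_ge0 s0; have := normr_ge0 s1; lra.
have hu n : `|zv n| <= S * majorant C n -> `|zu n| <= (c0 + 1) / B0 * S * majorant C n.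
  move=> hv; have nb : 0 < n%:R + B0 by rewrite ltr_wpDl.
  rewrite -(ler_pM2l nb) -[X in X * `|_| <= _](gtr0_norm nb) -normrM zu_rec.
  apply: (@le_trans _ _ (B0 * ((c0 + 1) / B0 * S * majorant C n))).
    have -> : B0 * ((c0 + 1) / B0 * S * majorant C n) = c0 * (S * majorant C n) + S * majorant C n.
      by field; rewrite gt_eqF.
    rewrite (le_trans (ler_normD _ _))// lerD ?src//.
    by rewrite normrM (ger0_norm c0_ge0) ler_wpM2l.
  by rewrite ler_wpM2r ?lerDr// mulr_ge0// mulr_ge0.
have hv n : `|zv n| <= S * majorant C n.
  elim: n => [|n IH]; first by rewrite /= mulr1.
  have n1 : 0 < n.+1%:R :> R by [].
  rewrite -(ler_pM2l n1) -[X in X * `|_| <= _](gtr0_norm n1) -normrM zv_rec.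
  have -> : n.+1%:R * (S * majorant C n.+1) = S * majorant C n * (C + n%:R).
    by rewrite /=; field.
  have h1 : `|(n%:R + B1) * zv n| <= (n%:R + `|B1|) * (S * majorant C n).
    by rewrite normrM ler_pM// (le_trans (ler_normD _ _))// normr_nat.
  have h2 : `|c1 * zu n| <= c1 * ((c0 + 1) / B0 * S * majorant C n).
    by rewrite normrM (ger0_norm c1_ge0) ler_wpM2l// hu.
  have h3 := src _ n hs1.
  have h4 : 0 <= S * majorant C n by rewrite mulr_ge0.
  rewrite (le_trans (ler_normB _ _))//.
  apply: (@le_trans _ _ ((n%:R + `|B1|) * (S * majorant C n) + c1 * ((c0 + 1) / B0 * S * majorant C n) + S * majorant C n)).
    by rewrite lerD// (le_trans (ler_normB _ _))// lerD.
  rewrite -subr_ge0 [X in 0 <= X](_ : _ = S * majorant C n)//.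
  by rewrite /C; ring.
by split; [apply: (@rad_le _ _ _ (majorant C) ((c0 + 1) / B0 * S))|apply: (@rad_le _ _ _ (majorant C) S)] => //;
  [exact: rad_majo|move=> n; apply: hu|exact: rad_majo].
Qed.

Lemma Z_zsys : exists d0 d1, forall z, `|z| < 1 ->
  zsys B0 B1 c0 c1 s0 s1 Z0 Z1 d0 d1 z.
Proof.
have [ru rv] := rad_z.
exists (psum (pseries_diffs zu)), (psum (pseries_diffs zv)) => z z1; split.
- exact: psum_is_derive z1.
- exact: psum_is_derive z1.
- rewrite -(@ode_psum _ 1 _ zv 0 1 0 (- B0) c0 s0 z ru rv z1).
    by congr (_ * _); ring.
  by move=> n; have := zu_rec n => e; lra.
- have -> : B1 * Z1 z - c1 * Z0 z - s1 = B1 * Z1 z + (- c1) * Z0 z + - s1 by ring.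
  rewrite -(@ode_psum _ 1 _ zu 1 (-1) 0 B1 (- c1) (- s1) z rv ru z1).
    by congr (_ * _); ring.
  by move=> n; have := zv_rec n => e; lra.
Qed.

Lemma Z1_at0 : Z1 0 = nu.
Proof. exact: psum_at0. Qed.

End ZSeries.

(** * Analyticity and the Gauss series *)

Section Analytic.
Variable R : realType.
Implicit Types (z t e : R) (u : R^nat).

Lemma near_dist z e : 0 < e -> \forall y \near z, `|y - z| < e.
Proof. by move=> e0; apply/nbhs_ballP; exists e => //= y; rewrite /ball/= distrC. Qed.

Section Local.
Variables (B0 B1 c0 c1 z0 : R).
Hypotheses (z00 : z0 != 0) (z01 : z0 < 1).

(** Coefficients at an ordinary point z0 of the solution with value (x, y). *)
Fixpoint lcoef (x y : R) n : R * R :=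
  if n is m.+1 then
    let p := lcoef x y m in
    ((- (B0 + m%:R) * p.1 + c0 * p.2) / (z0 * m.+1%:R),
     ((B1 + m%:R) * p.2 - c1 * p.1) / ((1 - z0) * m.+1%:R))
  else (x, y).

Let K := (1 + `|B0| + `|B1| + `|c0| + `|c1|) * (`|z0|^-1 + (1 - z0)^-1).

Lemma lcoef_K_gt0 : 0 < K.
Proof.
rewrite /K; apply: mulr_gt0; first by rewrite -!addrA ltr_pwDl// !addr_ge0.
by rewrite addr_gt0 ?invr_gt0 ?subr_gt0 ?normr_gt0.
Qed.

Lemma lcoef_bound x y n :
  `|(lcoef x y n).1| <= (`|x| + `|y|) * K ^+ n /\
  `|(lcoef x y n).2| <= (`|x| + `|y|) * K ^+ n.
Proof.
have z1p : 0 < 1 - z0 by rewrite subr_gt0.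
have nz0 : 0 < `|z0| by rewrite normr_gt0.
elim: n => [|n [IH1 IH2]]; first by rewrite expr0 mulr1 lerDl lerDr/=.
set M := (`|x| + `|y|) * K ^+ n in IH1 IH2.
have M0 : 0 <= M by apply: le_trans IH1.
have n1 : 0 < n.+1%:R :> R by [].
have nn : n.+1%:R = n%:R + 1 :> R by rewrite natr1.
have n0 : 0 <= n%:R :> R by [].
set Kc := 1 + `|B0| + `|B1| + `|c0| + `|c1|.
have p0 := normr_ge0 B0; have p1 := normr_ge0 B1.
have p2 := normr_ge0 c0; have p3 := normr_ge0 c1.
have Kc0 : 0 <= Kc by rewrite /Kc; lra.
have key b c p r (d : R) : `|b| + `|c| + 1 <= Kc -> `|p| <= M -> `|r| <= M -> 0 < `|d| ->
    `|d|^-1 <= `|z0|^-1 + (1 - z0)^-1 ->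
    `|((b + n%:R) * p + c * r) / (d * n.+1%:R)| <= (`|x| + `|y|) * K ^+ n.+1.
  move=> hk hp hr d0 hd.
  rewrite normrM normfV normrM normr_nat ler_pdivrMr ?mulr_gt0//.
  rewrite exprSr mulrA -/M.
  apply: (@le_trans _ _ ((`|b| + n%:R + `|c|) * M)).
    rewrite (le_trans (ler_normD _ _))// [leRHS]mulrDl !normrM lerD//; last first.
      by rewrite ler_wpM2l.
    by rewrite ler_pM// (le_trans (ler_normD _ _))// normr_nat.
  have -> : M * K * (`|d| * n.+1%:R) =
     (Kc * n.+1%:R) * ((`|z0|^-1 + (1 - z0)^-1) * `|d|) * M by rewrite /K -/Kc; ring.
  rewrite ler_wpM2r//.
  apply: (@le_trans _ _ (Kc * n.+1%:R)).
    by rewrite nn; have := normr_ge0 b; have := normr_ge0 c; nra.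
  rewrite ler_peMr ?mulr_ge0//.
  by rewrite -[leLHS](mulVf (lt0r_neq0 d0)) ler_wpM2r.
split => /=.
  have -> : - (B0 + n%:R) * (lcoef x y n).1 = ((B0 + n%:R) * - (lcoef x y n).1) by ring.
  by apply: key; rewrite ?normrN// ?lerDl ?invr_ge0 ?(ltW z1p)// /Kc; lra.
rewrite -mulNr; apply: key => //.
- by rewrite normrN /Kc; lra.
- by rewrite gtr0_norm.
- by rewrite gtr0_norm// lerDr invr_ge0.
Qed.

(** Near z0 the solution is the sum of its local power series, by uniqueness. *)
Lemma analytic_zsys f0 f1 d0 d1 e : 0 < e ->
  (forall z, `|z - z0| < e -> zsys B0 B1 c0 c1 0 0 f0 f1 d0 d1 z) ->
  analytic_at f0 z0 /\ analytic_at f1 z0.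
Proof.
move=> e0 sys; have K0 := lcoef_K_gt0.
pose u n := (lcoef (f0 z0) (f1 z0) n).1.
pose v n := (lcoef (f0 z0) (f1 z0) n).2.
have Kn n : 0 <= K ^+ n by rewrite exprn_ge0// ltW.
have ru : radius_ge K^-1 u.
  by apply: (@rad_le _ _ _ _ (`|f0 z0| + `|f1 z0|) (rad_geo K0) _ Kn) => n; have [] := lcoef_bound (f0 z0) (f1 z0) n.
have rv : radius_ge K^-1 v.
  by apply: (@rad_le _ _ _ _ (`|f0 z0| + `|f1 z0|) (rad_geo K0) _ Kn) => n; have [] := lcoef_bound (f0 z0) (f1 z0) n.
have nz0 : 0 < `|z0| by rewrite normr_gt0.
have z1p : 0 < 1 - z0 by rewrite subr_gt0.
pose eta := Num.min (Num.min e K^-1) (Num.min `|z0| (1 - z0)) / 2.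
have Ki : 0 < K^-1 by rewrite invr_gt0.
have m0 : 0 < Num.min (Num.min e K^-1) (Num.min `|z0| (1 - z0)).
  by rewrite !lt_min e0 Ki nz0 z1p.
have eta0 : 0 < eta by rewrite divr_gt0.
have [he hK hz h1] : [/\ eta < e, eta < K^-1, eta < `|z0| & eta < 1 - z0].
  have : eta < Num.min (Num.min e K^-1) (Num.min `|z0| (1 - z0)) by rewrite /eta; lra.
  by rewrite !lt_min => /andP[/andP[-> ->] /andP[-> ->]].
have shd (c : R^nat) z : radius_ge K^-1 c -> `|z - z0| < K^-1 ->
    is_derive z (1 : R) (fun y => psum c (y - z0)) (psum (pseries_diffs c) (z - z0)).
  move=> rc zK.
  have d1' : is_derive z (1 : R) (fun y => y - z0) (1 : R).
    by apply: is_derive_eq (derB (derid z) (derC z0 z)) _; rewrite subr0.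
  by apply: is_derive_eq (@der_comp R (psum c) (fun y => y - z0) z _ _ (psum_is_derive rc zK) d1') _; rewrite mulr1.
have sysp z : `|z - z0| < K^-1 -> zsys B0 B1 c0 c1 0 0
    (fun y => psum u (y - z0)) (fun y => psum v (y - z0))
    (fun y => psum (pseries_diffs u) (y - z0))
    (fun y => psum (pseries_diffs v) (y - z0)) z.
  move=> zK; split; [exact: shd|exact: shd| |].
  - rewrite -(@ode_psum _ _ _ v z0 1 0 (- B0) c0 0 (z - z0) ru rv zK).
      by congr (_ * _); ring.
    by move=> n; rewrite /u /v/=; field; rewrite z00/= [1 + _]addrC natr1 pnatr_eq0.
  - have -> : B1 * psum v (z - z0) - c1 * psum u (z - z0) - 0 =
       B1 * psum v (z - z0) + (- c1) * psum u (z - z0) + 0 by ring.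
    rewrite -(@ode_psum _ _ _ u (1 - z0) (-1) 0 B1 (- c1) 0 (z - z0) rv ru zK).
      by congr (_ * _); ring.
    by move=> n; rewrite /u /v/=; field; rewrite (gt_eqF z1p)/= [1 + _]addrC natr1 pnatr_eq0.
have inb z : z0 - eta <= z <= z0 + eta -> `|z - z0| <= eta.
  by move=> h; rewrite ler_distl.
have eqs z : z0 - eta <= z <= z0 + eta -> f0 z = psum u (z - z0) /\ f1 z = psum v (z - z0).
  move=> hz'.
  suff [h h'] : f0 z - psum u (z - z0) = 0 /\ f1 z - psum v (z - z0) = 0.
    by split; apply/eqP; rewrite -subr_eq0 ?h ?h'.
  pose D0 y := f0 y - psum u (y - z0); pose D1 y := f1 y - psum v (y - z0).
  apply: (@zsys_unique R B0 B1 c0 c1 D0 D1 (fun y => d0 y - psum (pseries_diffs u) (y - z0))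
    (fun y => d1 y - psum (pseries_diffs v) (y - z0)) (z0 - eta) (z0 + eta) z0) => //.
  - by rewrite lerDl lerBlDr lerDl (ltW eta0).
  - by lra.
  - have [z0n|z0p] := ltP z0 0; [right|left].
      by move: hz; rewrite ltr0_norm//; lra.
    by move: hz; rewrite ger0_norm//; lra.
  - move=> y /inb hy; rewrite -(subrr (0 : R)).
    by apply: zsysB; [apply: sys|apply: sysp]; apply: le_lt_trans hy _.
  - by rewrite /D0 subrr psum_at0 subrr.
  - by rewrite /D1 subrr psum_at0 subrr.
have nr : \forall z \near z0, z0 - eta <= z <= z0 + eta.
  near=> z; have : `|z - z0| < eta by near: z; exact: near_dist.
  by rewrite ltr_distl => /andP[a b]; rewrite !ltW.
split; [exists u|exists v]; near=> z.
- have hz' : z0 - eta <= z <= z0 + eta by near: z.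
  have [-> _] := eqs _ hz'; apply: (rad_psum ru); exact: le_lt_trans (inb _ hz') _.
- have hz' : z0 - eta <= z <= z0 + eta by near: z.
  have [_ ->] := eqs _ hz'; apply: (rad_psum rv); exact: le_lt_trans (inb _ hz') _.
Unshelve. all: by end_near. Qed.

End Local.

Lemma near_analytic (f g : R -> R) z0 : (\forall z \near z0, f z = g z) ->
  analytic_at f z0 -> analytic_at g z0.
Proof. by move=> fg [u hu]; exists u; near=> z; rewrite -(near fg z)//; near: z.
Unshelve. all: by end_near. Qed.

Lemma cvg_pseries_rad u t : cvgn (pseries u t) -> radius_ge `|t| u.
Proof.
move=> /cvg_series_cvg_0 h r r0 rt; have [M [_ HM]] := cvg_seq_bounded (cvgP _ h).
exists (M + 1) => n.
have := HM (M + 1) (ltac:(by rewrite ltrDl)) n I; rewrite /= normrM normrX.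
by apply: le_trans; rewrite ler_wpM2l// lerXn2r ?nnegrE// ltW.
Qed.

(** Up to a factor, the n-th coefficient is the right limit at 0 of the n-th
    derivative. *)
Lemma psum_zero n : forall u (de : R), 0 < de -> radius_ge de u ->
  (forall t, 0 < t -> t < de -> psum u t = 0) -> u n = 0.
Proof.
elim: n => [|n IH] u de de0 ru u0.
  rewrite -psum_at0.
  have c : psum u t @[t --> 0^'+] --> psum u 0.
    apply: cvg_at_right_filter; apply: (psum_continuous ru); by rewrite normr0.
  have c0 : psum u t @[t --> 0^'+] --> (0 : R).
    apply/cvgrPdist_lt => eps eps0; near=> t.
    have t0 : 0 < t by near: t; exact: nbhs_right_gt.
    have t1 : t < de by near: t; exact: nbhs_right_lt.
    by rewrite u0// subrr normr0.
  exact: (cvg_unique _ c c0).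
have : pseries_diffs u n = 0.
  apply: (IH _ de) => //; first exact: rad_diffs.
  move=> t t0 tde; have nt : `|t| < de by rewrite gtr0_norm.
  have [_ <-] := psum_is_derive ru nt.
  rewrite -(derive_cst (0 : R) t (1 : R)); apply: near_eq_derive.
  near=> s; rewrite u0//=; near: s; [exact: lt_nbhsr|exact: lt_nbhsl].
by rewrite /pseries_diffs => /eqP; rewrite mulf_eq0 pnatr_eq0/= => /eqP.
Unshelve. all: by end_near. Qed.

Lemma analytic_null (u : R^nat) (H : R -> R) z0 e : 0 < e ->
  (\forall z \near z0, pseries u (z - z0) @ \oo --> H z) ->
  (forall z, z0 < z -> z < z0 + e -> H z = 0) -> \forall z \near z0, H z = 0.
Proof.
move=> e0 /nbhs_ballP[d /= d0 hd] H0.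
pose m := Num.min d e / 2.
have m0 : 0 < m by rewrite divr_gt0// lt_min d0.
have md : m < d /\ m < e.
  have : m < Num.min d e by rewrite /m; have : 0 < Num.min d e by [rewrite lt_min d0]; lra.
  by rewrite lt_min => /andP[].
have hds t : `|t| < d -> pseries u t @ \oo --> H (z0 + t).
  move=> td; have := hd (z0 + t); rewrite /ball/= opprD addrA subrr sub0r normrN.
  by move=> /(_ td); rewrite addrAC subrr add0r.
have rm : radius_ge m u.
  rewrite -(gtr0_norm m0); apply: cvg_pseries_rad; apply/cvg_ex; exists (H (z0 + m)).
  by apply: hds; rewrite gtr0_norm//; case: md.
have u0 n : u n = 0.
  apply: (@psum_zero n u m) => // t t0 tm.
  have td : `|t| < d by rewrite gtr0_norm//; case: md => ? _; lra.
  rewrite /psum (cvg_lim _ (hds _ td))//; apply: H0; first by rewrite ltrDl.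
  by rewrite ltrD2l; case: md => _ ?; lra.
near=> z.
have zd : `|z - z0| < d.
  by near: z; exact: near_dist.
have := hds _ zd; rewrite [z0 + _]addrC subrK => h.
have h0 : pseries u (z - z0) @ \oo --> (0 : R).
  rewrite (_ : pseries _ _ = fun=> 0); first exact: cvg_cst.
  by apply/funext => k; rewrite /pseries /series/= big1// => i _; rewrite u0 mul0r.
exact: (cvg_unique _ h h0).
Unshelve. all: by end_near. Qed.

(** At the supremum of the points below 1 where G and G' differ, they agree just
    to the right, hence on a neighbourhood by [analytic_null]. *)
Lemma is_hypergeo_unique (b0 b1 c : R) (G G' : R -> R) :
  is_hypergeo b0 b1 c G -> is_hypergeo b0 b1 c G' ->
  forall z, z < 1 -> G z = G' z.
Proof.
move=> [g1 g2] [g1' g2'] z z1; apply: contrapT => Gz.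
have in1 y : `|y| < 1 -> G y = G' y.
  by move=> y1; exact: (cvg_unique _ (g1 _ y1) (g1' _ y1)).
pose A := [set y | y < 1 /\ G y <> G' y].
have A0 : A !=set0 by exists z.
have Aub : ubound A (- 1).
  move=> y [y1 yG]; rewrite leNgt; apply/negP => y2; apply: yG; apply: in1.
  by rewrite ltr_norml y2.
have hs : has_sup A by split => //; exists (- 1).
have s1 : sup A <= - 1 by exact: ge_sup.
have [u hu] := g2 (sup A) (ltac:(lra)); have [v hv] := g2' (sup A) (ltac:(lra)).
have : \forall y \near sup A, G y - G' y = 0.
  apply: (@analytic_null (fun n => u n - v n) (fun y => G y - G' y) _ 1 ltr01).
    near=> y.
    have a : pseries u (y - sup A) @ \oo --> G y by near: y.
    have b : pseries v (y - sup A) @ \oo --> G' y by near: y.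
    have := cvg_pseriesD a (@cvg_pseriesZ _ _ _ _ (-1) b).
    rewrite mulN1r; have -> // : (fun n => u n + -1 * v n) = (fun n => u n - v n).
    by apply/funext => n; rewrite mulN1r.
  move=> y y1 y2; apply/eqP; rewrite subr_eq0; apply/eqP; apply: contrapT => Gy.
  have : y <= sup A by apply: (ub_le_sup hs.2); split => //; lra.
  by rewrite leNgt y1.
move=> /nbhs_ballP[d /= d0 hd].
have [y yA yd] := sup_adherent d0 hs; have [y1 Gy] := yA.
apply: Gy; apply/eqP; rewrite -subr_eq0; apply/eqP; apply: hd.
have : y <= sup A by apply: (ub_le_sup hs.2).
by move=> h; rewrite /ball/= ger0_norm ?subr_ge0//; lra.
Unshelve. all: by end_near. Qed.

Lemma hypergeoE (b0 b1 c : R) G z : is_hypergeo b0 b1 c G -> z < 1 ->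
  hypergeo b0 b1 c z = G z.
Proof.
move=> hG z1; apply: (@is_hypergeo_unique b0 b1 c) => //.
by apply: (@getPex _ (is_hypergeo b0 b1 c)); exists G.
Qed.

End Analytic.

Section Pochhammer.
Variable R : realType.
Implicit Type b : R.

Lemma pochS b n : pochhammer b n.+1 = pochhammer b n * (b + n%:R).
Proof. by rewrite /pochhammer big_ord_recr. Qed.

Lemma pochSl b n : pochhammer b n.+1 = b * pochhammer (b + 1) n.
Proof.
rewrite /pochhammer big_ord_recl/= addr0; congr (_ * _).
by apply: eq_bigr => i _; rewrite /bump/= natrD addrA.
Qed.

Lemma poch_gt0 b n : 0 < b -> 0 < pochhammer b n.
Proof. by move=> b0; apply: prodr_gt0 => i _; rewrite ltr_wpDr. Qed.

End Pochhammer.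

Section Gauss.
Variable R : realType.
Variables (B0 B1 c0 c1 s0 s1 q bb0 bb1 : R).
Hypotheses (B0_gt0 : 0 < B0) (c0_gt0 : 0 < c0) (c1_ge0 : 0 <= c1).
Hypotheses (B0E : B0 = c0 + q * s0) (B1E : B1 = c1 + q * s1).
Hypotheses (bbD : bb0 + bb1 = B0 + B1) (bbM : bb0 * bb1 = B0 * B1 - c0 * c1).
Implicit Type z : R.

Let c0_ge0 : 0 <= c0. Proof. exact: ltW. Qed.

Let zsysB' t0 t1 f0 f1 df0 df1 g0 g1 dg0 dg1 z :
  zsys B0 B1 c0 c1 t0 t1 f0 f1 df0 df1 z -> zsys B0 B1 c0 c1 t0 t1 g0 g1 dg0 dg1 z ->
  zsys B0 B1 c0 c1 0 0 (fun y => f0 y - g0 y) (fun y => f1 y - g1 y)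
    (fun y => df0 y - dg0 y) (fun y => df1 y - dg1 y) z.
Proof. by move=> f g; have := zsysB f g; rewrite !subrr. Qed.

Lemma Z_unique nu t0 t1 f0 f1 df0 df1 z :
  (forall y, y < 1 / 2 -> zsys B0 B1 c0 c1 t0 t1 f0 f1 df0 df1 y) -> f1 0 = nu ->
  - 1 < z -> z <= 0 ->
  Z0 B0 B1 c0 c1 nu t0 t1 z = f0 z /\ Z1 B0 B1 c0 c1 nu t0 t1 z = f1 z.
Proof.
move=> hf f10 z1 z0.
have [e0 [e1 hZ]] := @Z_zsys R B0 B1 c0 c1 nu t0 t1 B0_gt0 c0_ge0 c1_ge0.
have [r zr r1] : exists2 r, - z < r & r < 1 by apply: exists_between; lra.
have r0 : 0 < r by lra.
have hy1 y : - r <= y <= 0 -> `|y| < 1.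
  by move=> /andP[y1 y2]; rewrite ltr_norml; apply/andP; split; lra.
have hy2 y : - r <= y <= 0 -> y < 1 / 2 by move=> /andP[y1 y2]; lra.
have [||a b] := @zsys_unique0 R B0 B1 c0 c1 B0_gt0
  (fun y => Z0 B0 B1 c0 c1 nu t0 t1 y - f0 y) (fun y => Z1 B0 B1 c0 c1 nu t0 t1 y - f1 y)
  _ _ r r0 (fun y hy => zsysB' (hZ y (hy1 y hy)) (hf y (hy2 y hy))) _ z _.
- by rewrite Z1_at0 f10 subrr.
- by rewrite z0 andbT; lra.
by split; apply/eqP; rewrite -subr_eq0 ?a ?b.
Qed.

Lemma Z_eq_W z : - 1 < z -> z <= 0 ->
  Z0 B0 B1 c0 c1 0 s0 s1 z = W0 c0 c1 s0 s1 B0 B1 (wz z) /\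
  Z1 B0 B1 c0 c1 0 s0 s1 z = W1 c0 c1 s0 s1 B0 B1 (wz z).
Proof.
apply: (Z_unique (@W_zsys R c0 c1 s0 s1 c0_ge0 c1_ge0 B0 B1 B0_gt0)).
by rewrite /wz mul0r /W1 psum_at0.
Qed.

(** Subtracting the constant solution 1 trades the value 1 at the level for
    sources proportional to q.  In this form the derivative at q = 0 needs only
    the continuity of the w-series in q. *)
Definition Q0 z : R := 1 - q * W0 c0 c1 s0 s1 B0 B1 (wz z).
Definition Q1 z : R := 1 - q * W1 c0 c1 s0 s1 B0 B1 (wz z).

Definition dQ0 (z : R) : R := 0 - q * dW0 c0 c1 s0 s1 B0 B1 z.
Definition dQ1 (z : R) : R := 0 - q * dW1 c0 c1 s0 s1 B0 B1 z.

Lemma Q_zsys z : z < 1 / 2 -> zsys B0 B1 c0 c1 0 0 Q0 Q1 dQ0 dQ1 z.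
Proof.
move=> z1; have hW := @W_zsys R c0 c1 s0 s1 c0_ge0 c1_ge0 B0 B1 B0_gt0.
have [a b c d] := hW z z1; split.
- exact: derB (derC 1 z) (derZ q a).
- exact: derB (derC 1 z) (derZ q b).
- rewrite /dQ0 sub0r mulrN mulrCA c /Q0 /Q1 B0E; ring.
- rewrite /dQ1 sub0r mulrN mulrCA d /Q0 /Q1 B1E; ring.
Qed.

Lemma Gauss_eq_Q z : - 1 < z -> z <= 0 ->
  Z0 B0 B1 c0 c1 1 0 0 z = Q0 z /\ Z1 B0 B1 c0 c1 1 0 0 z = Q1 z.
Proof.
by apply: (Z_unique Q_zsys); rewrite /Q1 /wz mul0r /W1 psum_at0 mulr0 subr0.
Qed.

(** Eliminating the first component leaves a two-term recursion with factor
    ((n + B0)(n + B1) - c0 c1)/((n + B0)(n + 1)), whose numerator is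
    (bb0 + n)(bb1 + n). *)
Lemma zv_hypergeo n : zv B0 B1 c0 c1 1 0 0 n = hypergeo_coef bb0 bb1 B0 n.
Proof.
elim: n => [|n IH].
  by rewrite /hypergeo_coef /pochhammer !big_ord0 /= fact0 !mulr1 divr1.
have n1 : n.+1%:R != 0 :> R by [].
have nb : n%:R + B0 != 0 by rewrite gt_eqF// ltr_wpDl.
have p0 : pochhammer B0 n != 0 by rewrite gt_eqF// poch_gt0.
have f0 : n`!%:R != 0 :> R by rewrite pnatr_eq0 -lt0n fact_gt0.
rewrite /= /zu_of IH /hypergeo_coef !pochS factS natrM !mulr0 subr0 addr0.
have E : (bb0 + n%:R) * (bb1 + n%:R) = (n%:R + B1) * (n%:R + B0) - c0 * c1.
  transitivity (bb0 * bb1 + (bb0 + bb1) * n%:R + n%:R * n%:R); first by ring.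
  by rewrite bbD bbM; ring.
transitivity (pochhammer bb0 n * pochhammer bb1 n * ((bb0 + n%:R) * (bb1 + n%:R))
   / (pochhammer B0 n * (B0 + n%:R) * (n.+1%:R * n`!%:R))); last by congr (_ / _); ring.
rewrite E; field; rewrite [B0 + _]addrC.
by rewrite f0 p0 nb [1 + _]addrC natr1 n1.
Qed.

Lemma zu_hypergeo n : zu B0 B1 c0 c1 1 0 0 n =
  c0 / B0 * hypergeo_coef bb0 bb1 (B0 + 1) n.
Proof.
rewrite /zu /zu_of zv_hypergeo mulr0 addr0 /hypergeo_coef.
have nb : n%:R + B0 != 0 by rewrite gt_eqF// ltr_wpDl.
have p0 : pochhammer B0 n != 0 by rewrite gt_eqF// poch_gt0.
have p1 : pochhammer (B0 + 1) n != 0 by rewrite gt_eqF// poch_gt0// addr_gt0.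
have f0 : n`!%:R != 0 :> R by rewrite pnatr_eq0 -lt0n fact_gt0.
have e : pochhammer B0 n * (B0 + n%:R) = B0 * pochhammer (B0 + 1) n.
  by rewrite -pochS -pochSl.
have -> : pochhammer B0 n = B0 * pochhammer (B0 + 1) n / (n%:R + B0).
  by rewrite -e [B0 + _]addrC mulfK.
by field; rewrite f0 p1 nb gt_eqF.
Qed.

(** The candidates for the continuation: the power series in z covers ]-1, 1[
    and the w-series covers the rest of the half line; they agree on ]-1, 0]. *)
Definition G0 z : R := if -1 < z then Z0 B0 B1 c0 c1 1 0 0 z else Q0 z.
Definition G1 z : R := if -1 < z then Z1 B0 B1 c0 c1 1 0 0 z else Q1 z.

Lemma G_eq_Q z : z <= 0 -> G0 z = Q0 z /\ G1 z = Q1 z.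
Proof.
by rewrite /G0 /G1; case: ltP => // z1 z0; exact: Gauss_eq_Q.
Qed.

Lemma G_analytic z0 : z0 < 1 -> z0 != 0 -> analytic_at G0 z0 /\ analytic_at G1 z0.
Proof.
move=> z1 z0n; have [z2|z2] := ltP (- 1) z0.
  have [d0 [d1 hZ]] := @Z_zsys R B0 B1 c0 c1 1 0 0 B0_gt0 c0_ge0 c1_ge0.
  have [||a b] := @analytic_zsys R B0 B1 c0 c1 z0 z0n z1 (Z0 B0 B1 c0 c1 1 0 0)
     (Z1 B0 B1 c0 c1 1 0 0) d0 d1 (Num.min (z0 + 1) (1 - z0)).
  - by rewrite lt_min; apply/andP; split; lra.
  - move=> z; rewrite lt_min !ltr_norml => /andP[/andP[h1 h2] /andP[h3 h4]].
    by apply: hZ; rewrite ltr_norml; apply/andP; split; lra.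
  split; [apply: near_analytic a|apply: near_analytic b]; near=> z;
    by rewrite /G0 /G1 ifT//; near: z; exact: lt_nbhsr.
have hZ := Q_zsys.
have [||a b] := @analytic_zsys R B0 B1 c0 c1 z0 z0n z1 Q0 Q1 dQ0 dQ1 1.
- by [].
- by move=> z; rewrite ltr_norml => /andP[h1 h2]; apply: hZ; lra.
split; [apply: near_analytic a|apply: near_analytic b]; near=> z;
  have zneg : z <= 0 by (apply: ltW; near: z; apply: lt_nbhsl; lra).
  by have [-> _] := G_eq_Q zneg.
by have [_ ->] := G_eq_Q zneg.
Unshelve. all: by end_near. Qed.

Lemma G_series z : `|z| < 1 ->
  pseries (zu B0 B1 c0 c1 1 0 0) z @ \oo --> G0 z /\
  pseries (zv B0 B1 c0 c1 1 0 0) z @ \oo --> G1 z.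
Proof.
move=> z1; have [ru rv] := rad_z B1 1 0 0 B0_gt0 c0_ge0 c1_ge0.
have z2 : - 1 < z by move: z1; rewrite ltr_norml => /andP[].
rewrite /G0 /G1 z2.
by split; [exact: rad_psum ru z1|exact: rad_psum rv z1].
Qed.

Lemma hypergeo_Q1 z : z <= 0 -> hypergeo bb0 bb1 B0 z = Q1 z.
Proof.
move=> z0; have [_ <-] := G_eq_Q z0; apply: hypergeoE; last by lra.
have gs y : `|y| < 1 -> pseries (hypergeo_coef bb0 bb1 B0) y @ \oo --> G1 y.
  move=> /G_series[_]; suff -> : zv B0 B1 c0 c1 1 0 0 = hypergeo_coef bb0 bb1 B0 by [].
  by apply/funext => n; exact: zv_hypergeo.
split=> // y y1; have [->|yn] := eqVneq y 0; last by have [] := G_analytic y1 yn.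
exists (hypergeo_coef bb0 bb1 B0); near=> t; rewrite subr0; apply: gs.
by rewrite -[t]subr0; near: t; exact: near_dist.
Unshelve. all: by end_near. Qed.

Lemma hypergeo_Q0 z : z <= 0 -> c0 / B0 * hypergeo bb0 bb1 (B0 + 1) z = Q0 z.
Proof.
move=> z0; have [<- _] := G_eq_Q z0.
have cB : c0 / B0 != 0 by rewrite mulf_neq0 ?invr_neq0 ?gt_eqF.
suff -> : hypergeo bb0 bb1 (B0 + 1) z = (c0 / B0)^-1 * G0 z by rewrite mulrA mulfV// mul1r.
apply: (@hypergeoE _ _ _ _ (fun z => (c0 / B0)^-1 * G0 z)); last by lra.
have cE : (fun n => (c0 / B0)^-1 * zu B0 B1 c0 c1 1 0 0 n) = hypergeo_coef bb0 bb1 (B0 + 1).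
  by apply/funext => n; rewrite zu_hypergeo mulrA mulVf// mul1r.
have gs y : `|y| < 1 -> pseries (hypergeo_coef bb0 bb1 (B0 + 1)) y @ \oo -->
    (c0 / B0)^-1 * G0 y.
  by move=> /G_series[h _]; rewrite -cE; exact: cvg_pseriesZ.
split=> // y y1; have [->|yn] := eqVneq y 0.
  exists (hypergeo_coef bb0 bb1 (B0 + 1)); near=> t; rewrite subr0; apply: gs.
  by rewrite -[t]subr0; near: t; exact: near_dist.
have [[u hu] _] := G_analytic y1 yn; exists (fun n => (c0 / B0)^-1 * u n).
by near=> t; apply: cvg_pseriesZ; near: t.
Unshelve. all: by end_near. Qed.

End Gauss.

(** * Dependence on the Laplace variable, and the series at -1 *)

Section ParameterDerivative.
Variable R : realType.
Implicit Types (w q : R).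

Lemma psum_norm_le (c d : R^nat) rho K x : radius_ge rho d -> `|x| < rho ->
  0 <= K -> (forall n, `|c n| <= K * d n) -> (forall n, 0 <= d n) ->
  `|psum c x| <= K * psum d `|x|.
Proof.
move=> rd xr K0 cd d0.
have rc : radius_ge rho c by exact: rad_le rd cd d0.
have h1 := cvg_norm (rad_psum rc xr).
have h2 : K * pseries d `|x| n @[n --> \oo] --> K * psum d `|x|.
  by apply: cvgM; [exact: cvg_cst|apply: (rad_psum rd); rewrite normr_id].
apply: (ler_cvg_to (h1 _) h2); near=> n.
rewrite /pseries /series/= mulr_sumr (le_trans (ler_norm_sum _ _ _))//.
apply: ler_sum => i _; rewrite normrM normrX mulrA.
by rewrite ler_wpM2r ?exprn_ge0.
Unshelve. all: by end_near. Qed.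

Lemma psumB (c d : R^nat) rho x : radius_ge rho c -> radius_ge rho d -> `|x| < rho ->
  psum (fun n => c n - d n) x = psum c x - psum d x.
Proof.
move=> rc rd xr; apply: cvg_lim => //.
have := cvg_pseriesD (rad_psum rc xr) (@cvg_pseriesZ _ _ _ _ (-1) (rad_psum rd xr)).
rewrite mulN1r (_ : (fun n => _) = (fun n => c n - d n))//.
by apply/funext => n; rewrite mulN1r.
Qed.

Lemma continuous_lip0 (phi : R -> R) K de : 0 < de ->
  (forall q, `|q| < de -> `|phi q - phi 0| <= K * `|q|) -> {for 0, continuous phi}.
Proof.
move=> de0 h; apply/cvgrPdist_lt => e e0.
have K0 : 0 < `|K| + 1 by rewrite ltr_wpDl.
near=> q.
have q1 : `|q - 0| < de by near: q; exact: near_dist.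
have q2 : `|q - 0| < e / (`|K| + 1) by near: q; apply: near_dist; rewrite divr_gt0.
rewrite subr0 in q1 q2; rewrite distrC; apply: le_lt_trans (h _ q1) _.
apply: (@le_lt_trans _ _ ((`|K| + 1) * `|q|)).
  by rewrite ler_wpM2r// (le_trans (ler_norm _))// lerDl.
by rewrite mulrC -ltr_pdivlMr.
Unshelve. all: by end_near. Qed.

(** Caratheodory's criterion, with slope - phi. *)
Lemma derive_1subM (phi : R -> R) : {for 0, continuous phi} ->
  is_derive 0 (1 : R) (fun q => 1 - q * phi q) (- phi 0).
Proof.
move=> cphi; apply/is_derive1_caratheodory; exists (fun q => - phi q); split.
- by move=> q; rewrite mul0r !subr0; ring.
- exact: continuousN.
- by [].
Qed.

Lemma W_continuous (c0 c1 s0 s1 w : R) : 0 < c0 -> 0 <= c1 -> `|w| < 1 ->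
  {for 0, continuous (fun q => W0 c0 c1 s0 s1 (c0 + q * s0) (c1 + q * s1) w)} /\
  {for 0, continuous (fun q => W1 c0 c1 s0 s1 (c0 + q * s0) (c1 + q * s1) w)}.
Proof.
move=> c00 c10 w1; have c0' := ltW c00.
have [K [C [K0 C1 H]]] := @wcoef_lip R c0 c1 s0 s1 c0' c10 c0 c1 c00.
have rm := rad_majo C1.
have m0 n : 0 <= majorant C n by apply: majo_ge0; lra.
pose S := `|s0| + `|s1|.
have S0 : 0 <= S by rewrite addr_ge0.
pose de := Num.min (c0 / 2) 1 / (S + 1).
have de0 : 0 < de by rewrite divr_gt0 ?lt_min ?divr_gt0//; lra.
have hq q : `|q| < de -> `|q| * S <= c0 / 2 /\ `|q| * S <= 1.
  rewrite /de ltr_pdivlMr; last by lra.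
  rewrite lt_min => /andP[a b].
  have q0 := normr_ge0 q; have : `|q| * S <= `|q| * (S + 1) by rewrite ler_wpM2l; lra.
  by move=> h; split; lra.
have bd q : `|q| < de -> [/\ c0 / 2 <= c0 + q * s0, `|c1 + q * s1| <= `|c1| + 1 &
    `|c0 + q * s0 - c0| + `|c1 + q * s1 - c1| = S * `|q|].
  move=> qd; have [h1 h2] := hq q qd.
  have a0 : `|q * s0| <= `|q| * S by rewrite normrM ler_wpM2l// lerDl.
  have a1 : `|q * s1| <= `|q| * S by rewrite normrM ler_wpM2l// lerDr.
  split.
  - by have := ler_norm (- (q * s0)); rewrite normrN; lra.
  - by rewrite (le_trans (ler_normD _ _))// lerD2l; lra.
  - by rewrite ![_ + _ * _]addrC !addrK !normrM /S; ring.
have E (k X : R) : X + 0 * k = X by rewrite mul0r addr0.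
split; apply: (@continuous_lip0 _ (K * S * psum (majorant C) `|w|) de de0) => q qd;
  have [b1 b2 b3] := bd q qd;
  have B00 : 0 < c0 + q * s0 by (apply: lt_le_trans b1; rewrite divr_gt0).
- rewrite !E /W0 -(psumB (rad_wu _ _ _ _ _ B00) (rad_wu _ _ _ _ _ c00) w1)//.
  rewrite mulrAC; apply: (psum_norm_le rm w1 _ _ m0); first by rewrite !mulr_ge0.
  by move=> n; have [h _] := H _ _ n b1 b2; apply: le_trans h _; rewrite b3 mulrA.
- rewrite !E /W1 -(psumB (rad_wv _ _ _ _ _ B00) (rad_wv _ _ _ _ _ c00) w1)//.
  rewrite mulrAC; apply: (psum_norm_le rm w1 _ _ m0); first by rewrite !mulr_ge0.
  by move=> n; have [_ h] := H _ _ n b1 b2; apply: le_trans h _; rewrite b3 mulrA.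
Qed.

End ParameterDerivative.

Section BoundarySeries.
Variable R : realType.
Implicit Types (a : R^nat) (z s c : R).

(** Leibniz: apply the bound to the sequence without its first term. *)
Lemma alternating_bound m : forall a, (forall n, 0 <= a n) ->
  (forall n, a n.+1 <= a n) -> 0 <= \sum_(k < m) (-1) ^+ k * a k <= a 0.
Proof.
elim: m => [|m IH] a a0 ad; first by rewrite big_ord0 lexx a0.
rewrite big_ord_recl/= expr0 mul1r.
have -> : \sum_(i < m) (-1) ^+ bump 0 i * a (bump 0 i) =
    - \sum_(k < m) (-1) ^+ k * a k.+1.
  by rewrite -sumrN; apply: eq_bigr => i _; rewrite /bump/= add1n exprS; ring.
have /andP[h1 h2] := IH (fun k => a k.+1) (fun k => a0 _) (fun k => ad _).
have h3 := ad 0; apply/andP; split; lra.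
Qed.

Definition pterm s c n : R := pochhammer s n / pochhammer c n / n%:R.

Lemma pterm_ge0 s c n : 0 < s -> 0 < c -> 0 <= pterm s c n.
Proof. by move=> s0 c0; rewrite !divr_ge0// ltW// poch_gt0. Qed.

(** The subtracted quotient is nonnegative for all n exactly when
    s <= c + 1, and it is of order 1/n when s < c + 1. *)
Lemma ptermS s c n : 0 < s -> 0 < c -> (0 < n)%N ->
  pterm s c n.+1 = pterm s c n *
    (1 - ((c + 1 - s) * n%:R + c) / ((c + n%:R) * n.+1%:R)).
Proof.
move=> s0 c0 n0; rewrite /pterm !pochS.
have nz : n%:R != 0 :> R by rewrite pnatr_eq0 -lt0n.
have cz : pochhammer c n != 0 by rewrite gt_eqF// poch_gt0.
have cn : c + n%:R != 0 by rewrite gt_eqF// ltr_wpDr.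
by field; rewrite nz cn cz [1 + _]addrC natr1 pnatr_eq0.
Qed.

Lemma pterm_decr s c n : 0 < s -> 0 < c -> 0 <= c + 1 - s -> (0 < n)%N ->
  pterm s c n.+1 <= pterm s c n.
Proof.
move=> s0 c0 k0 n0; rewrite ptermS// ler_piMr ?pterm_ge0//.
have c1 := ltW c0; rewrite gerBl divr_ge0//; first by rewrite addr_ge0// mulr_ge0.
by rewrite mulr_ge0// addr_ge0.
Qed.

(** With a positive limit, the decrements of the terms would dominate a
    harmonic series. *)
Lemma pterm_cvg0 s c : 0 < s -> 0 < c -> 0 < c + 1 - s ->
  pterm s c n @[n --> \oo] --> (0 : R).
Proof.
move=> s0 c0 k0.
pose t n := pterm s c n.+1.
rewrite -(cvg_shiftS (pterm s c)); rewrite -/t.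
have t0 n : 0 <= t n by exact: pterm_ge0.
have td n : t n.+1 <= t n by apply: pterm_decr => //; exact: ltW.
have tni : nonincreasing_seq t by apply/nonincreasing_seqP.
have lbt : has_lbound (range t) by exists 0 => _ [n _ <-].
have ct := nonincreasing_cvgn tni lbt; set L := inf _ in ct.
have L0 : 0 <= L by apply: lb_le_inf => [|_ [n _ <-]//]; exists (t 0), 0.
have Lt n : L <= t n by apply: inf_lbound => //; exists n.
have [L_0|Ln] := eqVneq 0 L; first by rewrite -L_0 in ct.
have Lp : 0 < L by rewrite lt_neqAle Ln.
(* the quotient subtracted in [ptermS] is at least ka / (n + 1) *)
exfalso; pose ka := (c + 1 - s) / (c + 1).
have ka0 : 0 < ka by rewrite divr_gt0//; lra.
have dec n : L * ka * harmonic n.+1 <= t n - t n.+1.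
  rewrite /t (ptermS (n := n.+1))// mulrBr mulr1 opprB addrCA subrr addr0 -mulrA.
  apply: ler_pM => //.
  - by rewrite mulr_ge0 ?(ltW ka0)// harmonic_ge0.
  - exact: (Lt n).
  rewrite /ka /harmonic/= -mulrA -invfM.
  have cn : 0 < c + n.+1%:R by rewrite ltr_wpDr.
  have n2 : 0 < n.+2%:R :> R by [].
  have c1 : 0 < c + 1 by lra.
  rewrite ler_pdivrMr ?mulr_gt0// mulrAC ler_pdivlMr ?mulr_gt0//.
  have -> : (c + 1 - s) * ((c + n.+1%:R) * n.+2%:R) =
     ((c + 1 - s) * (c + n.+1%:R)) * n.+2%:R by ring.
  rewrite mulrA ler_wpM2r// -natr1; have : 0 <= n%:R :> R by [].
  move: (n%:R : R) (c + 1 - s) (ltW k0) => x k k0' x0; rewrite -subr_ge0.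
  have -> : (k * (x + 1) + c) * (c + 1) - k * (c + (x + 1)) = k * x * c + c * (c + 1) by ring.
  by rewrite addr_ge0// !mulr_ge0// ltW.
have : cvgn (series (@harmonic R)).
  apply: nondecreasing_is_cvgn.
    by apply/nondecreasing_seqP => n; rewrite -subr_ge0 /series/= big_nat_recr//= addrAC subrr add0r harmonic_ge0.
  exists (1 + t 0 / (L * ka)) => _ [n _ <-].
  have Lk : 0 < L * ka by rewrite mulr_gt0.
  have H m : series (@harmonic R) m.+1 <= 1 + (t 0 - t m) / (L * ka).
    elim: m => [|m IH].
      by rewrite /series/= big_nat1 /harmonic/= invr1 subrr mul0r addr0.
    rewrite /series/= big_nat_recr//=.
    have -> : 1 + (t 0 - t m.+1) / (L * ka) =
      (1 + (t 0 - t m) / (L * ka)) + (t m - t m.+1) / (L * ka) by field; rewrite !gt_eqF.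
    by rewrite lerD// ler_pdivlMr// mulrC dec.
  case: n => [|n].
    by rewrite /series/= big_geq// addr_ge0// divr_ge0// ltW.
  apply: le_trans (H n) _; rewrite lerD2l ler_wpM2r ?invr_ge0 ?(ltW Lk)//.
  by have := t0 n; lra.
by move/dvg_harmonic.
Qed.

Definition pseq s c z N : R := \sum_(1 <= n < N) pterm s c n * z ^+ n.

Lemma pseq_tail s c z N m : 0 < s -> 0 < c -> 0 <= c + 1 - s ->
  -1 <= z -> z <= 0 -> (0 < N)%N ->
  `|pseq s c z (N + m) - pseq s c z N| <= pterm s c N.
Proof.
move=> s0 c0 k0 z1 z0 N0.
rewrite /pseq (@big_cat_nat _ _ _ N) ?leq_addr//= addrAC subrr add0r.
rewrite -{1}(add0n N) big_addn addKn big_mkord.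
have Z0 : 0 <= - z by lra.
have Z1 : - z <= 1 by lra.
pose a k := pterm s c (k + N) * (- z) ^+ (k + N).
have E : \sum_(i < m) pterm s c (i + N) * z ^+ (i + N) =
    (-1) ^+ N * \sum_(k < m) (-1) ^+ k * a k.
  rewrite mulr_sumr; apply: eq_bigr => i _; rewrite /a.
  have -> : z ^+ (i + N) = (-1) ^+ (i + N) * (- z) ^+ (i + N).
    by rewrite -exprMn mulN1r opprK.
  by rewrite exprD; ring.
rewrite E normrM normrX normrN1 expr1n mul1r.
have [||h1 h2] : _ /\ _ := andP (@alternating_bound m a _ _).
- by move=> n; rewrite mulr_ge0 ?pterm_ge0// exprn_ge0.
- move=> n; rewrite /a addSn ler_pM ?pterm_ge0 ?exprn_ge0//.
    by apply: pterm_decr => //; rewrite addn_gt0 N0 orbT.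
  by rewrite ler_wiXn2l.
rewrite ger0_norm// (le_trans h2)// /a add0n ler_piMr ?pterm_ge0//.
exact: exprn_ile1.
Qed.

Lemma pseq_continuous s c N z : {for z, continuous (fun z => pseq s c z N)}.
Proof.
elim: N => [|N IH].
  rewrite (_ : (fun z => _) = fun=> 0); first exact: cst_continuous.
  by apply/funext => y; rewrite /pseq big_geq.
case: N IH => [|N] IH.
  rewrite (_ : (fun z => _) = fun=> 0); first exact: cst_continuous.
  by apply/funext => y; rewrite /pseq big_geq.
rewrite (_ : (fun z => _) = fun z => pseq s c z N.+1 + pterm s c N.+1 * z ^+ N.+1).
  apply: continuousD => //; apply: continuousM; first exact: cst_continuous.
  exact: exprn_continuous.
by apply/funext => y; rewrite /pseq big_nat_recr.
Qed.

(** Leibniz's bound for the tails is uniform in z in [-1, 0], so the convergence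
    is uniform up to the endpoint. *)
Lemma pseq_abel s c (F : R -> R) : 0 < s -> 0 < c -> 0 < c + 1 - s ->
  {for -1, continuous F} ->
  (forall z, -1 < z -> z < 0 -> pseq s c z @ \oo --> F z) ->
  pseq s c (-1) @ \oo --> F (-1).
Proof.
move=> s0 c0 k0 cF hF; have k0' := ltW k0.
have bnd N : (0 < N)%N -> `|F (-1) - pseq s c (-1) N| <= pterm s c N.
  move=> N0.
  have cS : {for -1, continuous (fun z => F z - pseq s c z N)}.
    by apply: continuousB => //; exact: pseq_continuous.
  have hb : `|F z - pseq s c z N| @[z --> (-1)^'+] --> `|F (-1) - pseq s c (-1) N|.
    by apply: cvg_norm; apply: cvg_at_right_filter; exact: cS.
  apply: (cvgr_to_le hb); near=> z.
  have z1 : -1 < z by near: z; exact: nbhs_right_gt.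
  have z0 : z < 0 by near: z; apply: nbhs_right_lt; rewrite ltrN10.
  have h1 : `|pseq s c z n - pseq s c z N| @[n --> \oo] --> `|F z - pseq s c z N|.
    by apply: cvg_norm; apply: cvgB; [exact: hF|exact: cvg_cst].
  apply: (cvgr_to_le h1); near=> n.
  have Nn : (N <= n)%N by near: n; exact: nbhs_infty_ge.
  by rewrite -(subnKC Nn); apply: pseq_tail => //; exact: ltW.
apply/cvgrPdist_lt => e e0.
have /cvgrPdist_lt/(_ _ e0) te := pterm_cvg0 s0 c0 k0.
near=> n; apply: le_lt_trans (bnd n _) _; first by near: n; exact: nbhs_infty_gt.
have : `|0 - pterm s c n| < e by near: n.
by rewrite sub0r normrN ger0_norm// pterm_ge0.
Unshelve. all: by end_near. Qed.

(** Here the terms are bounded below by 1/c. *)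
Lemma pseq_diverges c k : 0 < c -> 1 <= k -> ~ cvgn (pseq (c + k) c (-1)).
Proof.
move=> c0 k1 cv.
have low n : (0 < n)%N -> c^-1 <= pterm (c + k) c n.
  move=> n0; have n0' : 0 < n%:R :> R by rewrite ltr0n.
  have P0 : 0 < pochhammer c n by exact: poch_gt0.
  have h : pochhammer (c + 1) n <= pochhammer (c + k) n.
    by apply: ler_prod => i _; rewrite addr_ge0 ?addr_ge0 ?(ltW c0)//= lerD2r lerD2l.
  have e : pochhammer c n * (c + n%:R) = c * pochhammer (c + 1) n.
    by rewrite -pochS -pochSl.
  rewrite /pterm ler_pdivlMr// ler_pdivlMr//.
  apply: le_trans h.
  rewrite -(ler_pM2l c0) -e mulrA mulrA mulfV ?gt_eqF// mul1r mulrC.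
  by rewrite ler_wpM2l ?(ltW P0)// lerDr ltW.
have d0 : (pseq (c + k) c (-1) n.+1 - pseq (c + k) c (-1) n) @[n --> \oo] --> (0 : R).
  rewrite -[X in _ --> X](subrr (limn (pseq (c + k) c (-1)))).
  apply: cvgB => //; by rewrite (cvg_shiftS (pseq _ _ _)).
have ci : 0 < c^-1 by rewrite invr_gt0.
have /cvgrPdist_lt/(_ _ ci) := d0; case=> N _ /(_ N.+1 (leqnSn N))/=.
rewrite sub0r normrN /pseq big_nat_recr//= [X in `|X|]addrAC subrr add0r normrM normrX normrN1.
rewrite expr1n mulr1 ger0_norm ?pterm_ge0//; last by rewrite addr_gt0//; lra.
by rewrite ltNge low.
Qed.

End BoundarySeries.

Section Model.
Variables (R : realType) (lam gam a : 'I_2 -> R).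
Hypotheses (lam_gt0 : forall i, 0 < lam i) (gam_gt0 : forall i, 0 < gam i).
Implicit Types (q x y z : R).

Let c0 := lam 0 / gam 0.
Let c1 := lam 1 / gam 1.
Let s0 := (gam 0)^-1.
Let s1 := (gam 1)^-1.
Let c0_gt0 : 0 < c0. Proof. exact: divr_gt0. Qed.
Let c1_gt0 : 0 < c1. Proof. exact: divr_gt0. Qed.

Lemma beta0E q : beta lam gam 0 q = c0 + q * s0.
Proof. by rewrite /beta mulrDl. Qed.
Lemma beta1E q : beta lam gam 1 q = c1 + q * s1.
Proof. by rewrite /beta mulrDl. Qed.

Lemma discr_gt0 q : 0 < discr lam gam q.
Proof.
rewrite /discr ltr_wpDl ?sqr_ge0// !beta0E beta1E !mul0r !addr0.
by rewrite mulr_gt0// mulr_gt0.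
Qed.

Lemma bD q : b0 lam gam q + b1 lam gam q = beta lam gam 0 q + beta lam gam 1 q.
Proof. by rewrite /b0 /b1; field. Qed.

Lemma bM q : b0 lam gam q * b1 lam gam q =
  beta lam gam 0 q * beta lam gam 1 q - c0 * c1.
Proof.
have e : Num.sqrt (discr lam gam q) ^+ 2 = discr lam gam q.
  by rewrite sqr_sqrtr// ltW// discr_gt0.
transitivity (((beta lam gam 0 q + beta lam gam 1 q) ^+ 2 - Num.sqrt (discr lam gam q) ^+ 2) / 4).
  by rewrite /b0 /b1; field.
rewrite e /discr.
have -> : beta lam gam 0 0 = c0 by rewrite beta0E mul0r addr0.
have -> : beta lam gam 1 0 = c1 by rewrite beta1E mul0r addr0.
by field.
Qed.

Lemma b0'0_gt0 : 0 < b0'0 lam gam.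
Proof. by rewrite /b0'0 divr_gt0 ?addr_gt0 ?mulr_gt0. Qed.

Lemma b0_derive : is_derive (0 : R) (1 : R) (b0 lam gam) (b0'0 lam gam).
Proof.
have db i : is_derive (0 : R) (1 : R) (beta lam gam i) (gam i)^-1.
  rewrite /beta (_ : (fun q => _) = (fun q => (gam i)^-1 * (lam i + q))).
    by apply: is_derive_eq (derZ _ (derD (derC (lam i) 0) (derid 0))) _; ring.
  by apply/funext => q; rewrite mulrC.
have dd : is_derive (0 : R) (1 : R) (discr lam gam) (2 * (c0 - c1) * (s0 - s1)).
  have h := derB (db 0) (db 1).
  have := derD (derM h h) (derC (4 * beta lam gam 0 0 * beta lam gam 1 0) 0).
  rewrite (_ : (fun y => _) = discr lam gam); last first.
    by apply/funext => q; rewrite /discr expr2.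
  move=> d; apply: is_derive_eq d _.
  by rewrite beta0E beta1E !mul0r !addr0 /s0 /s1; ring.
have d0 : discr lam gam 0 = (c0 + c1) ^+ 2.
  by rewrite /discr beta0E beta1E !mul0r !addr0; ring.
have cc : 0 < c0 + c1 by rewrite addr_gt0.
have sq : Num.sqrt (discr lam gam 0) = c0 + c1 by rewrite d0 sqrtr_sqr gtr0_norm.
have ds := @der_comp R Num.sqrt (discr lam gam) 0 _ _ (is_derive1_sqrt (discr_gt0 0)) dd.
have := derZ (1 / 2) (derB (derD (db 0) (db 1)) ds).
rewrite (_ : (fun y => _) = b0 lam gam); last first.
  by apply/funext => q; rewrite /b0; field.
move=> d; apply: is_derive_eq d _.
rewrite sq /b0'0 /s0 /s1 /c0 /c1; field.
by rewrite !gt_eqF ?addr_gt0 ?mulr_gt0.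
Qed.

(** The solution with discount q, sources 1/gam_i and second component 0 at the
    level.  The Laplace transforms are 1 - q U. *)
Definition U0 q z := W0 c0 c1 s0 s1 (c0 + q * s0) (c1 + q * s1) (wz z).
Definition U1 q z := W1 c0 c1 s0 s1 (c0 + q * s0) (c1 + q * s1) (wz z).

Lemma B0q_gt0 q : - lam 0 < q -> 0 < c0 + q * s0.
Proof. by move=> ?; rewrite -beta0E /beta divr_gt0//; lra. Qed.

Lemma Qhat1E x q : - lam 0 < q -> zvar gam a x <= 0 ->
  Qhat1 lam gam a x q = 1 - q * U1 q (zvar gam a x).
Proof.
move=> q0 z0; rewrite /Qhat1 beta0E.
apply: (@hypergeo_Q1 R _ (c1 + q * s1) c0 c1 s0 s1 q) => //; try exact: B0q_gt0; try exact: ltW.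
  by rewrite bD beta0E beta1E.
by rewrite bM beta0E beta1E.
Qed.

Lemma Qhat0E x q : - lam 0 < q -> zvar gam a x <= 0 ->
  Qhat0 lam gam a x q = 1 - q * U0 q (zvar gam a x).
Proof.
move=> q0 z0; rewrite /Qhat0 beta0E.
have -> : lam 0 / (lam 0 + q) = c0 / (c0 + q * s0).
  by rewrite -beta0E /beta /c0; field; rewrite !gt_eqF//; lra.
apply: (@hypergeo_Q0 R _ (c1 + q * s1) c0 c1 s0 s1 q) => //; try exact: B0q_gt0; try exact: ltW.
  by rewrite bD beta0E beta1E.
by rewrite bM beta0E beta1E.
Qed.

Lemma Qhat_derive x : zvar gam a x <= 0 ->
  is_derive (0 : R) (1 : R) (Qhat0 lam gam a x) (- U0 0 (zvar gam a x)) /\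
  is_derive (0 : R) (1 : R) (Qhat1 lam gam a x) (- U1 0 (zvar gam a x)).
Proof.
move=> z0; have w1 : `|wz (zvar gam a x)| < 1 by apply: wz_lt1; lra.
have [h0 h1] := @W_continuous R c0 c1 s0 s1 _ c0_gt0 (ltW c1_gt0) w1.
have nq : \forall q \near (0 : R), - lam 0 < q by apply: lt_nbhsr; rewrite oppr_lt0.
split.
- apply: near_eq_is_derive (derive_1subM h0); near=> q.
  by rewrite Qhat0E//; near: q.
- apply: near_eq_is_derive (derive_1subM h1); near=> q.
  by rewrite Qhat1E//; near: q.
Unshelve. all: by end_near. Qed.

Let s := c0 + c1.

Lemma mean_seriesE c z : mean_series lam gam c z = pseq s c z.
Proof.
by apply/funext => N; apply: eq_bigr => n _; rewrite /pterm -/s; ring.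
Qed.

(** At q = 0 the roots are 0 and s = c0 + c1.  The factor 0 would annihilate all
    terms, but the source restarts the recursion at n = 1, with - b0'(0) s/c0. *)
Lemma zv_mean n : (0 < n)%N ->
  zv c0 c1 c0 c1 0 s0 s1 n = - b0'0 lam gam * pterm s c0 n.
Proof.
have g0 := gam_gt0 0; have g1 := gam_gt0 1; have l0 := lam_gt0 0; have l1 := lam_gt0 1.
case: n => // n _; elim: n => [|n IH].
  rewrite /= /zu_of /pterm /pochhammer !big_ord1 /b0'0 /s /c0 /c1 /s0 /s1/=.
  by field; rewrite !gt_eqF ?addr_gt0 ?mulr_gt0.
have nz : n.+1%:R != 0 :> R by [].
have nz2 : n.+2%:R != 0 :> R by [].
have pz : pochhammer c0 n.+1 != 0 by rewrite gt_eqF// poch_gt0.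
have cn : n.+1%:R + c0 != 0 by rewrite gt_eqF// ltr_wpDl.
have cn' : c0 + n.+1%:R != 0 by rewrite addrC.
have -> : zv c0 c1 c0 c1 0 s0 s1 n.+2 = ((n.+1%:R + c1) * zv c0 c1 c0 c1 0 s0 s1 n.+1 -
   c1 * ((c0 * zv c0 c1 c0 c1 0 s0 s1 n.+1) / (n.+1%:R + c0))) / n.+2%:R.
  by rewrite [LHS]/= /zu_of/= !mul0r subr0 !addr0.
rewrite IH /pterm !(pochS _ n.+1) /s.
have alg (C0 C1 u v p p' b : R) : u != 0 -> v != 0 -> p' != 0 -> u + C0 != 0 ->
    ((u + C1) * (b * (p / p' / u)) - C1 * (C0 * (b * (p / p' / u)) / (u + C0))) / v =
    b * (p * (C0 + C1 + u) / (p' * (C0 + u)) / v).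
  move=> u0 v0 p0 h; have h' : C0 + u != 0 by rewrite addrC.
  by field; rewrite ?u0 ?v0 ?p0 ?h ?h'.
exact: alg.
Qed.

Lemma zu_mean n : (0 < n)%N ->
  zu c0 c1 c0 c1 0 s0 s1 n = - b0'0 lam gam * pterm s (1 + c0) n.
Proof.
move=> n0; rewrite /zu /zu_of zv_mean// gtn_eqF// mul0r addr0 /pterm.
have nz : n%:R != 0 :> R by rewrite pnatr_eq0 -lt0n.
have pz : pochhammer c0 n != 0 by rewrite gt_eqF// poch_gt0.
have pz1 : pochhammer (1 + c0) n != 0 by rewrite gt_eqF// poch_gt0// addr_gt0.
have cn : n%:R + c0 != 0 by rewrite gt_eqF// ltr_wpDl.
have e : pochhammer c0 n * (c0 + n%:R) = c0 * pochhammer (1 + c0) n.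
  by rewrite -pochS pochSl [1 + _]addrC.
have -> : pochhammer c0 n = c0 * pochhammer (1 + c0) n / (n%:R + c0).
  by rewrite -e [c0 + _]addrC mulfK.
by field; rewrite nz pz1 cn gt_eqF.
Qed.

Lemma U_mean_in z : -1 < z -> z <= 0 ->
  pseq s (1 + c0) z @ \oo --> (U0 0 z - 1 / lam 0) / - b0'0 lam gam /\
  pseq s c0 z @ \oo --> U1 0 z / - b0'0 lam gam.
Proof.
move=> z1 z0; have bp := b0'0_gt0.
have z2 : `|z| < 1 by rewrite ltr_norml z1; lra.
have [ru rv] := @rad_z R c0 c1 c0 c1 0 s0 s1 c0_gt0 (ltW c0_gt0) (ltW c1_gt0).
have E (k : R) : c0 + 0 * k = c0 by rewrite mul0r addr0.
have E1 (k : R) : c1 + 0 * k = c1 by rewrite mul0r addr0.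
have [e0 e1] := @Z_eq_W R c0 c1 c0 c1 s0 s1 c0_gt0 c0_gt0 (ltW c1_gt0) z z1 z0.
rewrite /U0 /U1 !E !E1 -e0 -e1.
have nb : - b0'0 lam gam != 0 by rewrite oppr_eq0 gt_eqF.
have alg (t u : R) : t * u = - b0'0 lam gam * t * u / - b0'0 lam gam.
  by have := nb; rewrite oppr_eq0 => nb'; field.
have l0 : zu c0 c1 c0 c1 0 s0 s1 0 = 1 / lam 0.
  by rewrite /zu /zu_of/= mulr0 !add0r mul1r /s0 /c0; field; rewrite !gt_eqF.
split.
- rewrite -cvg_shiftS.
  rewrite (_ : (fun n => _) = fun N => (pseries (zu c0 c1 c0 c1 0 s0 s1) z N.+1 - 1 / lam 0) / - b0'0 lam gam).
    apply: cvgM; last exact: cvg_cst.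
    apply: cvgB; last exact: cvg_cst.
    by rewrite (cvg_shiftS (pseries _ z)); exact: rad_psum ru z2.
  apply/funext => N; rewrite /pseries /series/= big_nat_recl//= expr0 mulr1 l0.
  rewrite addrAC subrr add0r mulr_suml /pseq big_add1/=.
  by apply: eq_bigr => i _; rewrite zu_mean//; exact: alg.
- rewrite -cvg_shiftS.
  rewrite (_ : (fun n => _) = fun N => (pseries (zv c0 c1 c0 c1 0 s0 s1) z N.+1) / - b0'0 lam gam).
    apply: cvgM; last exact: cvg_cst.
    by rewrite (cvg_shiftS (pseries _ z)); exact: rad_psum rv z2.
  apply/funext => N; rewrite /pseries /series/= big_nat_recl//= expr0 mulr1.
  rewrite add0r mulr_suml /pseq big_add1/=.
  by apply: eq_bigr => i _; have /= -> := zv_mean (ltn0Sn i); exact: alg.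
Qed.

Lemma U_continuous q z : - lam 0 < q -> z < 1 / 2 ->
  {for z, continuous (U0 q)} /\ {for z, continuous (U1 q)}.
Proof.
move=> q0 z1.
have [a0 a1 _ _] := @W_zsys R c0 c1 s0 s1 (ltW c0_gt0) (ltW c1_gt0) _ (c1 + q * s1) (B0q_gt0 q0) z z1.
by split; [exact: der_cont a0|exact: der_cont a1].
Qed.

Lemma U_mean0 z : (-1 < z /\ z <= 0) \/ (z = -1 /\ c1 < 2) ->
  cvgn (mean_series lam gam (1 + c0) z) /\
  U0 0 z = - b0'0 lam gam * limn (mean_series lam gam (1 + c0) z) + 1 / lam 0.
Proof.
move=> hz; rewrite mean_seriesE; have bp := b0'0_gt0.
have nb : - b0'0 lam gam != 0 by rewrite oppr_eq0 gt_eqF.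
have c : pseq s (1 + c0) z @ \oo --> (U0 0 z - 1 / lam 0) / - b0'0 lam gam.
  case: hz => [[z1 z0]|[-> hc]]; first by have [] := U_mean_in z1 z0.
  apply: (@pseq_abel R s (1 + c0) (fun z => (U0 0 z - 1 / lam 0) / - b0'0 lam gam)).
  - by rewrite addr_gt0.
  - by rewrite addr_gt0.
  - by rewrite /s; lra.
  - have [cu _] := @U_continuous 0 (-1) (ltac:(by rewrite oppr_lt0)) (ltac:(lra)).
    apply: continuousM; last exact: cst_continuous.
    by apply: continuousB => //; exact: cst_continuous.
  - by move=> y y1 y0; have [] := U_mean_in y1 (ltW y0).
split; first by apply/cvg_ex; eexists; exact: c.
by rewrite (cvg_lim _ c)// mulrC divfK// subrK.
Qed.

Lemma U_mean1 z : (-1 < z /\ z <= 0) \/ (z = -1 /\ c1 < 1) ->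
  cvgn (mean_series lam gam c0 z) /\
  U1 0 z = - b0'0 lam gam * limn (mean_series lam gam c0 z).
Proof.
move=> hz; rewrite mean_seriesE; have bp := b0'0_gt0.
have nb : - b0'0 lam gam != 0 by rewrite oppr_eq0 gt_eqF.
have c : pseq s c0 z @ \oo --> U1 0 z / - b0'0 lam gam.
  case: hz => [[z1 z0]|[-> hc]]; first by have [] := U_mean_in z1 z0.
  apply: (@pseq_abel R s c0 (fun z => U1 0 z / - b0'0 lam gam)) => //.
  - by rewrite addr_gt0.
  - by rewrite /s; lra.
  - have [_ cu] := @U_continuous 0 (-1) (ltac:(by rewrite oppr_lt0)) (ltac:(lra)).
    by apply: continuousM => //; exact: cst_continuous.
  - by move=> y y1 y0; have [] := U_mean_in y1 (ltW y0).
split; first by apply/cvg_ex; eexists; exact: c.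
by rewrite (cvg_lim _ c)// mulrC divfK.
Qed.

Lemma mean_diverges : 1 <= c1 -> ~ cvgn (mean_series lam gam c0 (-1)).
Proof. by move=> h; rewrite mean_seriesE; exact: pseq_diverges. Qed.

End Model.

(** * Test functions along the flow *)

Section Interface.
Variables (R : realType) (lam gam a : 'I_2 -> R).
Hypotheses (lam_gt0 : forall i, 0 < lam i) (gam_gt0 : forall i, 0 < gam i).
Hypothesis a_gam : a 1 / gam 1 < a 0 / gam 0.
Implicit Types (q x y z h : R) (i : 'I_2).

Lemma I2E i : i = 0 \/ i = 1.
Proof. by case: i => [[|[|//]] p]; [left|right]; apply/val_inj. Qed.

Definition other_state i : 'I_2 := if i == 0 then 1 else 0.

Definition level i : R := a i / gam i.

Definition flow i h y : R := level i + (y - level i) * expR (- (gam i * h)).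

Lemma flow0 i y : flow i 0 y = y.
Proof. by rewrite /flow mulr0 oppr0 expR0 mulr1 addrC subrK. Qed.

Lemma expRN_itv i h : 0 <= h -> 0 < expR (- (gam i * h)) <= 1.
Proof.
move=> h0; rewrite expR_gt0/= -expR0 ler_expR oppr_le0 mulr_ge0//; exact: ltW.
Qed.

Lemma flow_contract i h y y' : 0 <= h -> `|flow i h y - flow i h y'| <= `|y - y'|.
Proof.
move=> h0; have /andP[e0 e1] := expRN_itv i h0.
have -> : flow i h y - flow i h y' = (y - y') * expR (- (gam i * h)) by rewrite /flow; ring.
by rewrite normrM (gtr0_norm e0) ler_piMr.
Qed.

Lemma flow_dist i h y : 0 <= h -> `|flow i h y - y| <= `|y - level i| * gam i * h.
Proof.
move=> h0; have /andP[e0 e1] := expRN_itv i h0.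
have -> : flow i h y - y = (y - level i) * (expR (- (gam i * h)) - 1) by rewrite /flow; ring.
rewrite normrM -mulrA ler_wpM2l// ler0_norm ?subr_le0//.
by have := expR_ge1Dx (- (gam i * h)); lra.
Qed.

Lemma flow_in i h x y : level 0 <= x -> 0 <= h -> level 1 <= y <= x ->
  level 1 <= flow i h y <= x.
Proof.
move=> x0 h0 /andP[y1 y2]; have a0 : level 1 < level 0 := a_gam.
have /andP[e0 e1] := expRN_itv i h0; rewrite /flow.
move: (expR _) e0 e1 => E e0 e1.
have hi : level 1 <= level i <= x.
  by case: (I2E i) => ->; apply/andP; split => //; [exact: ltW|exact: le_trans (ltW a0) x0].
case/andP: hi => h1 h2.
have -> : level i + (y - level i) * E = level i * (1 - E) + y * E by ring.
have E1 : 0 <= 1 - E by lra.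
have := ler_wpM2r E1 h1; have := ler_wpM2r E1 h2.
have := ler_wpM2r (ltW e0) y1; have := ler_wpM2r (ltW e0) y2.
by move=> *; apply/andP; split; lra.
Qed.

Lemma flow_below i h y : 0 <= h -> y < level 0 -> flow i h y < level 0.
Proof.
move=> h0 y1; have a0 : level 1 < level 0 := a_gam.
have /andP[e0 e1] := expRN_itv i h0; rewrite /flow.
move: (expR _) e0 e1 => E e0 e1.
have h2 : level i <= level 0 by case: (I2E i) => -> //; exact: ltW.
have -> : level i + (y - level i) * E = level i * (1 - E) + y * E by ring.
have E1 : 0 <= 1 - E by lra.
have := ler_wpM2r E1 h2; have : y * E < level 0 * E by rewrite ltr_pM2r.
by move=> *; lra.
Qed.

Lemma flow0_above h y : 0 <= h -> level 0 <= y -> level 0 <= flow 0 h y.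
Proof.
move=> h0 y0; have /andP[e0 e1] := expRN_itv 0 h0.
by rewrite /flow lerDl mulr_ge0 ?(ltW e0)// subr_ge0.
Qed.

(** What remains of the backward equations with discount q and source sg when
    f is moved by the flow for a time h.  The functions are bounded and
    Lipschitz on the whole line, so that they can be evaluated along paths that
    have crossed the level. *)
Definition test_fun (x q sg : R) (f : 'I_2 -> R -> R) (L C h0 : R) :=
  [/\ 0 <= L, 0 <= C, 0 < h0,
    (forall i y y', `|f i y - f i y'| <= L * `|y - y'|) &
    (forall i y, `|f i y| <= L) /\
    forall i y h, level 0 <= y <= x -> 0 <= h <= h0 ->
    `|f i (flow i h y) - f i y
        - h * ((lam i + q) * f i y - lam i * f (other_state i) y - sg)| <= C * h * h].

Definition clampr (p r u : R) := Num.max p (Num.min u r).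

Lemma clampr_in p r u : p <= r -> p <= clampr p r u <= r.
Proof. by move=> pr; rewrite /clampr le_max lexx/= ge_max pr ge_min lexx orbT. Qed.

Lemma clampr_id p r u : p <= u <= r -> clampr p r u = u.
Proof. by move=> /andP[pu ur]; rewrite /clampr min_l// max_r. Qed.

Lemma clampr_lip p r u v : p <= r -> `|clampr p r u - clampr p r v| <= `|u - v|.
Proof.
wlog uv : u v / u <= v.
  move=> H pr; have [h|/ltW h] := leP u v; first exact: H.
  by rewrite distrC [leRHS]distrC; exact: H.
move=> pr; rewrite !ler0_norm ?subr_le0//; last first.
  rewrite /clampr ge_max le_max lexx/= le_max; apply/orP; right.
  by rewrite le_min !ge_min uv lexx orbT.
rewrite /clampr /Num.max /Num.min.
by case: (ltP u r) => ?; case: (ltP v r) => ?; case: ltP => ?; case: ltP => ?; lra.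
Qed.

Lemma lip_bounded_der (f d : R -> R) p r : p <= r ->
  (forall z, p <= z <= r -> is_derive z (1 : R) f (d z)) ->
  (forall z, p <= z <= r -> {for z, continuous d}) ->
  exists2 L, 0 <= L &
    (forall u v, `|f (clampr p r u) - f (clampr p r v)| <= L * `|u - v|) /\
    (forall u, `|f (clampr p r u)| <= L).
Proof.
move=> pr df cd.
have bnd (g : R -> R) : (forall z, p <= z <= r -> {for z, continuous g}) ->
    exists2 M, 0 <= M & forall z, p <= z <= r -> `|g z| <= M.
  move=> cg.
  have cg' : {within `[p, r], continuous (fun z => `|g z|)}.
    apply: continuous_in_subspaceT => z; rewrite inE/= in_itv/= => hz.
    by apply: cvg_norm; exact: cg.
  have [c ci hc] := EVT_max pr cg'; exists `|g c|; first exact: normr_ge0.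
  by move=> z hz; apply: hc; rewrite in_itv.
have [M M0 hM] := bnd d cd.
have [N N0 hN] : exists2 M, 0 <= M & forall z, p <= z <= r -> `|f z| <= M.
  by apply: bnd => z hz; exact: der_cont (df z hz).
have lip u v : p <= u <= r -> p <= v <= r -> u <= v -> `|f u - f v| <= M * `|u - v|.
  move=> /andP[u1 u2] /andP[v1 v2] uv.
  have sub y : u <= y <= v -> p <= y <= r by move=> /andP[? ?]; apply/andP; split; lra.
  have [c hc e] := is_derive_MVT uv (fun y hy => df y (sub y hy)).
  by rewrite distrC e normrM [`|u - v|]distrC ler_wpM2r// hM// sub.
exists (M + N); first by rewrite addr_ge0.
split=> [u v|u]; last by rewrite (le_trans (hN _ (clampr_in _ pr)))// lerDr.
apply: (@le_trans _ _ (M * `|clampr p r u - clampr p r v|)); last first.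
  by apply: ler_pM => //; [rewrite lerDl|exact: clampr_lip].
have [h|/ltW h] := leP (clampr p r u) (clampr p r v); first by apply: lip => //; exact: clampr_in.
by rewrite distrC [`|clampr _ _ u - _|]distrC; apply: lip => //; exact: clampr_in.
Qed.

Lemma zvar_ge0P y : level 0 <= y -> zvar gam a y <= 0.
Proof.
move=> y0; rewrite /zvar mulr_le0_ge0 ?subr_le0// invr_ge0 subr_ge0 ltW//.
Qed.

(** The solution is frozen outside [z(x), 1/4].  This changes nothing for a flow
    that starts in [l0, x] and lasts at most 1/(4 gamma_1), since it ends where
    z <= 1/4; the error O(h^2) comes from the mean value theorem and from the
    Lipschitz bound for the derivative along the flow. *)
Lemma zsys_test_fun (x q sg : R) (h0 h1 d0 d1 : R -> R) : level 0 <= x ->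
  (forall z, z < 1 / 2 -> zsys (beta lam gam 0 q) (beta lam gam 1 q)
     (lam 0 / gam 0) (lam 1 / gam 1) (sg / gam 0) (sg / gam 1) h0 h1 d0 d1 z) ->
  (forall z, z < 1 / 2 -> {for z, continuous d0} /\ {for z, continuous d1}) ->
  exists f L C r, test_fun x q sg f L C r /\
    forall y, level 0 <= y <= x -> f 0 y = h0 (zvar gam a y) /\ f 1 y = h1 (zvar gam a y).
Proof.
move=> x0 sys cd.
have a0 : level 1 < level 0 := a_gam.
pose D := level 0 - level 1; have D0 : 0 < D by rewrite subr_gt0.
pose p := zvar gam a x; have p0 : p <= 0 := zvar_ge0P x0.
have pr : p <= 1 / 4 by lra.
have zE y : zvar gam a y = (level 0 - y) / D by [].
pose h i := if i == 0 then h0 else h1 : R -> R.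
pose d i := if i == 0 then d0 else d1 : R -> R.
have ltz z : p <= z <= 1 / 4 -> z < 1 / 2 by move=> /andP[_ ?]; lra.
have dh i z : z < 1 / 2 -> is_derive z (1 : R) (h i) (d i z).
  by move=> /sys[? ? _ _]; rewrite /h /d; case: (I2E i) => ->.
have cdi i z : z < 1 / 2 -> {for z, continuous (d i)}.
  by move=> /cd[? ?]; rewrite /d; case: (I2E i) => ->.
have lipi i := lip_bounded_der pr (fun z hz => dh i z (ltz z hz)) (fun z hz => cdi i z (ltz z hz)).
have [L0 L00 [l0 b0]] := lipi 0; have [L1 L10 [l1 b1]] := lipi 1.
pose f i y := h i (clampr p (1 / 4) (zvar gam a y)).
pose L := (L0 + L1) * (D^-1 + 1).
have LL : 0 <= L0 + L1 by rewrite addr_ge0.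
have Di : 0 < D^-1 by rewrite invr_gt0.
have Lge0 : 0 <= L by rewrite mulr_ge0//; lra.
have fl i y y' : `|f i y - f i y'| <= L * `|y - y'|.
  have E : `|zvar gam a y - zvar gam a y'| = D^-1 * `|y - y'|.
    rewrite !zE -mulrBl normrM (gtr0_norm Di) mulrC; congr (_ * _).
    by rewrite -[RHS]normrN; congr (`|_|); ring.
  apply: (@le_trans _ _ ((L0 + L1) * (D^-1 * `|y - y'|))).
    rewrite -E /f; case: (I2E i) => ->.
      by apply: le_trans (l0 _ _) _; rewrite ler_wpM2r// lerDl.
    by apply: le_trans (l1 _ _) _; rewrite ler_wpM2r// lerDr.
  by rewrite mulrA ler_wpM2r// ler_wpM2l// lerDl.
have fb i y : `|f i y| <= L.
  apply: (@le_trans _ _ (L0 + L1)); last by rewrite ler_peMr// lerDr ltW.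
  rewrite /f; case: (I2E i) => ->.
    by apply: le_trans (b0 _) _; rewrite lerDl.
  by apply: le_trans (b1 _) _; rewrite lerDr.
pose M := x - level 1.
have M0 : 0 <= M by rewrite /M; lra.
pose G := gam 0 + gam 1.
have [g0 g1] : 0 < gam 0 /\ 0 < gam 1 by [].
(* in this time the flow in state 1 raises z from 0 to at most 1/4 *)
pose r := (4 * gam 1)^-1.
have r0 : 0 < r by rewrite invr_gt0 mulr_gt0.
have gG i : gam i <= G by rewrite /G; case: (I2E i) => ->; rewrite ?lerDl ?lerDr ltW.
have lG i : 0 <= lam i by exact: ltW.
have G0 : 0 <= G by rewrite /G addr_ge0// ltW.
pose K := `|q| + 2 * (lam 0 + lam 1).
have K0 : 0 <= K by rewrite addr_ge0// mulr_ge0// addr_ge0.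
have hK i : `|lam i + q| + lam i <= K.
  have := ler_normD (lam i) q; rewrite (ger0_norm (lG i)) /K.
  by case: (I2E i) => ->; have := lG 0; have := lG 1; lra.
exists f, L, (K * L * (M * G)), r; split; last first.
  move=> y /andP[y1 y2]; rewrite /f clampr_id//.
  have := zvar_ge0P y1 => zn; apply/andP; split; last by lra.
  by rewrite /p !zE ler_wpM2r ?(ltW Di)// lerD2l lerN2.
split => //.
  by apply: mulr_ge0; apply: mulr_ge0.
split=> // i y t /andP[y1 y2] /andP[t0 tr].
have inz s : 0 <= s <= t -> p <= zvar gam a (flow i s y) <= 1 / 4.
  move=> /andP[s0 st].
  have hy : level 1 <= y <= x by rewrite y2 andbT; lra.
  have /andP[f1 f2] := flow_in i x0 s0 hy.
  apply/andP; split; first by rewrite /p !zE ler_wpM2r ?(ltW Di)// lerD2l lerN2.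
  case: (I2E i) f1 f2 => -> f1 f2.
    by apply: (@le_trans _ _ 0); [apply: zvar_ge0P; exact: flow0_above|lra].
  rewrite zE ler_pdivrMr//.
  have e := expR_ge1Dx (- (gam 1 * s)).
  have e2 : gam 1 * s <= 1 / 4.
    apply: (@le_trans _ _ (gam 1 * r)); first by rewrite ler_pM2l//; lra.
    by rewrite /r le_eqVlt; apply/orP; left; apply/eqP; field; rewrite gt_eqF.
  have E0 : 0 <= expR (- (gam 1 * s)) by exact: expR_ge0.
  have hD : D * expR (- (gam 1 * s)) <= (y - level 1) * expR (- (gam 1 * s)).
    by rewrite ler_wpM2r// /D; lra.
  have hD2 : D * (1 - 1 / 4) <= D * expR (- (gam 1 * s)) by rewrite ler_pM2l//; lra.
  by rewrite /flow; rewrite /D in hD hD2 *; lra.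
have fE j s : 0 <= s <= t -> f j (flow i s y) = h j (zvar gam a (flow i s y)).
  by move=> hs; rewrite /f clampr_id// inz.
have dflow s : is_derive s (1 : R) (fun s => flow i s y) (gam i * (level i - flow i s y)).
  have d1' : is_derive s (1 : R) (fun s => - (gam i * s)) (- gam i).
    have := derZ (- gam i) (derid s); rewrite mulr1 (_ : (fun y => _) = fun s => - (gam i * s))//.
    by apply/funext => u; rewrite mulNr.
  have := derD (derC (level i) s) (derZ (y - level i) (@der_comp R expR (fun s => - (gam i * s)) s _ _ (is_derive_expR _) d1')).
  by move=> dd; apply: is_derive_eq dd _; rewrite /flow; ring.
have dz s : is_derive s (1 : R) (fun s => zvar gam a (flow i s y))
    (- D^-1 * (gam i * (level i - flow i s y))).
  have := derZ (- D^-1) (derB (dflow s) (derC (level 0) s)).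
  rewrite (_ : (fun y => _) = fun s => zvar gam a (flow i s y)).
    by move=> dd; apply: is_derive_eq dd _; rewrite subr0.
  by apply/funext => u; rewrite zE; ring.
pose g s := (lam i + q) * f i (flow i s y) - lam i * f (other_state i) (flow i s y) - sg.
have dpsi s : 0 <= s <= t -> is_derive s (1 : R) (fun s => h i (zvar gam a (flow i s y))) (g s).
  move=> hs; have zz := ltz _ (inz s hs).
  apply: is_derive_eq (@der_comp R (h i) (fun s => zvar gam a (flow i s y)) s _ _ (dh i _ zz) (dz s)) _.
  rewrite /g !fE//; have [_ _ e0 e1] := sys _ zz.
  move: e0 e1 (zE (flow i s y)); rewrite /h /d /other_state.
  set z := zvar gam a _; set Y := flow i s y => e0 e1 ez.
  have eY : Y = level 0 - z * D by rewrite ez mulfVK ?gt_eqF//; ring.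
  case: (I2E i) => ->; rewrite /= eY.
    have -> : d0 z * (- D^-1 * (gam 0 * (level 0 - (level 0 - z * D)))) = - gam 0 * (z * d0 z).
      by field; rewrite gt_eqF.
    by rewrite e0 /beta; field; rewrite gt_eqF.
  have -> : d1 z * (- D^-1 * (gam 1 * (level 1 - (level 0 - z * D)))) = gam 1 * ((1 - z) * d1 z).
    by rewrite /D; field; rewrite gt_eqF.
  by rewrite e1 /beta; field; rewrite gt_eqF.
have [c /andP[c0 c1] e] := is_derive_MVT t0 dpsi.
have tt : 0 <= t <= t by rewrite t0 lexx.
have t00 : (0 : R) <= 0 <= t by rewrite lexx t0.
move: e; rewrite -fE// -fE// flow0 subr0 => ->.
have fc j : `|f j (flow i c y) - f j y| <= L * (M * G * t).
  apply: le_trans (fl _ _ _) _; rewrite ler_wpM2l//.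
  apply: le_trans (flow_dist _ _ c0) _.
  apply: ler_pM => //; first by rewrite mulr_ge0// ltW.
  apply: ler_pM => //; first by rewrite ltW.
  rewrite /M; case: (I2E i) => ->.
    by rewrite ger0_norm; lra.
  by rewrite ger0_norm; lra.
have -> : g c * t - t * ((lam i + q) * f i y - lam i * f (other_state i) y - sg) =
   ((lam i + q) * (f i (flow i c y) - f i y) - lam i * (f (other_state i) (flow i c y) - f (other_state i) y)) * t.
  by rewrite /g; ring.
rewrite normrM (ger0_norm t0) ler_wpM2r//.
apply: (@le_trans _ _ ((`|lam i + q| + lam i) * (L * (M * G * t)))).
  rewrite (le_trans (ler_normB _ _))// !normrM (ger0_norm (lG i)) mulrDl.
  by rewrite lerD// ler_wpM2l.
apply: (@le_trans _ _ (K * (L * (M * G * t)))).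
  by apply: ler_wpM2r => //; apply: mulr_ge0 => //; apply: mulr_ge0 => //; apply: mulr_ge0.
by rewrite le_eqVlt; apply/orP; left; apply/eqP; ring.
Qed.

End Interface.

(** * The paths of the process *)

Section RealInduction.
Variables (R : realType) (e : R -> 'I_2).
Hypothesis e_right : forall t, 0 <= t -> \forall s \near t^'+, e s = e t.
Hypothesis e_left : forall t, 0 < t -> exists i, \forall s \near t^'-, e s = i.
Implicit Types (s t r u h : R).

Lemma near_rightP (t : R) (Q : R -> Prop) : (\forall s \near t^'+, Q s) ->
  exists2 d, 0 < d & forall s, t < s -> s < t + d -> Q s.
Proof.
move=> /nbhs_ballP[d /= d0 hd]; exists d => // s ts sd; apply: hd => //=.
by rewrite /ball/= distrC gtr0_norm ?subr_gt0//; lra.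
Qed.

Lemma near_leftP (t : R) (Q : R -> Prop) : (\forall s \near t^'-, Q s) ->
  exists2 d, 0 < d & forall s, t - d < s -> s < t -> Q s.
Proof.
move=> /nbhs_ballP[d /= d0 hd]; exists d => // s ts sd; apply: hd => //=.
by rewrite /ball/= gtr0_norm ?subr_gt0//; lra.
Qed.

(** Induction along the intervals of constancy of e: the supremum of the times
    reached is attained thanks to the left limit, and passed thanks to right
    continuity. *)
Lemma path_induct (Q : R -> Prop) : Q 0 ->
  (forall s s', 0 <= s -> s <= s' -> (forall r, s <= r -> r < s' -> e r = e s) ->
     Q s -> Q s') -> forall t, 0 <= t -> Q t.
Proof.
move=> Q0 Qs t t0; apply: contrapT => nQt.
pose A := [set u | 0 <= u /\ forall r, 0 <= r -> r <= u -> Q r].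
have A0 : A 0.
  by split => // r r0 r1; have -> : r = 0 by apply/eqP; rewrite eq_le r0 r1.
have At u : A u -> u < t.
  by move=> [u0 hu]; rewrite ltNge; apply/negP => tu; apply: nQt; exact: hu.
have hs : has_sup A by split; [exists 0|exists t => u /At/ltW].
pose c := sup A.
have c0 : 0 <= c by apply: (ub_le_sup hs.2).
have below r : 0 <= r -> r < c -> Q r.
  move=> r0 rc; have [u [_ hu] ru] := sup_adherent (ltac:(by rewrite subr_gt0) : 0 < c - r) hs.
  by apply: hu => //; rewrite -/c in ru; lra.
have Qc : Q c.
  have [<-//|cn] := eqVneq 0 c.
  have cp : 0 < c by rewrite lt_neqAle cn.
  have [i /near_leftP[d d0 hd]] := e_left cp.
  pose s := Num.max (c / 2) (c - d / 2).
  have [s1 s2 s3] : [/\ 0 <= s, c - d < s & s < c].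
    by rewrite /s; split; rewrite ?le_max ?lt_max ?gt_max; do ?(apply/andP; split); do ?(apply/orP; by [left; lra|right; lra]); lra.
  apply: (Qs s) => //; [exact: ltW| |exact: below].
  by move=> r sr rc; rewrite !hd//; lra.
have [d d0 hd] := near_rightP (e_right c0).
have : A (c + d / 2).
  split; first by lra.
  move=> r r0 rd; have [rc|cr] := ltP r c; first exact: below.
  apply: (Qs c) => // u cu ur; have [->//|uc] := eqVneq u c.
  by apply: hd; [rewrite lt_neqAle eq_sym uc|lra].
move=> /(ub_le_sup hs.2); rewrite -/c; lra.
Qed.

Lemma finite_switches t : 0 <= t -> exists ts : seq R, forall s s',
  0 <= s -> s <= s' -> s' <= t -> (forall u, u \in ts -> ~ (s < u <= s')) ->
  forall r, s <= r -> r <= s' -> e r = e s.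
Proof.
move: t; apply: path_induct.
  exists [::] => s s' s0 ss' s't _ r sr rs'.
  by congr e; apply/eqP; rewrite eq_le sr andbT; lra.
move=> p q p0 pq cst [ts hts]; exists (p :: q :: ts) => s s' s0 ss' s'q hn r sr rs'.
have [s'p|ps'] := leP s' p.
  apply: (hts s s') => // u uts; apply: hn; by rewrite !inE uts !orbT.
have ps : p <= s.
  rewrite leNgt; apply/negP => sp; apply: (hn p); first by rewrite !inE eqxx.
  by rewrite sp ltW.
have [sq|qs] := eqVneq s q.
  by congr e; apply/eqP; rewrite eq_le sr andbT; lra.
have s'q' : s' < q.
  rewrite lt_neqAle s'q andbT; apply/eqP => s'qE; apply: (hn q).
    by rewrite !inE eqxx orbT.
  rewrite s'qE lexx andbT lt_neqAle qs/=; lra.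
by rewrite !cst//; lra.
Qed.

End RealInduction.

Section PathAnalysis.
Variables (R : realType) (gam a : 'I_2 -> R).
Hypotheses (gam_gt0 : forall i, 0 < gam i).
Hypothesis a_gam : a 1 / gam 1 < a 0 / gam 0.
Variables (x : R) (e : R -> 'I_2) (X : R -> R).
Hypothesis e_right : forall t, 0 <= t -> \forall s \near t^'+, e s = e t.
Hypothesis e_left : forall t, 0 < t -> exists i, \forall s \near t^'-, e s = i.
Implicit Types (s t r u h : R).
Hypothesis X_ou : ou_path a gam x e X.
Hypothesis x_ge : level gam a 0 <= x.

Notation mu := (@lebesgue_measure R).
Notation fl := (flow gam a).
Notation l0 := (level gam a 0).
Notation l1 := (level gam a 1).

Let cX : {within `[0, +oo[, continuous X}. Proof. by case: X_ou. Qed.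
Let X0 : X 0 = x. Proof. by case: X_ou => _ []. Qed.
Let vel s := a (e s) - gam (e s) * X s.

Lemma X_within s s' : 0 <= s -> {within `[s, s'], continuous X}.
Proof.
move=> s0; apply: continuous_subspaceW cX => r /=.
by rewrite !in_itv/= => /andP[sr _]; rewrite andbT; lra.
Qed.

Lemma X_cont t : 0 < t -> {for t, continuous X}.
Proof.
move=> t0; have c : {within `]0, +oo[, continuous X}.
  apply: continuous_subspaceW cX => r /=.
  by rewrite !in_itv/= !andbT => /ltW.
have oI : open (`]0, +oo[%classic : set R) by exact: interval_open.
move: c; rewrite continuous_open_subspace// => c.
by apply: c; rewrite inE/= in_itv/= t0.
Qed.

Lemma vel_measurable t : 0 <= t -> measurable_fun `[0, t[ vel.
Proof.
move: t; apply: (path_induct e_right e_left).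
  by rewrite set_itvco0; exact: measurable_fun_set0.
move=> s s' s0 ss' cst ms.
have -> : `[0, s'[%classic = `[0, s[%classic `|` `[s, s'[%classic :> set R.
  rewrite -(@itv_bndbnd_setU _ _ (BLeft 0) (BLeft s) (BLeft s'))//.
apply/measurable_funU => //; split => //.
apply: (@eq_measurable_fun _ _ _ _ _ (fun r => a (e s) - gam (e s) * X r)).
  move=> r; rewrite inE/= in_itv/= => /andP[sr rs'].
  by rewrite /vel cst.
apply: measurable_funB; first exact: measurable_cst.
apply: measurable_funM; first exact: measurable_cst.
apply: subspace_continuous_measurable_fun => //.
apply: continuous_subspaceW cX => r /=.
by rewrite !in_itv/= => /andP[sr _]; rewrite andbT; lra.
Qed.

Lemma vel_integrable t : 0 <= t -> mu.-integrable `[0, t] (EFin \o vel).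
Proof.
move=> t0.
suff : mu.-integrable `[0, t + 1[ (EFin \o vel).
  apply: integrableS => // r /=; rewrite !in_itv/= => /andP[-> h]; lra.
apply: measurable_bounded_integrable => //.
- have := @lebesgue_measure_itv R `[0, t + 1[; rewrite /= => ->.
  by case: ifP => // _; rewrite -EFinB ltry.
- by apply: vel_measurable; lra.
have cpt : {within `[0, t + 1], continuous (fun r => `|X r|)}.
  have c := @X_within 0 (t + 1) (lexx _).
  by move=> r; apply: cvg_norm; exact: c.
have [c _ hc] := EVT_max (ltac:(lra) : 0 <= t + 1) cpt.
pose M := `|a 0| + `|a 1| + (gam 0 + gam 1) * `|X c|.
exists M; split; first exact: num_real.
move=> M' MM' r /=; rewrite in_itv/= => /andP[r0 rt].
apply: le_trans (ltW MM'); rewrite /vel (le_trans (ler_normB _ _))//.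
have hX : `|X r| <= `|X c| by apply: hc; rewrite in_itv/= r0 ltW.
rewrite normrM (gtr0_norm (gam_gt0 _)) /M; apply: lerD.
  by case: (I2E (e r)) => ->; rewrite ?lerDl ?lerDr.
apply: ler_pM => //; first exact: ltW.
by case: (I2E (e r)) => ->; rewrite ?lerDl ?lerDr ltW.
Qed.

Lemma X_deriv s s' i t : 0 <= s -> (forall r, s <= r -> r < s' -> e r = i) ->
  s < t -> t < s' -> is_derive t (1 : R) X (a i - gam i * X t).
Proof.
move=> s0 cst st ts'; have t0 : 0 < t by lra.
have [_ [_ XE]] := X_ou.
have ev : vel t = a i - gam i * X t by rewrite /vel cst// ltW.
have cv : {for t, continuous vel}.
  have c : {for t, continuous (fun r => a i - gam i * X r)}.
    apply: continuousB; first exact: cst_continuous.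
    by apply: continuousM; [exact: cst_continuous|exact: X_cont].
  rewrite /prop_for /continuous_at ev; apply: cvg_trans c; apply: near_eq_cvg; near=> r.
  rewrite /vel cst//; [apply: ltW|]; near: r; [exact: lt_nbhsr|exact: lt_nbhsl].
have [dF FE] := continuous_FTC1_closed (ltac:(lra) : t < t + 1)
  (vel_integrable (ltac:(lra) : 0 <= t + 1)) t0 cv.
set F := (fun x0 => _) in dF FE.
have dF' : is_derive t (1 : R) F (vel t) by apply: DeriveDef; [exact: dF|rewrite -derive1E; exact: FE].
have hd : is_derive t (1 : R) (fun y => x + F y) (a i - gam i * X t).
  by apply: is_derive_eq (derD (derC x t) dF') _; rewrite add0r; exact: ev.
apply: near_eq_is_derive hd; near=> r; rewrite XE//.
by apply: ltW; near: r; exact: lt_nbhsr.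
Unshelve. all: by end_near. Qed.

(** (X - l_i) exp(gamma_i t) is constant while the state is i. *)
Lemma X_piece s s' i : 0 <= s -> s <= s' -> (forall r, s <= r -> r < s' -> e r = i) ->
  X s' = fl i (s' - s) (X s).
Proof.
move=> s0; rewrite le_eqVlt => /predU1P[<- _|ss' cst]; first by rewrite subrr flow0.
pose G r := (X r - level gam a i) * expR (gam i * (r - s)).
have dE r : is_derive r (1 : R) (fun r => expR (gam i * (r - s))) (expR (gam i * (r - s)) * gam i).
  have d1 : is_derive r (1 : R) (fun r => gam i * (r - s)) (gam i).
    by have := derZ (gam i) (derB (derid r) (derC s r)); rewrite subr0 mulr1.
  exact: (@der_comp R expR (fun r => gam i * (r - s)) r _ _ (is_derive_expR _) d1).
have dG r : r \in `]s, s'[%R -> is_derive r (1 : R) G ((fun=> 0) r).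
  rewrite in_itv/= => /andP[sr rs'].
  apply: is_derive_eq (derM (derB (X_deriv s0 cst sr rs') (derC (level gam a i) r)) (dE r)) _.
  by rewrite /level; field; rewrite gt_eqF.
have cG : {within `[s, s'], continuous G}.
  have cx := X_within (s' := s') s0.
  have ce : {within `[s, s'], continuous (fun r => expR (gam i * (r - s)))}.
    by apply: continuous_in_subspaceT => r _; exact: der_cont (dE r).
  move=> r; apply: cvgM; last exact: ce.
  by apply: cvgB; [exact: cx|exact: cvg_cst].
have [c _] := MVT ss' dG cG; rewrite mul0r => /eqP; rewrite subr_eq0 => /eqP.
rewrite /G subrr mulr0 expR0 mulr1 => h.
by rewrite /flow -h -mulrA -expRD subrr expR0 mulr1 addrC subrK.
Qed.

Lemma X_in t : 0 <= t -> l1 <= X t <= x.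
Proof.
move: t; apply: (path_induct e_right e_left).
  by rewrite X0 lexx andbT; apply: le_trans x_ge; exact: ltW.
move=> s s' s0 ss' cst h; rewrite (X_piece s0 ss' cst).
by apply: flow_in => //; rewrite subr_ge0.
Qed.

Lemma X_stay_below s t : 0 <= s -> s <= t -> X s < l0 -> X t < l0.
Proof.
move=> s0 st Xs; have t0 : 0 <= t by lra.
move: t t0 st; apply: (path_induct e_right e_left).
  move=> s00; have -> : 0 = s by apply/eqP; rewrite eq_le s0 s00.
  exact: Xs.
move=> p q p0 pq cst IH sq; have [sp|ps] := leP s p.
  rewrite (X_piece p0 pq cst); apply: flow_below => //; first by rewrite subr_ge0.
  exact: IH.
rewrite (@X_piece s q (e p) s0 sq); last by move=> r sr rq; apply: cst => //; lra.
by apply: flow_below => //; rewrite subr_ge0.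
Qed.

Definition speed_bound : R := 2 * ((x - l1) * (gam 0 + gam 1)).

Lemma bnd_ge0 : 0 <= speed_bound.
Proof.
have a0 : l1 < l0 := a_gam.
rewrite /speed_bound; apply: mulr_ge0 => //; apply: mulr_ge0.
  by rewrite subr_ge0; apply: le_trans x_ge; exact: ltW.
by rewrite addr_ge0// ltW.
Qed.

Lemma lvl_dist i y : l1 <= y <= x -> `|y - level gam a i| <= x - l1.
Proof.
move=> /andP[y1 y2]; have a0 : l1 < l0 := a_gam.
by have := x_ge; rewrite ler_norml; case: (I2E i) => -> ?; apply/andP; split; lra.
Qed.

Lemma flow_dist_bnd i h y : 0 <= h -> l1 <= y <= x -> `|fl i h y - y| <= speed_bound / 2 * h.
Proof.
move=> h0 hy; apply: le_trans (@flow_dist R gam a gam_gt0 i h y h0) _.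
have -> : speed_bound / 2 * h = (x - l1) * (gam 0 + gam 1) * h by rewrite /speed_bound; field.
rewrite ler_wpM2r//; apply: ler_pM => //; rewrite ?(ltW (gam_gt0 _)) ?lvl_dist//.
by case: (I2E i) => ->; rewrite ?lerDl ?lerDr (ltW (gam_gt0 _)).
Qed.

Lemma X_lip s t : 0 <= s -> s <= t -> `|X t - X s| <= speed_bound / 2 * (t - s).
Proof.
move=> s0 st; have t0 : 0 <= t by lra.
move: t t0 st; apply: (path_induct e_right e_left).
  move=> s00; have -> : s = 0 by apply/eqP; rewrite eq_le s0 s00.
  by rewrite !subrr normr0 mulr0.
move=> p q p0 pq cst IH sq; have [sp|ps] := leP s p.
  have -> : X q - X s = (X q - X p) + (X p - X s) by ring.
  have -> : speed_bound / 2 * (q - s) = speed_bound / 2 * (q - p) + speed_bound / 2 * (p - s) by ring.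
  rewrite (le_trans (ler_normD _ _))// lerD ?IH// (X_piece p0 pq cst).
  by apply: flow_dist_bnd; rewrite ?subr_ge0 ?X_in.
rewrite (@X_piece s q (e p) s0 sq); last by move=> r sr rq; apply: cst => //; lra.
by apply: flow_dist_bnd; rewrite ?subr_ge0 ?X_in.
Qed.

(** The error made by ignoring the switches in ]s, s + h]. *)
Definition flow_resid h s : R := `|X (s + h) - fl (e s) h (X s)|.

Lemma resid_le h s : 0 <= s -> 0 <= h -> flow_resid h s <= speed_bound * h.
Proof.
move=> s0 h0; rewrite /flow_resid.
have -> : X (s + h) - fl (e s) h (X s) = (X (s + h) - X s) - (fl (e s) h (X s) - X s) by ring.
have -> : speed_bound * h = speed_bound / 2 * (s + h - s) + speed_bound / 2 * h by field.
rewrite (le_trans (ler_normB _ _))// lerD//.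
  by apply: X_lip => //; rewrite lerDl.
by apply: flow_dist_bnd => //; exact: X_in.
Qed.

(** The error vanishes on grid intervals without a switch, and is O(h) on the
    others, whose number is bounded in terms of the path. *)
Lemma sum_resid t : 0 <= t -> exists2 K, 0 <= K & forall (h : R) (n : nat),
  0 <= h -> n%:R * h <= t -> \sum_(k < n) flow_resid h (k%:R * h) <= K * h.
Proof.
move=> t0; have [ts hts] := finite_switches e_right e_left t0.
exists ((size ts)%:R * speed_bound); first by rewrite mulr_ge0 ?bnd_ge0.
move=> h n h0 nt.
have kin (k : 'I_n) : [/\ 0 <= k%:R * h, k%:R * h <= k.+1%:R * h & k.+1%:R * h <= t].
  split; rewrite ?mulr_ge0// ?ler_wpM2r ?ler_nat//.
  by apply: le_trans nt; rewrite ler_wpM2r// ler_nat.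
have kS (k : nat) : k%:R * h + h = k.+1%:R * h by rewrite -natr1 mulrDl mul1r.
have one (k : 'I_n) : flow_resid h (k%:R * h) <=
   \sum_(u <- ts) ((k%:R : R) * h < u <= (k.+1%:R : R) * h)%R%:R * (speed_bound * h).
  have [k0 k1 k2] := kin k.
  have [/hasP[u uts hu]|/hasPn no] := boolP (has (fun u : R => (k%:R : R) * h < u <= (k.+1%:R : R) * h) ts).
    rewrite (big_rem u)//= hu mul1r; apply: le_trans (resid_le k0 h0) _.
    by rewrite lerDl sumr_ge0// => i _; rewrite mulr_ge0// mulr_ge0// bnd_ge0.
  suff -> : flow_resid h (k%:R * h) = 0.
    by rewrite sumr_ge0// => i _; rewrite mulr_ge0// mulr_ge0// bnd_ge0.
  have cst := hts _ _ k0 k1 k2 (fun u uts => elimN idP (no u uts)).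
  have cst' r : k%:R * h <= r -> r < k.+1%:R * h -> e r = e (k%:R * h).
    by move=> r1 r2; apply: cst => //; exact: ltW.
  have := X_piece k0 k1 cst'.
  have dk : k.+1%:R * h - k%:R * h = h by rewrite -kS addrAC subrr add0r.
  by rewrite /flow_resid kS dk => ->; rewrite subrr normr0.
apply: le_trans (ler_sum _ (fun k _ => one k)) _.
rewrite exchange_big/=.
apply: (@le_trans _ _ (\sum_(u <- ts) speed_bound * h)); last first.
  by rewrite big_const_seq count_predT iter_addr_0 -[leLHS]mulr_natl mulrA.
have Bh : 0 <= speed_bound * h by apply: mulr_ge0 => //; exact: bnd_ge0.
apply: ler_sum => u _; rewrite -mulr_suml ler_piMl//.
have atmost : forall m, \sum_(k < m) ((k%:R : R) * h < u <= (k.+1%:R : R) * h)%R%:R <= (u <= (m%:R : R) * h)%R%:R :> R.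
  elim=> [|m IH]; first by rewrite big_ord0.
  rewrite big_ord_recr/=.
  have [um|mu] := leP u (m%:R * h).
    have hT : (u <= m.+1%:R * h) = true by apply: le_trans um _; rewrite ler_wpM2r// ler_nat.
    by rewrite hT/= addr0 (le_trans IH)// lern1 leq_b1.
  have hF : (u <= m%:R * h) = false by rewrite leNgt mu.
  by rewrite (le_trans (lerD IH (lexx _)))// hF/= add0r.
by apply: le_trans (atmost n) _; rewrite lern1 leq_b1.
Qed.

End PathAnalysis.

(** * Expectations of bounded functions *)

Section BoundedExpectation.
Context {R : realType} {d : measure_display} {Omega : measurableType d}.
Variable P : probability Omega R.
Implicit Types (f g : Omega -> R) (k M : R) (A : set Omega).

Definition bounded_mfun f := measurable_fun setT f /\ exists M, forall w, `|f w| <= M.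

Definition Ex f : R := fine (\int[P]_w (f w)%:E).

Lemma bmf_integrable f : bounded_mfun f -> P.-integrable setT (EFin \o f).
Proof.
move=> [mf [M hM]]; apply: measurable_bounded_integrable => //.
  by apply: (@le_lt_trans _ _ 1%E); [exact: probability_le1|exact: ltry].
by exists M; split; [exact: num_real|move=> M' MM' w _; apply: le_trans (hM w) (ltW MM')].
Qed.

Lemma bmf_fin f : bounded_mfun f -> (\int[P]_w (f w)%:E)%E \is a fin_num.
Proof. by move=> bf; apply: integrable_fin_num => //; exact: bmf_integrable. Qed.

Lemma bmf_cst k : bounded_mfun (fun=> k).
Proof. by split; [exact: measurable_cst|exists `|k|]. Qed.

Lemma bmfD f g : bounded_mfun f -> bounded_mfun g -> bounded_mfun (fun w => f w + g w).
Proof.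
move=> [mf [M hM]] [mg [N hN]]; split; first exact: measurable_funD.
by exists (M + N) => w; rewrite (le_trans (ler_normD _ _))// lerD.
Qed.

Lemma bmfM f g : bounded_mfun f -> bounded_mfun g -> bounded_mfun (fun w => f w * g w).
Proof.
move=> [mf [M hM]] [mg [N hN]]; split; first exact: measurable_funM.
by exists (M * N) => w; rewrite normrM ler_pM.
Qed.

Lemma bmfZ k f : bounded_mfun f -> bounded_mfun (fun w => k * f w).
Proof. by move=> bf; apply: bmfM => //; exact: bmf_cst. Qed.

Lemma bmfB f g : bounded_mfun f -> bounded_mfun g -> bounded_mfun (fun w => f w - g w).
Proof.
move=> bf bg; have := bmfD bf (bmfZ (-1) bg).
by under eq_fun do rewrite mulN1r.
Qed.

Lemma bmf_sum (n : nat) (F : nat -> Omega -> R) : (forall i, bounded_mfun (F i)) ->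
  bounded_mfun (fun w => \sum_(i < n) F i w).
Proof.
move=> bF; elim: n => [|n IH].
  by under eq_fun do rewrite big_ord0; exact: bmf_cst.
by under eq_fun do rewrite big_ord_recr/=; exact: bmfD.
Qed.

Lemma bmf_norm f : bounded_mfun f -> bounded_mfun (fun w => `|f w|).
Proof.
move=> [mf [M hM]]; split; first exact: measurableT_comp.
by exists M => w; rewrite normr_id.
Qed.

Lemma bmf_indic A : measurable A -> bounded_mfun (\1_A : Omega -> R).
Proof.
move=> mA; split; first exact: measurable_indic.
by exists 1 => w; rewrite indicE; case: (w \in A); rewrite ?normr0 ?normr1.
Qed.

Lemma bmf_lim (F : nat -> Omega -> R) f M : (forall n, bounded_mfun (F n)) ->
  (forall n w, `|F n w| <= M) -> (forall w, F n w @[n --> \oo] --> f w) -> bounded_mfun f.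
Proof.
move=> bF hM hl; split.
  by apply: (measurable_fun_cvg (h := F)) => [m|w _]; [have [] := bF m|exact: hl].
exists M => w; have h : `|F n w| @[n --> \oo] --> `|f w| by apply: cvg_norm; exact: hl.
by apply: (cvgr_to_le h); near=> n; exact: hM.
Unshelve. all: by end_near. Qed.

Lemma ExD f g : bounded_mfun f -> bounded_mfun g -> Ex (fun w => f w + g w) = Ex f + Ex g.
Proof.
move=> bf bg; rewrite /Ex -fineD ?bmf_fin//; congr fine.
by rewrite -integralD//; exact: bmf_integrable.
Qed.

Lemma ExZ k f : bounded_mfun f -> Ex (fun w => k * f w) = k * Ex f.
Proof.
move=> bf; rewrite /Ex -[X in X * _]/(fine k%:E) -fineM ?bmf_fin//; congr fine.
by rewrite -integralZl//; exact: bmf_integrable.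
Qed.

Lemma ExB f g : bounded_mfun f -> bounded_mfun g -> Ex (fun w => f w - g w) = Ex f - Ex g.
Proof.
move=> bf bg; under [in LHS]eq_fun do rewrite -mulN1r.
by rewrite ExD//; [rewrite ExZ// mulN1r|exact: bmfZ].
Qed.

Lemma Ex_sum (n : nat) (F : nat -> Omega -> R) : (forall i, bounded_mfun (F i)) ->
  Ex (fun w => \sum_(i < n) F i w) = \sum_(i < n) Ex (F i).
Proof.
move=> bF; elim: n => [|n IH].
  rewrite big_ord0 /Ex; under eq_integral do rewrite big_ord0.
  by rewrite integral0.
rewrite big_ord_recr/= -IH -ExD//; last exact: bmf_sum.
by congr Ex; apply/funext => w; rewrite big_ord_recr.
Qed.

Lemma Ex_le f g : bounded_mfun f -> bounded_mfun g -> (forall w, f w <= g w) -> Ex f <= Ex g.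
Proof.
move=> bf bg fg; rewrite /Ex fine_le ?bmf_fin//.
apply: le_integral => //; [exact: bmf_integrable|exact: bmf_integrable|].
by move=> w _; rewrite lee_fin.
Qed.

Lemma Ex_cst k : Ex (fun=> k) = k.
Proof. by rewrite /Ex integral_cst//= probability_setT mule1. Qed.

Lemma Ex_indic A : measurable A -> Ex \1_A = fine (P A).
Proof. by move=> mA; rewrite /Ex integral_indic// setIT. Qed.

Lemma Ex_norm_le f g : bounded_mfun f -> bounded_mfun g -> (forall w, `|f w| <= g w) -> `|Ex f| <= Ex g.
Proof.
move=> bf bg fg; rewrite ler_norml; apply/andP; split.
  rewrite -mulN1r -ExZ//; apply: Ex_le => //; first exact: bmfZ.
  by move=> w; rewrite mulN1r; have := fg w; rewrite ler_norml => /andP[].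
by apply: Ex_le => // w; apply: le_trans (fg w); exact: ler_norm.
Qed.

Lemma Ex_bound f M : bounded_mfun f -> (forall w, `|f w| <= M) -> `|Ex f| <= M.
Proof. by move=> bf hM; rewrite -(Ex_cst M); apply: Ex_norm_le => //; exact: bmf_cst. Qed.

Lemma Ex_dct (F : nat -> Omega -> R) f M : (forall n, bounded_mfun (F n)) ->
  (forall n w, `|F n w| <= M) -> (forall w, F n w @[n --> \oo] --> f w) ->
  Ex (F n) @[n --> \oo] --> Ex f.
Proof.
move=> bF hM hl; have bf := bmf_lim bF hM hl.
have [||||| _ _ h] := @dominated_convergence _ _ _ P setT measurableT
  (fun n w => (F n w)%:E) (fun w => (f w)%:E) (fun=> M%:E).
- by move=> n; apply/measurable_EFinP; have [] := bF n.
- by apply/measurable_EFinP; case: bf.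
- by apply: aeW => w _; apply: cvg_EFin; [exact: nearW|exact: hl].
- exact: (bmf_integrable (bmf_cst M)).
- by apply: aeW => w n _; rewrite lee_fin.
apply: fine_cvg; rewrite fineK ?bmf_fin//; exact: h.
Qed.

End BoundedExpectation.

Section LipschitzBounded.
Variable R : realType.
Implicit Types (F G : R -> R) (L : R).

Definition bounded_lip F := exists2 L, 0 <= L &
  (forall y y', `|F y - F y'| <= L * `|y - y'|) /\ (forall y, `|F y| <= L).

Lemma lipbM F G : bounded_lip F -> bounded_lip G -> bounded_lip (fun y => F y * G y).
Proof.
move=> [L L0 [lF bF]] [K K0 [lG bG]]; exists (2 * L * K + L * K).
  by rewrite addr_ge0// ?mulr_ge0.
have LK : 0 <= L * K by rewrite mulr_ge0.
split=> [y y'|y]; last first.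
  rewrite normrM; apply: (@le_trans _ _ (L * K)); first by rewrite ler_pM.
  by rewrite -mulrA lerDr mulr_ge0.
have -> : F y * G y - F y' * G y' = F y * (G y - G y') + (F y - F y') * G y' by ring.
rewrite (le_trans (ler_normD _ _))// !normrM.
apply: (@le_trans _ _ (L * (K * `|y - y'|) + L * `|y - y'| * K)).
  by rewrite lerD// ler_pM.
have n0 := normr_ge0 (y - y').
have -> : L * (K * `|y - y'|) + L * `|y - y'| * K = 2 * L * K * `|y - y'| by ring.
by rewrite ler_wpM2r// lerDl.
Qed.

Lemma lipb_continuous F : bounded_lip F -> continuous F.
Proof.
move=> [L L0 [lF _]] y; apply/cvgrPdist_le => e e0.
near=> z; apply: le_trans (lF _ _) _.
have h : `|z - y| < e / (L + 1) by near: z; apply: near_dist; rewrite divr_gt0// ltr_wpDl.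
rewrite distrC; apply: (@le_trans _ _ ((L + 1) * `|z - y|)); first by rewrite ler_wpM2r// lerDl.
by rewrite mulrC -ler_pdivlMr ?ltr_wpDl// ltW.
Unshelve. all: by end_near. Qed.

Lemma lipb_cvg F (u : R^nat) l : bounded_lip F -> u @ \oo --> l -> F (u n) @[n --> \oo] --> F l.
Proof. by move=> /lipb_continuous cF ul; apply: continuous_cvg => //; exact: cF. Qed.

Lemma lipbB F G : bounded_lip F -> bounded_lip G -> bounded_lip (fun y => F y - G y).
Proof.
move=> [L L0 [lF bF]] [K K0 [lG bG]]; exists (L + K); first by rewrite addr_ge0.
split=> [y y'|y]; last by rewrite (le_trans (ler_normB _ _))// lerD.
have -> : F y - G y - (F y' - G y') = (F y - F y') - (G y - G y') by ring.
by rewrite (le_trans (ler_normB _ _))// mulrDl lerD.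
Qed.

Lemma lipb_comp F G : bounded_lip F -> (forall y y', `|G y - G y'| <= `|y - y'|) ->
  bounded_lip (fun y => F (G y)).
Proof.
move=> [L L0 [lF bF]] hG; exists L => //; split=> [y y'|y] //.
by apply: le_trans (lF _ _) _; rewrite ler_wpM2l.
Qed.

(** Lipschitz approximations, from above, of the indicator of [l, +oo[. *)
Definition ramp l (m : nat) (y : R) : R := clampr 0 1 (1 + m%:R * (y - l)).

Lemma lipb_ramp l m : bounded_lip (ramp l m).
Proof.
have h01 : 0 <= 1 :> R by [].
exists (m%:R + 1); first by rewrite addr_ge0.
split=> [y y'|y].
  apply: le_trans (clampr_lip _ _ h01) _.
  have -> : 1 + m%:R * (y - l) - (1 + m%:R * (y' - l)) = m%:R * (y - y') by ring.
  by rewrite normrM normr_nat ler_wpM2r// lerDl.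
have /andP[a b] := clampr_in (1 + m%:R * (y - l)) h01.
by rewrite /ramp ger0_norm// (le_trans b)// lerDr.
Qed.

Lemma ramp_cvg l y : ramp l m y @[m --> \oo] --> ((l <= y)%R%:R : R).
Proof.
have [ly|yl] := leP l y.
  rewrite (_ : (fun m => _) = fun=> 1); first exact: cvg_cst.
  apply/funext => m; rewrite /ramp /clampr.
  have h : 1 <= 1 + m%:R * (y - l) by rewrite lerDl mulr_ge0// subr_ge0.
  by rewrite min_r// max_r.
apply/cvgrPdist_lt => e e0; near=> m.
suff -> : ramp l m y = 0 by rewrite subrr normr0.
rewrite /ramp /clampr max_l// ge_min; apply/orP; left.
have : (l - y)^-1 <= m%:R by near: m; exact: nbhs_infty_ger.
have h : 0 < l - y by lra.
rewrite -[X in X <= _]mul1r ler_pdivrMr// => h2.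
by lra.
Unshelve. all: by end_near. Qed.

End LipschitzBounded.

(** * The hitting time on a grid *)

Section Hitting.
Variables (R : realType) (gam a : 'I_2 -> R).
Hypotheses (gam_gt0 : forall i, 0 < gam i).
Hypothesis a_gam : a 1 / gam 1 < a 0 / gam 0.
Variables (x : R) (e : R -> 'I_2) (X : R -> R).
Hypothesis e_right : forall t, 0 <= t -> \forall s \near t^'+, e s = e t.
Hypothesis e_left : forall t, 0 < t -> exists i, \forall s \near t^'-, e s = i.
Hypothesis X_ou : ou_path a gam x e X.
Hypothesis x_ge : level gam a 0 <= x.
Implicit Types (s t h : R) (n k : nat).

Notation l0 := (level gam a 0).
Notation T := (hitting_time l0 X).

Let X0 : X 0 = x. Proof. by case: X_ou => _ []. Qed.
Let stay s t := X_stay_below gam_gt0 a_gam e_right e_left X_ou (s := s) (t := t).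

Lemma hit_ge0 : (0%:E <= T)%E.
Proof. by apply: le_ereal_inf_tmp => _ [t [t0 _] <-]; rewrite lee_fin. Qed.

Lemma hit_le t : 0 <= t -> X t < l0 -> (T <= t%:E)%E.
Proof. by move=> t0 Xt; apply: ereal_inf_lbound; exists t. Qed.

Lemma hit_ge t : 0 <= t -> l0 <= X t -> (t%:E <= T)%E.
Proof.
move=> t0 Xt; apply: le_ereal_inf_tmp => _ [s [s0 Xs] <-]; rewrite lee_fin leNgt.
by apply/negP => st; have := stay s0 (ltW st) Xs; rewrite ltNge Xt.
Qed.

Definition hit_at t : R := fine (Order.min T t%:E).

Lemma hit_atE t : 0 <= t -> (hit_at t)%:E = Order.min T t%:E.
Proof.
move=> t0; rewrite /hit_at fineK//; have := hit_ge0.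
by case: T => [r| |] //= h; rewrite /Order.min; case: ifP.
Qed.

Lemma hit_at_le t s : 0 <= t -> (hit_at t <= s) = (Order.min T t%:E <= s%:E)%E.
Proof. by move=> t0; rewrite -hit_atE// lee_fin. Qed.

Lemma hit_at_itv t : 0 <= t -> 0 <= hit_at t <= t.
Proof.
move=> t0; rewrite -!lee_fin hit_atE// le_min hit_ge0 lee_fin t0/=.
by rewrite ge_min lexx orbT.
Qed.

Lemma hit_at_alive t : 0 <= t -> l0 <= X t -> hit_at t = t.
Proof. by move=> t0 Xt; apply: EFin_inj; rewrite hit_atE// min_r// hit_ge. Qed.

(** The grid times at which the path is not below the level form an initial
    segment, so their number locates the crossing. *)
Definition alive_count h n : nat := \sum_(k < n) (l0 <= X (k%:R * h))%R.

Lemma cnt_le h n : (alive_count h n <= n)%N.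
Proof.
elim: n => [|n IH]; first by rewrite /alive_count big_ord0.
rewrite /alive_count big_ord_recr/= -/(alive_count h n).
by apply: leq_trans (leq_add IH (leq_b1 _)) _; rewrite addn1.
Qed.

Lemma cntS h n : alive_count h n.+1 = (alive_count h n + (l0 <= X (n%:R * h))%R)%N.
Proof. by rewrite /alive_count big_ord_recr. Qed.

Lemma alive_before h n : 0 <= h -> l0 <= X (n%:R * h) ->
  forall k, (k <= n)%N -> l0 <= X (k%:R * h).
Proof.
move=> h0 Xn k kn; rewrite leNgt; apply/negP => Xk.
have := @stay (k%:R * h) (n%:R * h) (mulr_ge0 (ler0n _ _) h0).
rewrite ler_wpM2r ?ler_nat// => /(_ isT Xk); by rewrite ltNge Xn.
Qed.

Lemma cnt_full h n : 0 <= h -> (forall k, (k < n)%N -> l0 <= X (k%:R * h)) -> alive_count h n = n.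
Proof.
move=> h0; elim: n => [|n IH] al; first by rewrite /alive_count big_ord0.
rewrite cntS (al n)// addn1 IH// => k kn; apply: al; exact: ltnW.
Qed.

Lemma cnt_spec h n : 0 <= h ->
  (forall k, (k < alive_count h n)%N -> l0 <= X (k%:R * h)) /\
  ((alive_count h n < n)%N -> X ((alive_count h n)%:R * h) < l0).
Proof.
move=> h0; elim: n => [|n [IH1 IH2]]; first by rewrite /alive_count big_ord0.
rewrite cntS; have [al|de] := leP l0 (X (n%:R * h)).
  have full : alive_count h n = n.
    by apply: cnt_full => // k kn; apply: (alive_before h0 al); exact: ltnW.
  by rewrite full addn1 ltnn; split=> // k; rewrite ltnS => kn; exact: alive_before kn.
rewrite addn0; split => // _.
by have [c|c] := ltnP (alive_count h n) n; [exact: IH2|have -> : alive_count h n = n by apply/eqP; rewrite eqn_leq cnt_le].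
Qed.

(** The factors equal to 1 are the first ones. *)
Lemma sum_alive_telescope (Z : nat -> R) h n : 0 <= h ->
  \sum_(k < n) (l0 <= X (k%:R * h))%R%:R * (Z k.+1 - Z k) = Z (alive_count h n) - Z 0.
Proof.
move=> h0; elim: n => [|n IH]; first by rewrite big_ord0 /alive_count big_ord0 subrr.
rewrite big_ord_recr/= IH cntS; have [al|de] := leP l0 (X (n%:R * h)).
  have -> : alive_count h n = n.
    by apply: cnt_full => // k kn; apply: (alive_before h0 al); exact: ltnW.
  by rewrite /= mul1r addn1; ring.
by rewrite /= addn0 mul0r addr0.
Qed.

Lemma cntE h n : (alive_count h n)%:R = \sum_(k < n) (l0 <= X (k%:R * h))%R%:R :> R.
Proof. by rewrite /alive_count natr_sum. Qed.

Lemma cnt_gt0 h n : (0 < n)%N -> (0 < alive_count h n)%N.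
Proof.
by case: n => // n _; rewrite /alive_count big_ord_recl/= mul0r X0 x_ge.
Qed.

Lemma cnt_hit h n : (0 < n)%N -> 0 <= h -> `|(alive_count h n)%:R * h - hit_at (n%:R * h)| <= h.
Proof.
move=> n0 h0; have [c1 c2] := cnt_spec n h0.
have t0 : 0 <= n%:R * h by rewrite mulr_ge0.
have K0 := cnt_gt0 h n0; have Kn := cnt_le h n.
have /andP[a0 a1] := hit_at_itv t0.
have pre : (alive_count h n).-1%:R * h <= hit_at (n%:R * h).
  rewrite -lee_fin hit_atE// le_min lee_fin ler_wpM2r ?ler_nat ?(leq_trans (leq_pred _) Kn)// andbT.
  by apply: hit_ge; [rewrite mulr_ge0|apply: c1; rewrite prednK].
have KS : (alive_count h n)%:R * h = (alive_count h n).-1%:R * h + h.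
  by rewrite -{1}(prednK K0) -natr1 mulrDl mul1r.
have post : hit_at (n%:R * h) <= (alive_count h n)%:R * h.
  have [c|c] := ltnP (alive_count h n) n.
    rewrite hit_at_le// ge_min; apply/orP; left.
    by apply: hit_le; [rewrite mulr_ge0|exact: c2].
  by have -> : alive_count h n = n by apply/eqP; rewrite eqn_leq Kn.
by rewrite ger0_norm ?subr_ge0//; lra.
Qed.

(** The first point of the grid of mesh t / n.+1 at which the path is below the
    level, or t if there is none. *)
Definition grid_hit t n : R := (alive_count (t / n.+1%:R) n.+1)%:R * (t / n.+1%:R).

Lemma cnt_hit_cvg t : 0 <= t ->
  grid_hit t n @[n --> \oo] --> hit_at t.
Proof.
move=> t0; rewrite /grid_hit; apply/cvgrPdist_le => eps eps0; near=> n.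
have h0 : 0 <= t / n.+1%:R by rewrite divr_ge0.
have := cnt_hit (ltn0Sn n) h0; rewrite [n.+1%:R * _]mulrC divfK// distrC => h.
apply: le_trans h _; rewrite ler_pdivrMr// -ler_pdivrMl//.
apply: (@le_trans _ _ n%:R); last by rewrite ler_nat.
near: n; exact: nbhs_infty_ger.
Unshelve. all: by end_near. Qed.

Lemma cnt_end t n : 0 <= t -> X t < l0 ->
  X (grid_hit t n) < l0.
Proof.
move=> t0 Xt; rewrite /grid_hit; have h0 : 0 <= t / n.+1%:R by rewrite divr_ge0.
have [_ c2] := cnt_spec n.+1 h0.
have [/c2//|c] := ltnP (alive_count (t / n.+1%:R) n.+1) n.+1.
have -> : alive_count (t / n.+1%:R) n.+1 = n.+1 by apply/eqP; rewrite eqn_leq cnt_le.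
by rewrite mulrC divfK.
Qed.

Lemma cnt_end_alive t n : 0 <= t -> l0 <= X t -> alive_count (t / n.+1%:R) n.+1 = n.+1.
Proof.
move=> t0 Xt; have h0 : 0 <= t / n.+1%:R by rewrite divr_ge0.
apply: cnt_full => // k kn; apply: (@alive_before _ n.+1) => //; last exact: ltnW.
by rewrite mulrC divfK.
Qed.

(** The state just after the crossing is 1: while the state is 0, a path at or
    above the level stays there. *)
Lemma cross_cvg (f : 'I_2 -> R -> R) t : 0 <= t -> X t < l0 -> bounded_lip (f 1) ->
  f (e (grid_hit t n)) (X (grid_hit t n)) @[n --> \oo] --> f 1 l0.
Proof.
move=> t0 Xt lf; pose s n := grid_hit t n; rewrite -/s.
pose tau := hit_at t; have /andP[tau0 taut] := hit_at_itv t0.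
have TE : T = tau%:E by rewrite hit_atE// min_l//; exact: hit_le.
have s0 n : 0 <= s n by rewrite /s /grid_hit mulr_ge0// divr_ge0.
have Xs n : X (s n) < l0 by exact: cnt_end.
have taus n : tau <= s n by rewrite -lee_fin -TE; exact: hit_le.
have lip := X_lip gam_gt0 a_gam e_right e_left X_ou x_ge.
set B := speed_bound gam a x / 2 in lip.
have B0 : 0 <= B by rewrite divr_ge0// (bnd_ge0 gam_gt0 a_gam x_ge).
have Xtau : l0 <= X tau.
  have [<-|tn] := eqVneq 0 tau; first by rewrite X0.
  have tp : 0 < tau by rewrite lt_neqAle tn.
  rewrite leNgt; apply/negP => Xn.
  pose de := Num.min tau ((l0 - X tau) / (B + 1)) / 2.
  have m0 : 0 < Num.min tau ((l0 - X tau) / (B + 1)).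
    by rewrite lt_min tp divr_gt0 ?subr_gt0//; lra.
  have d0 : 0 < de by rewrite divr_gt0.
  have [d1 d2] : de < tau /\ de < (l0 - X tau) / (B + 1).
    by apply/andP; rewrite -lt_min /de; lra.
  have r0 : 0 <= tau - de by lra.
  have Xr : l0 <= X (tau - de).
    rewrite leNgt; apply/negP => /(hit_le r0); rewrite TE lee_fin; lra.
  have := lip (tau - de) tau r0 (ltac:(lra)).
  have -> : tau - (tau - de) = de by ring.
  move: d2; rewrite ltr_pdivlMr; last by lra.
  by rewrite ler_norml => h1 /andP[h2 _]; nra.
have scv : s n @[n --> \oo] --> tau by exact: cnt_hit_cvg.
have tlt n : tau < s n.
  rewrite lt_neqAle taus andbT; apply/eqP => h; have := Xs n; rewrite -h; lra.
have [de d0 hd] := near_rightP (e_right tau0).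
have Xcv : X (s n) @[n --> \oo] --> l0.
  apply/cvgrPdist_le => eps eps0; near=> n.
  apply: (@le_trans _ _ (B * (s n - tau))).
    have := lip tau (s n) tau0 (taus n); have := Xs n.
    by rewrite !ler_norml => h1 /andP[h2 h3]; apply/andP; split; lra.
  have h : `|tau - s n| < eps / (B + 1).
    by near: n; move/cvgrPdist_lt: scv; apply; rewrite divr_gt0//; lra.
  have := tlt n; move: h; rewrite distrC gtr0_norm ?subr_gt0// ltr_pdivlMr; last by lra.
  by move=> h1 h2; nra.
have lcv := lipb_cvg lf Xcv.
apply: cvg_trans lcv; apply: near_eq_cvg; near=> n.
suff -> : e (s n) = 1 by [].
have sd : s n < tau + de.
  have : `|tau - s n| < de by near: n; move/cvgrPdist_lt: scv; exact.
  by rewrite ltr_distlC => /andP[].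
rewrite hd//; case: (I2E (e tau)) => // e0; exfalso.
have := @X_piece _ _ _ gam_gt0 _ _ _ e_right e_left X_ou tau (s n) 0 tau0 (taus n).
have cst r : tau <= r -> r < s n -> e r = 0.
  move=> r1 r2; have [->//|rt] := eqVneq r tau.
  by rewrite hd//; [rewrite lt_neqAle eq_sym rt|exact: lt_trans r2 sd].
move=> /(_ cst) h; have := Xs n; rewrite h ltNge => /negP; apply.
by apply: flow0_above => //; rewrite subr_ge0.
Unshelve. all: by end_near. Qed.

End Hitting.

(** * The Markov property for functions of the position *)

Section Markov.
Context {R : realType} {d : measure_display} {Omega : measurableType d}.
Variable P : probability Omega R.
Variables (gam a : 'I_2 -> R) (eps : R -> Omega -> 'I_2) (p : R -> 'I_2 -> 'I_2 -> R).
Hypothesis gam_gt0 : forall i, 0 < gam i.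
Hypothesis a_gam : a 1 / gam 1 < a 0 / gam 0.
Hypothesis eps_meas : forall t i, 0 <= t -> measurable (in_state eps t i).
Hypothesis eps_right : forall w t, 0 <= t -> \forall s \near t^'+, eps s w = eps t w.
Hypothesis eps_left : forall w t, 0 < t -> exists i, \forall s \near t^'-, eps s w = i.
Hypothesis p_trans : forall s h i j A, 0 <= s -> 0 <= h -> past eps s A ->
  (0 < P (A `&` in_state eps s i))%E ->
  cond_prob P (A `&` in_state eps s i) (in_state eps (s + h) j) = p h i j.
Variables (x : R) (X : R -> Omega -> R).
Hypothesis X_meas : forall t, measurable_fun setT (X t).
Hypothesis X_ou : forall w, ou_path a gam x (eps ^~ w) (fun t => X t w).
Hypothesis x_ge : level gam a 0 <= x.
Implicit Types (s t h y : R) (i j : 'I_2) (A : set Omega) (F : R -> R).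

Notation fl := (flow gam a).
Notation l0 := (level gam a 0).
Notation l1 := (level gam a 1).
Notation E := (Ex P).

Definition ind i s (w : Omega) : R := \1_(in_state eps s i) w.

Lemma indI (A B : set Omega) w : \1_(A `&` B) w = \1_A w * \1_B w :> R.
Proof. by rewrite indicI. Qed.

Lemma ind_eq i s w : ind i s w = (eps s w == i)%:R.
Proof.
rewrite /ind indicE; congr (_%:R); congr nat_of_bool.
by apply/idP/idP => [|/eqP] h; [apply/eqP; move: h; rewrite inE|rewrite inE].
Qed.

Lemma bmf_ind i s : 0 <= s -> bounded_mfun (ind i s).
Proof. by move=> s0; apply: bmf_indic; exact: eps_meas. Qed.

Lemma past_measurable s A : past eps s A -> measurable A.
Proof.
apply: (smallest_sub (X := measurable)).
  exact: sigma_algebra_measurable.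
by move=> _ [u [i [/andP[u0 _] ->]]]; exact: eps_meas.
Qed.

Lemma past_in_state s u i : 0 <= u <= s -> past eps s (in_state eps u i).
Proof. by move=> us; apply: sub_gen_smallest; exists u, i. Qed.

Lemma pastI s A B : past eps s A -> past eps s B -> past eps s (A `&` B).
Proof. have [h _] := @sigma_algebraP _ setT (past eps s) (fun U _ => @subsetT _ U).
by have [_ _ _] := h (smallest_sigma_algebra _ _); apply. Qed.

(** The functionals of the past for which the transition law holds.  They are
    closed under sums and bounded limits, which leads from events to functions
    of X(s). *)
Definition markov_at s h i (f : Omega -> R) := bounded_mfun f /\
  E (fun w => f w * ind i s w * ind i (s + h) w) = p h i i * E (fun w => f w * ind i s w).

Lemma markov_past s h i A : 0 <= s -> 0 <= h -> past eps s A ->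
  markov_at s h i \1_A.
Proof.
move=> s0 h0 pA; have mA := past_measurable pA.
have mi : measurable (in_state eps s i) by exact: eps_meas.
have mj : measurable (in_state eps (s + h) i) by apply: eps_meas; rewrite addr_ge0.
split; first exact: bmf_indic.
have -> : (fun w => \1_A w * ind i s w) = \1_(A `&` in_state eps s i) :> (Omega -> R).
  by apply/funext => w; rewrite indI.
have -> : (fun w => \1_A w * ind i s w * ind i (s + h) w) =
    \1_(A `&` in_state eps s i `&` in_state eps (s + h) i) :> (Omega -> R).
  by apply/funext => w; rewrite !indI.
have mAi : measurable (A `&` in_state eps s i) by exact: measurableI.
rewrite !Ex_indic//; last exact: measurableI.
have [P0|P0] := ltP 0%E (P (A `&` in_state eps s i)).
  have := p_trans i s0 h0 pA P0; rewrite /cond_prob => <-.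
  rewrite divfK// gt_eqF// fine_gt0// P0/=.
  by rewrite (le_lt_trans (probability_le1 _ _))// ltry.
have PA : P (A `&` in_state eps s i) = 0%E.
  by apply/eqP; rewrite eq_le P0 measure_ge0.
rewrite PA mulr0; suff -> : P (A `&` in_state eps s i `&` in_state eps (s + h) i) = 0%E by [].
apply/eqP; rewrite eq_le measure_ge0 andbT -PA.
by apply: le_measure; rewrite ?inE//; exact: measurableI.
Qed.

Lemma markovD s h i f g : 0 <= s -> 0 <= h ->
  markov_at s h i f -> markov_at s h i g -> markov_at s h i (fun w => f w + g w).
Proof.
move=> s0 h0 [bf ef] [bg eg]; split; first exact: bmfD.
have bi := bmf_ind i s0; have bj := bmf_ind i (addr_ge0 s0 h0).
have -> : (fun w => (f w + g w) * ind i s w * ind i (s + h) w) =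
    (fun w => f w * ind i s w * ind i (s + h) w + g w * ind i s w * ind i (s + h) w).
  by apply/funext => w; ring.
have -> : (fun w => (f w + g w) * ind i s w) = (fun w => f w * ind i s w + g w * ind i s w).
  by apply/funext => w; ring.
by rewrite !ExD ?ef ?eg ?mulrDr//; do ?apply: bmfM.
Qed.

Lemma markovZ s h i k f : 0 <= s -> 0 <= h ->
  markov_at s h i f -> markov_at s h i (fun w => k * f w).
Proof.
move=> s0 h0 [bf ef]; split; first exact: bmfZ.
have bi := bmf_ind i s0; have bj := bmf_ind i (addr_ge0 s0 h0).
have -> : (fun w => k * f w * ind i s w * ind i (s + h) w) =
    (fun w => k * (f w * ind i s w * ind i (s + h) w)).
  by apply/funext => w; ring.
have -> : (fun w => k * f w * ind i s w) = (fun w => k * (f w * ind i s w)).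
  by apply/funext => w; ring.
rewrite !ExZ ?ef; [ring|by do ?apply: bmfM|by do ?apply: bmfM].
Qed.

Lemma markov_lim s h i (F : nat -> Omega -> R) f M : 0 <= s -> 0 <= h ->
  (forall n, markov_at s h i (F n)) -> (forall n w, `|F n w| <= M) ->
  (forall w, F n w @[n --> \oo] --> f w) -> markov_at s h i f.
Proof.
move=> s0 h0 mF hM hl.
have bi := bmf_ind i s0; have bj := bmf_ind i (addr_ge0 s0 h0).
have i1 j u w : `|ind j u w| <= 1.
  by rewrite ind_eq; case: (_ == _); rewrite ?normr0 ?normr1.
split; first by apply: (bmf_lim (F := F)) hM hl => n; have [] := mF n.
have c1 : E (fun w => F n w * ind i s w * ind i (s + h) w) @[n --> \oo] -->
    E (fun w => f w * ind i s w * ind i (s + h) w).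
  apply: (@Ex_dct _ _ _ P (fun n w => F n w * ind i s w * ind i (s + h) w) _ M).
  - by move=> n; have [bF _] := mF n; do ?apply: bmfM.
  - move=> n w; rewrite !normrM -mulrA; apply: le_trans (hM n w).
    by rewrite ler_piMr// mulr_ile1.
  - by move=> w; do 2 (apply: cvgM; last exact: cvg_cst); exact: hl.
have c2 : E (fun w => F n w * ind i s w) @[n --> \oo] --> E (fun w => f w * ind i s w).
  apply: (@Ex_dct _ _ _ P (fun n w => F n w * ind i s w) _ M).
  - by move=> n; have [bF _] := mF n; do ?apply: bmfM.
  - by move=> n w; rewrite normrM; apply: le_trans (hM n w); rewrite ler_piMr.
  - by move=> w; apply: cvgM; [exact: hl|exact: cvg_cst].
have c3 : p h i i * E (fun w => F n w * ind i s w) @[n --> \oo] --> p h i i * E (fun w => f w * ind i s w).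
  by apply: cvgM; [exact: cvg_cst|exact: c2].
rewrite (_ : (fun n => E _) = (fun n => p h i i * E (fun w => F n w * ind i s w))) in c1.
  exact: (cvg_unique _ c1 c3).
by apply/funext => n; have [_ ->] := mF n.
Qed.

(** The flow driven by the states at the grid points: a finite-valued functional
    of the past, which approximates X. *)
Fixpoint grid_flow (h : R) k (w : Omega) : R :=
  if k is m.+1 then fl (eps (m%:R * h) w) h (grid_flow h m w) else x.

(** Splitting according to the state at the last grid point moves that point into
    the event A. *)
Lemma markov_grid s h i u k : 0 <= s -> 0 <= h -> 0 <= u -> forall A F M,
  k%:R * u <= s -> past eps s A -> (forall y, `|F y| <= M) ->
  markov_at s h i (fun w => \1_A w * F (grid_flow u k w)).
Proof.
move=> s0 h0 u0; elim: k => [|k IH] A F M ks pA hF.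
  have -> : (fun w => \1_A w * F (grid_flow u 0 w)) = (fun w => F x * \1_A w).
    by apply/funext => w /=; rewrite mulrC.
  by apply: markovZ => //; exact: markov_past.
have ku : 0 <= k%:R * u <= s.
  by rewrite mulr_ge0//=; apply: le_trans ks; rewrite ler_wpM2r// ler_nat.
have -> : (fun w => \1_A w * F (grid_flow u k.+1 w)) = (fun w =>
   \1_(A `&` in_state eps (k%:R * u) 0) w * F (fl 0 u (grid_flow u k w)) +
   \1_(A `&` in_state eps (k%:R * u) 1) w * F (fl 1 u (grid_flow u k w))).
  apply/funext => w; rewrite !indI -/(ind 0 _ w) -/(ind 1 _ w) !ind_eq /=.
  by case: (I2E (eps (k%:R * u) w)) => ->; rewrite /= ?mulr1 ?mulr0 ?mul0r ?addr0 ?add0r.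
have ks' : k%:R * u <= s by case/andP: ku.
by apply: markovD => //; apply: (IH _ (fun y => F (fl _ u y)) M) => //;
  apply: pastI => //; exact: past_in_state.
Qed.

Lemma grid_flow_dist h k w : 0 <= h ->
  `|grid_flow h k w - X (k%:R * h) w| <=
  \sum_(m < k) flow_resid gam a (eps ^~ w) (fun t => X t w) h (m%:R * h).
Proof.
move=> h0; have X0 : X 0 w = x by have [_ []] := X_ou w.
elim: k => [|k IH]; first by rewrite big_ord0 mul0r /= X0 subrr normr0.
rewrite big_ord_recr/=.
set y := grid_flow h k w in IH *.
have kS : k%:R * h + h = k.+1%:R * h by rewrite -natr1 mulrDl mul1r.
rewrite /flow_resid kS.
have -> : fl (eps (k%:R * h) w) h y - X (k.+1%:R * h) w =
  (fl (eps (k%:R * h) w) h y - fl (eps (k%:R * h) w) h (X (k%:R * h) w)) -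
  (X (k.+1%:R * h) w - fl (eps (k%:R * h) w) h (X (k%:R * h) w)) by ring.
rewrite (le_trans (ler_normB _ _))// lerD//.
by apply: le_trans IH; exact: flow_contract.
Qed.

Lemma grid_flow_cvg s w : 0 <= s ->
  grid_flow (s / n.+1%:R) n.+1 w @[n --> \oo] --> X s w.
Proof.
move=> s0.
have [K K0 hK] := sum_resid gam_gt0 a_gam (eps_right w) (eps_left w) (X_ou w) x_ge s0.
apply/cvgrPdist_le => e e0; near=> n.
have n1 : 0 < n.+1%:R :> R by [].
have h0 : 0 <= s / n.+1%:R by rewrite divr_ge0.
have hs : n.+1%:R * (s / n.+1%:R) = s by rewrite mulrC divfK.
rewrite distrC -[in X _ w]hs; apply: le_trans (grid_flow_dist _ _ h0) _.
apply: le_trans (hK _ n.+1 h0 _) _; first by rewrite hs.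
rewrite mulrA ler_pdivrMr// -ler_pdivrMl//.
apply: (@le_trans _ _ n%:R); last by rewrite ler_nat.
near: n; exact: nbhs_infty_ger.
Unshelve. all: by end_near. Qed.

Lemma markov_X s h i A F : 0 <= s -> 0 <= h -> past eps s A -> bounded_lip F ->
  markov_at s h i (fun w => \1_A w * F (X s w)).
Proof.
move=> s0 h0 pA lF; have [L L0 [_ bF]] := lF.
apply: (@markov_lim s h i (fun n w => \1_A w * F (grid_flow (s / n.+1%:R) n.+1 w)) _ L) => //.
- move=> n; apply: (@markov_grid s h i _ _ s0 h0 _ A F L) => //.
    by rewrite divr_ge0.
  by rewrite mulrC divfK.
- move=> n w; rewrite indicE normrM; case: (_ \in _); rewrite ?normr1 ?normr0 ?mul1r ?mul0r//.
- move=> w; apply: cvgM; first exact: cvg_cst.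
  by apply: lipb_cvg => //; exact: grid_flow_cvg.
Qed.

Definition alive_ind s (w : Omega) : R := (l0 <= X s w)%R%:R.

Lemma markov_alive s h i A F : 0 <= s -> 0 <= h -> past eps s A -> bounded_lip F ->
  markov_at s h i (fun w => \1_A w * (alive_ind s w * F (X s w))).
Proof.
move=> s0 h0 pA lF; have [L L0 [_ bF]] := lF.
apply: (@markov_lim s h i (fun n w => \1_A w * (ramp l0 n (X s w) * F (X s w))) _ L) => //.
- by move=> n; apply: (@markov_X s h i A (fun y => ramp l0 n y * F y)) => //; apply: lipbM => //; exact: lipb_ramp.
- move=> n w; rewrite indicE normrM; case: (_ \in _); rewrite ?normr1 ?normr0 ?mul1r ?mul0r//.
  rewrite normrM; apply: le_trans (bF (X s w)); rewrite ler_piMl//.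
  have /andP[r0 r1] := clampr_in (1 + n%:R * (X s w - l0)) ler01.
  by rewrite /ramp ger0_norm.
- move=> w; apply: cvgM; first exact: cvg_cst.
  by apply: cvgM; [exact: ramp_cvg|exact: cvg_cst].
Qed.

Lemma bmf_X F s : bounded_lip F -> bounded_mfun (fun w => F (X s w)).
Proof.
move=> lF; have [L L0 [_ bF]] := lF; split; last by exists L.
apply: (@measurableT_comp _ _ _ _ _ _ F); last exact: X_meas.
by apply: continuous_measurable_fun; exact: lipb_continuous.
Qed.

Lemma bmf_alive s : bounded_mfun (alive_ind s).
Proof.
apply: (@bmf_lim _ _ _ (fun n w => ramp l0 n (X s w)) _ 1).
- by move=> n; apply: bmf_X; exact: lipb_ramp.
- move=> n w; have /andP[r0 r1] := clampr_in (1 + n%:R * (X s w - l0)) ler01.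
  by rewrite /ramp ger0_norm.
- by move=> w; exact: ramp_cvg.
Qed.

End Markov.

(** * Constant expectation up to the hitting time *)

Section OneStep.
Variable R : realType.

Lemma expRN_quad (u : R) : 0 <= u -> `|expR (- u) - (1 - u)| <= u * u.
Proof.
move=> u0; have h1 := expR_ge1Dx (- u); have h2 := expR_ge1Dx u.
have e0 := expR_gt0 (- u).
have h3 : expR (- u) * expR u = 1 by rewrite -expRD addNr expR0.
rewrite ger0_norm; last by lra.
have : expR (- u) * (1 + u) <= 1 by rewrite -[leRHS]h3; apply: ler_wpM2l => //; exact: ltW.
by move: (expR (- u)) e0 h1 {h3} => E; nra.
Qed.

(** First order expansion of one discounted step from a point y where
    fi = f_i(y), fo = f_j(y): A and B are the values after the flow in the same
    and in the other state, and 1 - lm h + rho is the probability to stay. *)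
Lemma one_step_alg (fi fo A B lm q h discount rho sg L C M Lam h0 : R) :
  0 <= L -> 0 <= M -> `|fi| <= L -> `|A| <= L -> `|B| <= L ->
  `|A - fi| <= L * (M * h) -> `|B - fo| <= L * (M * h) ->
  `|A - fi - h * ((lm + q) * fi - lm * fo - sg)| <= C * h * h ->
  0 <= lm <= Lam -> 0 <= q -> 0 <= h <= h0 -> 0 <= discount <= 1 ->
  `|discount - (1 - q * h)| <= q * h * (q * h) ->
  `|discount * (B + (1 - lm * h + rho) * (A - B)) - fi + sg * h| <=
   (C + 2 * Lam * L * M + q * L * M + 2 * q * Lam * L
      + q * q * L * (1 + 2 * Lam * h0)) * h * h + 2 * L * `|rho|.
Proof.
move=> L0 M0 hfi hA hB hAf hBf hr /andP[lm0 lmL] q0 /andP[hh hh0] /andP[e0 e1] hth.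
set th := discount - (1 - q * h) in hth.
have -> : discount * (B + (1 - lm * h + rho) * (A - B)) - fi + sg * h =
  (A - fi - h * ((lm + q) * fi - lm * fo - sg)) + (lm * h) * ((B - fo) - (A - fi))
  + (- (q * h)) * (A - fi) + (q * h * (lm * h)) * (A - B)
  + th * (A - lm * h * (A - B)) + discount * rho * (A - B) by rewrite /th; ring.
have dAB : `|A - B| <= 2 * L by rewrite (le_trans (ler_normB _ _))//; lra.
have lh : 0 <= lm * h by rewrite mulr_ge0.
have qh : 0 <= q * h by rewrite mulr_ge0.
have Mh : 0 <= L * (M * h) by rewrite !mulr_ge0.
have lhL : lm * h <= Lam * h by rewrite ler_wpM2r.
have Lam0 : 0 <= Lam by apply: le_trans lmL.
have b2 : `|(lm * h) * ((B - fo) - (A - fi))| <= Lam * h * (2 * (L * (M * h))).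
  rewrite normrM (ger0_norm lh) ler_pM// (le_trans (ler_normB _ _))//; lra.
have b3 : `|(- (q * h)) * (A - fi)| <= q * h * (L * (M * h)).
  by rewrite normrM normrN (ger0_norm qh) ler_wpM2l.
have b4 : `|(q * h * (lm * h)) * (A - B)| <= q * h * (Lam * h) * (2 * L).
  by rewrite normrM ger0_norm ?mulr_ge0// ler_pM ?mulr_ge0// ler_wpM2l.
have b5 : `|th * (A - lm * h * (A - B))| <= q * h * (q * h) * (L * (1 + 2 * Lam * h0)).
  rewrite normrM ler_pM// (le_trans (ler_normB _ _))//.
  rewrite [leRHS]mulrDr mulr1 lerD// normrM (ger0_norm lh).
  have -> : L * (2 * Lam * h0) = (Lam * h0) * (2 * L) by ring.
  by rewrite ler_pM// (le_trans lhL)// ler_wpM2l.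
have b6 : `|discount * rho * (A - B)| <= `|rho| * (2 * L).
  rewrite !normrM (ger0_norm e0) ler_pM ?mulr_ge0//.
  by rewrite ler_piMl.
have -> : (C + 2 * Lam * L * M + q * L * M + 2 * q * Lam * L
      + q * q * L * (1 + 2 * Lam * h0)) * h * h + 2 * L * `|rho| =
  C * h * h + Lam * h * (2 * (L * (M * h))) + q * h * (L * (M * h)) +
  q * h * (Lam * h) * (2 * L) + q * h * (q * h) * (L * (1 + 2 * Lam * h0)) + `|rho| * (2 * L).
  by ring.
by do 5 (apply: le_trans (ler_normD _ _) _; apply: lerD => //).
Qed.

End OneStep.

Section Dynkin.
Context {R : realType} {d : measure_display} {Omega : measurableType d}.
Variable P : probability Omega R.
Variables (lam gam a : 'I_2 -> R) (eps : R -> Omega -> 'I_2) (p : R -> 'I_2 -> 'I_2 -> R).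
Hypothesis lam_gt0 : forall i, 0 < lam i.
Hypothesis gam_gt0 : forall i, 0 < gam i.
Hypothesis a_gam : a 1 / gam 1 < a 0 / gam 0.
Hypothesis eps_meas : forall t i, 0 <= t -> measurable (in_state eps t i).
Hypothesis eps_right : forall w t, 0 <= t -> \forall s \near t^'+, eps s w = eps t w.
Hypothesis eps_left : forall w t, 0 < t -> exists i, \forall s \near t^'-, eps s w = i.
Hypothesis p_trans : forall s h i j A, 0 <= s -> 0 <= h -> past eps s A ->
  (0 < P (A `&` in_state eps s i))%E ->
  cond_prob P (A `&` in_state eps s i) (in_state eps (s + h) j) = p h i j.
Hypothesis p_small : forall i, (p h i i - (1 - lam i * h)) / h @[h --> 0^'+] --> 0.
Variables (x : R) (X : R -> Omega -> R).
Hypothesis X_meas : forall t, measurable_fun setT (X t).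
Hypothesis X_ou : forall w, ou_path a gam x (eps ^~ w) (fun t => X t w).
Hypothesis x_ge : level gam a 0 <= x.
Variables (q sg L C h0 : R) (f : 'I_2 -> R -> R) (i0 : 'I_2).
Hypothesis q_ge0 : 0 <= q.
Hypothesis sgq : sg = 0 \/ q = 0.
Hypothesis tf : test_fun lam gam a x q sg f L C h0.
Implicit Types (s t h y : R) (i j : 'I_2).

Notation fl := (flow gam a).
Notation l0 := (level gam a 0).
Notation l1 := (level gam a 1).
Notation E := (Ex P).
Notation ind := (@ind R d Omega eps).
Notation alive := (@alive_ind R d Omega gam a X).
Notation res h s w := (flow_resid gam a (eps ^~ w) (fun t => X t w) h s).

Let S := in_state eps 0 i0.

Let L0 : 0 <= L. Proof. by case: tf. Qed.
Let C0 : 0 <= C. Proof. by case: tf. Qed.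
Let h00 : 0 < h0. Proof. by case: tf. Qed.
Let flip i y y' : `|f i y - f i y'| <= L * `|y - y'|. Proof. by case: tf. Qed.
Let fbd i y : `|f i y| <= L. Proof. by case: tf => _ _ _ _ []. Qed.
Let fstep i y h : l0 <= y <= x -> 0 <= h <= h0 ->
    `|f i (fl i h y) - f i y
        - h * ((lam i + q) * f i y - lam i * f (other_state i) y - sg)| <= C * h * h.
Proof. by case: tf => _ _ _ _ [_]; apply. Qed.

Let flipb i : bounded_lip (f i).
Proof.
exists L; first exact: L0.
by split; [move=> y y'; exact: flip|move=> y; exact: fbd].
Qed.

Let Xin w t : 0 <= t -> l1 <= X t w <= x.
Proof. exact: (X_in gam_gt0 a_gam (eps_right w) (eps_left w) (X_ou w) x_ge). Qed.

Let X0 w : X 0 w = x. Proof. by case: (X_ou w) => _ []. Qed.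

Let M := speed_bound gam a x / 2.
Let M0 : 0 <= M.
Proof. by rewrite /M divr_ge0// (bnd_ge0 gam_gt0 a_gam x_ge). Qed.
Let Lam := lam 0 + lam 1.
Let C1 := C + 2 * Lam * L * M + q * L * M + 2 * q * Lam * L
      + q * q * L * (1 + 2 * Lam * h0).
Definition trans_error h : R := `|p h 0 0 - (1 - lam 0 * h)| + `|p h 1 1 - (1 - lam 1 * h)|.
Definition discount h : R := expR (- (q * h)).
Definition step_error h : R := C1 * h * h + 2 * L * trans_error h.

Let ex_itv h : 0 <= h -> 0 <= discount h <= 1.
Proof.
by move=> hh; rewrite /discount expR_ge0/= -expR0 ler_expR oppr_le0 mulr_ge0.
Qed.

Lemma C1_ge0 : 0 <= C1.
Proof.
have l0' : 0 <= Lam by rewrite addr_ge0// ltW.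
have h0' := ltW h00.
have c1 : 0 <= 2 * Lam * L * M by do 3 (apply: mulr_ge0 => //).
have c2 : 0 <= q * L * M by do 2 (apply: mulr_ge0 => //).
have c3 : 0 <= 2 * q * Lam * L by do 3 (apply: mulr_ge0 => //).
have c4 : 0 <= 1 + 2 * Lam * h0.
  by apply: addr_ge0 => //; do 2 (apply: mulr_ge0 => //).
have c5 : 0 <= q * q * L * (1 + 2 * Lam * h0) by do 3 (apply: mulr_ge0 => //).
by do 4 (apply: addr_ge0 => //).
Qed.

Lemma eta_ge0 h : 0 <= h -> 0 <= step_error h.
Proof.
move=> hh; have c := C1_ge0.
rewrite /step_error; apply: addr_ge0; first by do 2 apply: mulr_ge0 => //.
by apply: mulr_ge0; [apply: mulr_ge0|apply: addr_ge0].
Qed.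

Lemma one_step i y h : l0 <= y <= x -> 0 <= h <= h0 ->
  `|discount h * (f (other_state i) (fl i h y) + p h i i * (f i (fl i h y) - f (other_state i) (fl i h y)))
     - f i y + sg * h| <= step_error h.
Proof.
move=> hy hh; have /andP[hh1 hh2] := hh.
have a0 : l1 < l0 := a_gam.
have hy' : l1 <= y <= x by case/andP: hy => y1 ->; rewrite andbT; lra.
have dfl : `|fl i h y - y| <= M * h := flow_dist_bnd gam_gt0 a_gam x_ge i hh1 hy'.
have lipd j : `|f j (fl i h y) - f j y| <= L * (M * h).
  by apply: le_trans (flip _ _ _) _; rewrite ler_wpM2l.
pose rho := p h i i - (1 - lam i * h).
have -> : p h i i = 1 - lam i * h + rho by rewrite /rho; ring.
have hrho : 2 * L * `|rho| <= 2 * L * trans_error h.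
  rewrite ler_wpM2l ?mulr_ge0// /trans_error /rho.
  by case: (I2E i) => ->; rewrite ?lerDl ?lerDr.
apply: le_trans (_ : _ <= C1 * h * h + 2 * L * `|rho|) _; last by rewrite lerD2l.
apply: (@one_step_alg R (f i y) (f (other_state i) y)) => //.
- exact: fstep.
- rewrite ltW//=; have [/ltW u /ltW v] := (lam_gt0 0, lam_gt0 1).
  by rewrite /Lam; case: (I2E i) => ->; rewrite ?lerDl ?lerDr.
- exact: ex_itv.
- by apply: expRN_quad; rewrite mulr_ge0.
Qed.

Let flc i h y y' : 0 <= h -> `|fl i h y - fl i h y'| <= `|y - y'|.
Proof. exact: flow_contract. Qed.

Let lipb_cst k : bounded_lip (fun _ : R => k).
Proof.
exists `|k|; first exact: normr_ge0.
by split=> // y y'; rewrite subrr normr0 mulr_ge0.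
Qed.

Let SP s : 0 <= s -> past eps s S.
Proof. by move=> s0; apply: past_in_state; rewrite lexx. Qed.

Let mS : measurable S. Proof. exact: eps_meas. Qed.

Let bind i s : 0 <= s -> bounded_mfun (ind i s). Proof. exact: bmf_ind. Qed.
Let balive s : bounded_mfun (alive s). Proof. exact: bmf_alive. Qed.
Let bfX F s : bounded_lip F -> bounded_mfun (fun w => F (X s w)). Proof. exact: bmf_X. Qed.

(** The gain of one step if the position followed the flow of the state at its
    beginning. *)
Definition jump_term s h (w : Omega) : R :=
  \1_S w * (alive s w * (discount h * f (eps (s + h) w) (fl (eps s w) h (X s w))
     - f (eps s w) (X s w) + sg * h)).

Let gg i h y := f i (fl i h y) - f (other_state i) (fl i h y).
Let kk i h y := discount h * f (other_state i) (fl i h y) - f i y + sg * h.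
Let lg i h : 0 <= h -> bounded_lip (gg i h).
Proof.
move=> hh; have cf j : bounded_lip (fun y => f j (fl i h y)).
  by apply: (@lipb_comp R (f j) (fl i h)); [exact: flipb|move=> y y'; exact: flc].
exact: (@lipbB R (fun y => f i (fl i h y)) (fun y => f (other_state i) (fl i h y))).
Qed.
Let lk i h : 0 <= h -> bounded_lip (kk i h).
Proof.
move=> hh; have cf j : bounded_lip (fun y => f j (fl i h y)).
  by apply: (@lipb_comp R (f j) (fl i h)); [exact: flipb|move=> y y'; exact: flc].
rewrite (_ : kk i h = (fun y => (discount h * f (other_state i) (fl i h y) - f i y) - - (sg * h))).
  apply: (@lipbB R (fun y => discount h * f (other_state i) (fl i h y) - f i y) (fun _ => - (sg * h))) => //.
  apply: (@lipbB R (fun y => discount h * f (other_state i) (fl i h y)) (f i)); last exact: flipb.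
  by apply: (@lipbM R (fun _ => discount h) (fun y => f (other_state i) (fl i h y))).
by apply/funext => y; rewrite opprK.
Qed.

(** The jump term on the event that the state at time s is i, written so that
    the state at time s + h enters through one indicator only; this is the form
    to which the transition law applies. *)
Let part i s h (w : Omega) : R :=
  discount h * (\1_S w * (alive s w * gg i h (X s w)) * ind i s w * ind i (s + h) w)
   + \1_S w * (alive s w * kk i h (X s w)) * ind i s w.

Lemma jump_termE s h w : jump_term s h w = part 0 s h w + part 1 s h w.
Proof.
rewrite /jump_term /part /gg /kk !ind_eq.
by case: (I2E (eps s w)) => ->; case: (I2E (eps (s + h) w)) => ->; rewrite /other_state /=; ring.
Qed.

Let bmfS : bounded_mfun (\1_S : Omega -> R). Proof. exact: bmf_indic. Qed.

Let bmf_part i s h : 0 <= s -> 0 <= h -> bounded_mfun (part i s h).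
Proof.
move=> s0 hh; have bg := bfX s (lg i hh); have bk := bfX s (lk i hh).
have b1 := bind i s0; have b2 := bind i (addr_ge0 s0 hh); have ba := balive s.
apply: bmfD; last by do ?apply: bmfM.
by apply: bmfZ; do ?apply: bmfM.
Qed.

Lemma bmf_jump s h : 0 <= s -> 0 <= h -> bounded_mfun (jump_term s h).
Proof.
move=> s0 hh; rewrite (_ : jump_term s h = fun w => part 0 s h w + part 1 s h w).
  by apply: bmfD; exact: bmf_part.
by apply/funext => w; exact: jump_termE.
Qed.

Lemma Ex_part i s h : 0 <= s -> 0 <= h <= h0 -> `|E (part i s h)| <= step_error h.
Proof.
move=> s0 /andP[hh hh0].
have bg := bfX s (lg i hh); have bk := bfX s (lk i hh).
have b1 := bind i s0; have b2 := bind i (addr_ge0 s0 hh); have ba := balive s.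
have [_ mk] := markov_alive gam_gt0 a_gam eps_meas eps_right eps_left p_trans X_ou x_ge i s0 hh (SP s0) (lg i hh).
rewrite /part ExD; [|by apply: bmfZ; do ?apply: bmfM|by do ?apply: bmfM].
rewrite ExZ; last by do ?apply: bmfM.
rewrite mk -ExZ; last by do ?apply: bmfM.
rewrite -ExZ; last by apply: bmfZ; do ?apply: bmfM.
rewrite -ExD; [|by do 2 apply: bmfZ; do ?apply: bmfM|by do ?apply: bmfM].
apply: Ex_bound.
  by apply: bmfD; [do 2 apply: bmfZ; do ?apply: bmfM|do ?apply: bmfM].
move=> w; have e0 := eta_ge0 hh.
rewrite ind_eq /alive_ind indicE.
have [al|_] := leP l0 (X s w); last by rewrite !mul0r !mulr0 !mul0r !mulr0 addr0 normr0.
case: (w \in S); last by rewrite !mul0r !mulr0 addr0 normr0.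
case: (eps s w == i); last by rewrite !mulr0 addr0 normr0.
rewrite !mul1r !mulr1.
have hx : l0 <= X s w <= x by rewrite al; case/andP: (Xin w s0).
apply: le_trans (one_step i hx _); last by rewrite hh.
by rewrite le_eqVlt; apply/orP; left; apply/eqP; congr (`|_|); rewrite /gg /kk; ring.
Qed.

Lemma Ex_jump s h : 0 <= s -> 0 <= h <= h0 -> `|E (jump_term s h)| <= 2 * step_error h.
Proof.
move=> s0 hh; have /andP[hh1 _] := hh.
rewrite (_ : jump_term s h = fun w => part 0 s h w + part 1 s h w); last first.
  by apply/funext => w; exact: jump_termE.
rewrite ExD; [|exact: bmf_part|exact: bmf_part].
rewrite (le_trans (ler_normD _ _))// mulr_natl mulr2n.
by rewrite lerD// Ex_part.
Qed.

Definition discounted_test t (w : Omega) : R := discount t * f (eps t w) (X t w).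

Definition compensated_inc s h (w : Omega) : R :=
  \1_S w * (alive s w * (discounted_test (s + h) w - discounted_test s w + sg * h)).

Lemma bmf_resid s h : 0 <= s -> 0 <= h -> bounded_mfun (fun w => res h s w).
Proof.
move=> s0 hh.
have bX t : 0 <= t -> bounded_mfun (X t).
  move=> t0; split; first exact: X_meas.
  exists (`|l1| + `|x|) => w; have /andP[x1 x2] := Xin w t0.
  have := ler_norm x; have := ler_norm (- l1); rewrite normrN.
  have := normr_ge0 x; have := normr_ge0 l1.
  by rewrite ler_norml => *; apply/andP; split; lra.
have b0 := bind 0 s0; have b1 := bind 1 s0.
have bXs := bX s s0; have bXh := bX (s + h) (addr_ge0 s0 hh).
have bfl i : bounded_mfun (fun w => fl i h (X s w)).
  apply: bmfD; first exact: bmf_cst.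
  by apply: bmfM; [apply: bmfB => //; exact: bmf_cst|exact: bmf_cst].
rewrite (_ : (fun w => _) = (fun w => `|X (s + h) w - (ind 0 s w * fl 0 h (X s w) + ind 1 s w * fl 1 h (X s w))|)).
  by apply: bmf_norm; apply: bmfB => //; apply: bmfD; apply: bmfM.
apply/funext => w; rewrite /flow_resid !ind_eq.
by case: (I2E (eps s w)) => ->; rewrite /= ?mul1r ?mul0r ?addr0 ?add0r.
Qed.

Lemma bmf_Zt t : 0 <= t -> bounded_mfun (discounted_test t).
Proof.
move=> t0; have b0 := bind 0 t0; have b1 := bind 1 t0.
have c0 := bfX t (flipb 0); have c1 := bfX t (flipb 1).
rewrite (_ : discounted_test t = fun w => discount t * (ind 0 t w * f 0 (X t w) + ind 1 t w * f 1 (X t w))).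
  by apply: bmfZ; apply: bmfD; apply: bmfM.
apply/funext => w; rewrite /discounted_test !ind_eq.
by case: (I2E (eps t w)) => ->; rewrite /= ?mul1r ?mul0r ?addr0 ?add0r.
Qed.

Lemma bmf_inc s h : 0 <= s -> 0 <= h -> bounded_mfun (compensated_inc s h).
Proof.
move=> s0 hh; have ba := balive s.
have z1 := bmf_Zt s0; have z2 := bmf_Zt (addr_ge0 s0 hh).
by apply: bmfM => //; apply: bmfM => //; apply: bmfD; [exact: bmfB|exact: bmf_cst].
Qed.

Lemma discountD s h : discount (s + h) = discount s * discount h.
Proof. by rewrite /discount -expRD; congr expR; ring. Qed.

(** The source is not discounted, which agrees with the discounted step because
    sg = 0 or q = 0. *)
Lemma inc_jump s h w : 0 <= s -> 0 <= h ->
  `|compensated_inc s h w - discount s * jump_term s h w| <= L * res h s w.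
Proof.
move=> s0 hh.
have /andP[es0 es1] := ex_itv s0; have /andP[eh0 eh1] := ex_itv hh.
have esg : discount s * sg = sg.
  by case: sgq => [->|q0]; rewrite ?mulr0// /discount q0 mul0r oppr0 expR0 mul1r.
have -> : compensated_inc s h w - discount s * jump_term s h w = \1_S w * (alive s w * (discount s * discount h *
   (f (eps (s + h) w) (X (s + h) w) - f (eps (s + h) w) (fl (eps s w) h (X s w))))).
  rewrite /compensated_inc /jump_term /discounted_test discountD.
  rewrite -[X in _ - X]mulrCA -mulrBr; congr (_ * _).
  rewrite -[X in _ - X]mulrCA -mulrBr; congr (_ * _).
  by rewrite -{1}esg; ring.
have hd : `|f (eps (s + h) w) (X (s + h) w) - f (eps (s + h) w) (fl (eps s w) h (X s w))|
    <= L * res h s w by exact: flip.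
rewrite !normrM indicE /alive_ind !normr_nat.
have n0 := normr_ge0 (f (eps (s + h) w) (X (s + h) w) - f (eps (s + h) w) (fl (eps s w) h (X s w))).
apply: le_trans hd.
case: (w \in S); last by rewrite mul0r.
case: (l0 <= X s w); last by rewrite mul0r mulr0.
rewrite !mul1r (ger0_norm es0) (ger0_norm eh0) ler_piMl//.
exact: mulr_ile1.
Qed.

Lemma Ex_inc s h : 0 <= s -> 0 <= h <= h0 ->
  `|E (compensated_inc s h)| <= 2 * step_error h + L * E (fun w => res h s w).
Proof.
move=> s0 hh; have /andP[hh1 _] := hh.
have bi := bmf_inc s0 hh1; have bj := bmf_jump s0 hh1; have br := bmf_resid s0 hh1.
have -> : E (compensated_inc s h) = E (fun w => compensated_inc s h w - discount s * jump_term s h w) + discount s * E (jump_term s h).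
  rewrite -ExZ// -ExD; [|by apply: bmfB => //; exact: bmfZ|exact: bmfZ].
  by congr Ex; apply/funext => w; ring.
rewrite (le_trans (ler_normD _ _))// addrC lerD//.
  rewrite normrM; have /andP[e0 e1] := ex_itv s0.
  apply: le_trans (Ex_jump s0 hh); rewrite (ger0_norm e0) ler_piMl//.
rewrite -ExZ//; apply: Ex_norm_le; [by apply: bmfB => //; exact: bmfZ|exact: bmfZ|].
by move=> w; exact: inc_jump.
Qed.

Variable t : R.
Hypothesis t_gt0 : 0 < t.

Notation tau w := (hit_at gam a (fun s => X s w) t).
Notation gh w n := (grid_hit gam a (fun s => X s w) t n).
Let hh n : R := t / n.+1%:R.

Let t0 : 0 <= t. Proof. exact: ltW. Qed.
Let hh_gt0 n : 0 < hh n. Proof. by rewrite divr_gt0. Qed.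
Let hh_ge0 n : 0 <= hh n. Proof. exact: ltW. Qed.
Let hhn n : n.+1%:R * hh n = t. Proof. by rewrite mulrC divfK. Qed.
Let khh k n : 0 <= k%:R * hh n. Proof. by rewrite mulr_ge0. Qed.

Let hh_cvg0 : hh n @[n --> \oo] --> (0 : R).
Proof.
apply/cvgrPdist_le => e e0; near=> n.
rewrite sub0r normrN ger0_norm// ler_pdivrMr// -ler_pdivrMl//.
apply: (@le_trans _ _ n%:R); last by rewrite ler_nat.
near: n; exact: nbhs_infty_ger.
Unshelve. all: by end_near. Qed.

Lemma prho_cvg : n.+1%:R * trans_error (hh n) @[n --> \oo] --> (0 : R).
Proof.
have pc i : `|(p (hh n) i i - (1 - lam i * hh n)) / hh n| @[n --> \oo] --> (0 : R).
  rewrite -[X in _ --> X](@normr0 R R); apply: cvg_norm.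
  by move/cvg_at_rightP: (p_small i); apply.
have : t * (`|(p (hh n) 0 0 - (1 - lam 0 * hh n)) / hh n| +
    `|(p (hh n) 1 1 - (1 - lam 1 * hh n)) / hh n|) @[n --> \oo] --> t * (0 + 0).
  by apply: cvgM; [exact: cvg_cst|apply: cvgD; exact: pc].
rewrite addr0 mulr0; apply: cvg_trans; apply: near_eq_cvg.
near=> n; rewrite /= /trans_error !normrM !(ger0_norm (x := (hh n)^-1)) ?invr_ge0//.
rewrite -mulrDl -[in t * _](hhn n) -mulrA; congr (_ * _).
by rewrite mulrC divfK// gt_eqF.
Unshelve. all: by end_near. Qed.

Lemma eta_cvg : n.+1%:R * step_error (hh n) @[n --> \oo] --> (0 : R).
Proof.
have -> : (fun n => n.+1%:R * step_error (hh n)) = (fun n => C1 * t * hh n + 2 * L * (n.+1%:R * trans_error (hh n))).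
  by apply/funext => n; rewrite /step_error -[in RHS](hhn n); ring.
rewrite -[X in _ --> X](addr0 0) -[X in _ --> X + _](mulr0 (C1 * t)) -[X in _ --> _ + X](mulr0 (2 * L)).
by apply: cvgD; apply: cvgM; [exact: cvg_cst|exact: hh_cvg0|exact: cvg_cst|exact: prho_cvg].
Qed.

Let sres n w := \sum_(k < n.+1) res (hh n) (k%:R * hh n) w.

Let resid_ge0 s h w : 0 <= res h s w. Proof. exact: normr_ge0. Qed.

Let bmf_sres n : bounded_mfun (sres n).
Proof. by apply: (bmf_sum n.+1 (F := fun k w => res (hh n) (k%:R * hh n) w)) => k; exact: bmf_resid. Qed.

Lemma sres_cvg : E (sres n) @[n --> \oo] --> (0 : R).
Proof.
have B0 := bnd_ge0 gam_gt0 a_gam x_ge.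
have -> : (0 : R) = E (fun=> 0) by rewrite Ex_cst.
apply: (Ex_dct (M := speed_bound gam a x * t)) => [n|n w|w]; first exact: bmf_sres.
  rewrite ger0_norm; last by apply: sumr_ge0 => k _; exact: resid_ge0.
  apply: le_trans (_ : _ <= \sum_(k < n.+1) speed_bound gam a x * hh n) _.
    apply: ler_sum => k _.
    exact: (resid_le gam_gt0 a_gam (eps_right w) (eps_left w) (X_ou w) x_ge).
  rewrite sumr_const card_ord -mulr_natl -[in leRHS](hhn n) le_eqVlt.
  by apply/orP; left; apply/eqP; ring.
have [K K0 hK] := sum_resid gam_gt0 a_gam (eps_right w) (eps_left w) (X_ou w) x_ge t0.
apply: (@squeeze_cvgr _ _ _ _ (fun=> 0) (fun n => K * hh n)).
- near=> n; rewrite sumr_ge0/=; last by move=> k _; exact: resid_ge0.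
  by apply: hK => //; rewrite hhn.
- exact: cvg_cst.
- by rewrite -(mulr0 K); apply: cvgM; [exact: cvg_cst|exact: hh_cvg0].
Unshelve. all: by end_near. Qed.

Let Sn n w := \sum_(k < n.+1) compensated_inc (k%:R * hh n) (hh n) w.

Lemma Sn_cvg : E (Sn n) @[n --> \oo] --> (0 : R).
Proof.
have speed_bound : \forall n \near \oo, - (2 * (n.+1%:R * step_error (hh n)) + L * E (sres n)) <= E (Sn n) <=
    2 * (n.+1%:R * step_error (hh n)) + L * E (sres n).
  have : \forall n \near \oo, hh n <= h0.
    have /cvgrPdist_le/(_ _ h00) := hh_cvg0; apply: filterS => n.
    by rewrite sub0r normrN ger0_norm.
  apply: filterS => n hn; rewrite -ler_norml /Sn.
  rewrite (Ex_sum P n.+1 (F := fun k w => compensated_inc (k%:R * hh n) (hh n) w)); last first.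
    by move=> k; exact: bmf_inc.
  apply: le_trans (ler_norm_sum _ _ _) _.
  apply: le_trans (_ : _ <= \sum_(k < n.+1) (2 * step_error (hh n) + L * E (fun w => res (hh n) (k%:R * hh n) w))) _.
    by apply: ler_sum => k _; apply: Ex_inc => //; rewrite hh_ge0.
  rewrite big_split/= sumr_const card_ord -mulr_sumr.
  rewrite -(Ex_sum P n.+1 (F := fun k w => res (hh n) (k%:R * hh n) w)); last first.
    by move=> k; exact: bmf_resid.
  rewrite -/(sres n) -[2 * step_error _ *+ _]mulr_natl.
  by rewrite [n.+1%:R * (2 * _)]mulrCA.
have lim0 : 2 * (n.+1%:R * step_error (hh n)) + L * E (sres n) @[n --> \oo] --> (0 : R).
  rewrite -[X in _ --> X](addr0 0) -[X in _ --> X + _](mulr0 2) -[X in _ --> _ + X](mulr0 L).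
  by apply: cvgD; apply: cvgM; [exact: cvg_cst|exact: eta_cvg|exact: cvg_cst|exact: sres_cvg].
apply: (squeeze_cvgr speed_bound) => //.
by rewrite -[X in _ --> X]oppr0; exact: cvgN.
Unshelve. all: by end_near. Qed.

Lemma SnE n w : Sn n w = \1_S w * (discounted_test (gh w n) w - discounted_test 0 w + sg * gh w n).
Proof.
rewrite /Sn /compensated_inc -mulr_sumr; congr (_ * _).
have -> : \sum_(k < n.+1) alive (k%:R * hh n) w * (discounted_test (k%:R * hh n + hh n) w - discounted_test (k%:R * hh n) w + sg * hh n) =
  \sum_(k < n.+1) (l0 <= X (k%:R * hh n) w)%R%:R * (discounted_test (k.+1%:R * hh n) w - discounted_test (k%:R * hh n) w)
  + sg * ((\sum_(k < n.+1) (l0 <= X (k%:R * hh n) w)%R%:R) * hh n).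
  rewrite mulr_suml mulr_sumr -big_split/=; apply: eq_bigr => k _.
  rewrite /alive_ind -natr1 mulrDl mul1r; ring.
rewrite (sum_alive_telescope gam_gt0 a_gam (eps_right w) (eps_left w) (X_ou w) (fun k => discounted_test (k%:R * hh n) w) n.+1 (hh_ge0 n)).
by rewrite -(cntE gam a (fun s => X s w)) mul0r.
Qed.

Let gh_ge0 n w : 0 <= gh w n.
Proof. by apply: mulr_ge0; [exact: ler0n|exact: hh_ge0]. Qed.

Let gh_le n w : gh w n <= t.
Proof. apply: le_trans (_ : _ <= n.+1%:R * hh n) _; last by rewrite hhn.
by apply: ler_wpM2r; [exact: hh_ge0|rewrite ler_nat; exact: cnt_le]. Qed.

(** The limit, on finer and finer grids, of the discounted test function plus
    the source, both taken at [grid_hit]. *)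
Definition stopped_gain w : R := sg * tau w +
  (if X t w < l0 then discount (tau w) * f 1 l0 else discount t * f (eps t w) (X t w)).

Let gh_cvg w : gh w n @[n --> \oo] --> tau w.
Proof. exact: (cnt_hit_cvg gam_gt0 a_gam (eps_right w) (eps_left w) (X_ou w) x_ge t0). Qed.

Lemma Z_gh_cvg w : discounted_test (gh w n) w @[n --> \oo] -->
  if X t w < l0 then discount (tau w) * f 1 l0 else discount t * f (eps t w) (X t w).
Proof.
case: ltP => Xt.
  apply: cvgM; last exact: (cross_cvg gam_gt0 a_gam (eps_right w) (eps_left w) (X_ou w) x_ge t0 Xt (flipb 1)).
  apply: (@cvg_comp _ _ _ (fun n => - (q * gh w n)) expR); last exact: continuous_expR.
  by apply: cvgN; apply: cvgM; [exact: cvg_cst|exact: gh_cvg].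
have e n : gh w n = t.
  rewrite /grid_hit (cnt_end_alive gam_gt0 a_gam (eps_right w) (eps_left w) (X_ou w) n t0 Xt).
  exact: hhn.
by apply: cvg_near_cst; apply: nearW => n; rewrite e.
Qed.

Lemma bmf_hit_at : bounded_mfun (fun w => tau w).
Proof.
apply: (bmf_lim (F := fun n w => gh w n) (M := t)) => [n|n w|w]; last exact: gh_cvg.
  rewrite (_ : (fun w => _) = fun w => hh n * \sum_(k < n.+1) alive (k%:R * hh n) w).
    by apply: bmfZ; apply: (bmf_sum n.+1 (F := fun k w => alive (k%:R * hh n) w)) => k; exact: balive.
  by apply/funext => w; rewrite /grid_hit cntE mulrC.
by rewrite ger0_norm; [exact: gh_le|exact: gh_ge0].
Qed.

(** By telescoping, the sum of the increments over a grid is the gain up to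
    [grid_hit], whose limit is [stopped_gain]; its expectation is at most the
    sum of the one-step errors and of the switching errors, and both sums vanish
    in the limit. *)
Lemma dynkin : E (fun w => \1_S w * stopped_gain w) = f i0 x * fine (P S) /\
  bounded_mfun (fun w => \1_S w * stopped_gain w).
Proof.
pose Y w : R := \1_S w * (stopped_gain w - f i0 x).
have limY w : Sn n w @[n --> \oo] --> Y w.
  rewrite (_ : (fun n => Sn n w) = fun n => \1_S w * (discounted_test (gh w n) w - f i0 x + sg * gh w n)); last first.
    apply/funext => n; rewrite SnE indicE; case: (boolP (w \in S)) => [|_]; last by rewrite !mul0r.
    by rewrite inE /S /in_state/= => we; rewrite {2}/discounted_test X0 we /discount mulr0 oppr0 expR0 mul1r.
  apply: cvgM; first exact: cvg_cst.
  rewrite /stopped_gain -addrA addrC; apply: cvgD; last by apply: cvgM; [exact: cvg_cst|exact: gh_cvg].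
  by apply: cvgB; [exact: Z_gh_cvg|exact: cvg_cst].
have bSn n : bounded_mfun (Sn n).
  by apply: (bmf_sum n.+1 (F := fun k w => compensated_inc (k%:R * hh n) (hh n) w)) => k; exact: bmf_inc.
have bd n w : `|Sn n w| <= L + L + `|sg| * t.
  rewrite SnE normrM indicE normr_nat.
  apply: le_trans (_ : _ <= `|discounted_test (gh w n) w - discounted_test 0 w + sg * gh w n|) _.
    by rewrite ler_piMl//; case: (_ \in _).
  have Zb s : 0 <= s -> `|discounted_test s w| <= L.
    move=> s0; rewrite normrM; have /andP[e0 e1] := ex_itv s0.
    rewrite (ger0_norm e0); apply: le_trans (fbd (eps s w) (X s w)).
    by rewrite ler_piMl.
  apply: le_trans (ler_normD _ _) _; apply: lerD.
    by apply: le_trans (ler_normB _ _) _; apply: lerD; exact: Zb.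
  by rewrite normrM (ger0_norm (gh_ge0 n w)) ler_wpM2l.
have bY : bounded_mfun Y := bmf_lim bSn bd limY.
have EY : E Y = 0.
  by apply: (cvg_unique _ (Ex_dct bSn bd limY) Sn_cvg).
have e : (fun w => \1_S w * stopped_gain w) = (fun w => Y w + f i0 x * \1_S w).
  by apply/funext => w; rewrite /Y; ring.
have bS' := bmfZ (f i0 x) bmfS.
split; last by rewrite e; exact: bmfD.
by rewrite e ExD// ExZ// EY add0r Ex_indic.
Qed.

End Dynkin.

(** * Mean and Laplace transform of the hitting time *)

Section HittingLaw.
Context {R : realType} {d : measure_display} {Omega : measurableType d}.
Variable P : probability Omega R.
Variables (lam gam a : 'I_2 -> R) (eps : R -> Omega -> 'I_2) (p : R -> 'I_2 -> 'I_2 -> R).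
Hypothesis lam_gt0 : forall i, 0 < lam i.
Hypothesis gam_gt0 : forall i, 0 < gam i.
Hypothesis a_gam : a 1 / gam 1 < a 0 / gam 0.
Hypothesis eps_meas : forall t i, 0 <= t -> measurable (in_state eps t i).
Hypothesis eps_right : forall w t, 0 <= t -> \forall s \near t^'+, eps s w = eps t w.
Hypothesis eps_left : forall w t, 0 < t -> exists i, \forall s \near t^'-, eps s w = i.
Hypothesis p_trans : forall s h i j A, 0 <= s -> 0 <= h -> past eps s A ->
  (0 < P (A `&` in_state eps s i))%E ->
  cond_prob P (A `&` in_state eps s i) (in_state eps (s + h) j) = p h i j.
Hypothesis p_small : forall i, (p h i i - (1 - lam i * h)) / h @[h --> 0^'+] --> 0.
Variables (x : R) (X : R -> Omega -> R).
Hypothesis X_meas : forall t, measurable_fun setT (X t).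
Hypothesis X_ou : forall w, ou_path a gam x (eps ^~ w) (fun t => X t w).
Hypothesis x_ge : level gam a 0 <= x.
Implicit Types (q t : R) (i : 'I_2) (w : Omega).

Notation l0 := (level gam a 0).
Notation E := (Ex P).
Notation alive := (@alive_ind R d Omega gam a X).
Notation T := (fun w : Omega => hitting_time l0 (fun s => X s w)).
Notation tau := (fun t w => hit_at gam a (fun s => X s w) t).
Let S := in_state eps 0.

Let mS i : measurable (S i). Proof. exact: eps_meas. Qed.
Let bmfS i : bounded_mfun (\1_(S i) : Omega -> R). Proof. exact: bmf_indic. Qed.
Let balive t : bounded_mfun (alive t). Proof. exact: bmf_alive. Qed.
Let btau t : 0 < t -> bounded_mfun (tau t).
Proof. exact: (bmf_hit_at gam_gt0 a_gam eps_right eps_left X_meas X_ou x_ge). Qed.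
Let tau_itv t w : 0 <= t -> 0 <= tau t w <= t. Proof. exact: hit_at_itv. Qed.
Let tauE t w : 0 <= t -> (tau t w)%:E = Order.min (T w) t%:E.
Proof. exact: hit_atE. Qed.
Let tau_alive t w : 0 <= t -> l0 <= X t w -> tau t w = t.
Proof. exact: (hit_at_alive gam_gt0 a_gam (eps_right w) (eps_left w) (X_ou w)). Qed.
Let T_ge0 w : (0 <= T w)%E. Proof. exact: hit_ge0. Qed.

Let alive01 t w : alive t w = 0 \/ alive t w = 1.
Proof. by rewrite /alive_ind; case: (_ <= _); [right|left]. Qed.

Let ind01 i w : (\1_(S i) w = 0 :> R) \/ (\1_(S i) w = 1 :> R).
Proof. by rewrite indicE; case: (_ \in _); [right|left]. Qed.

Lemma integral_bmf i (f : Omega -> R) : bounded_mfun f ->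
  (\int[P]_(w in S i) (f w)%:E = (E (fun w => \1_(S i) w * f w))%:E)%E.
Proof.
move=> bf; rewrite /Ex fineK; last first.
  by apply: bmf_fin; apply: bmfM.
rewrite integral_mkcond; apply: eq_integral => w _.
by rewrite patchE indicE; case: (w \in S i); rewrite ?mul1r ?mul0r.
Qed.

Lemma tauS_cvg w : (tau n.+1%:R w)%:E @[n --> \oo] --> T w.
Proof.
have e n : (tau n.+1%:R w)%:E = Order.min (T w) n.+1%:R%:E by rewrite tauE.
under eq_fun do rewrite e.
have := T_ge0 w; case: (T w) => [r| |] // r0.
  apply: cvg_near_cst; near=> n; apply: min_l; rewrite lee_fin.
  apply: (@le_trans _ _ n%:R); last by rewrite ler_nat.
  near: n; exact: nbhs_infty_ger.
have -> : (fun n => Order.min +oo%E n.+1%:R%:E) = (fun n => (n.+1%:R : R)%:E).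
  by apply/funext => n; rewrite min_r// leey.
apply/cvgenyP; apply/cvgnyPge => A; near=> n; apply: leqW.
by near: n; exact: nbhs_infty_ge.
Unshelve. all: by end_near. Qed.

(** At time t the formula differs from the mean of min(T, t) by at most
    L P(X(t) >= l0).  In particular these means are bounded by some M, so that
    P(X(t) >= l0) <= M/t, and the difference tends to 0. *)
Lemma hit_mean i L C h0 (f : 'I_2 -> R -> R) :
  test_fun lam gam a x 0 1 f L C h0 -> f 1 l0 = 0 ->
  (\int[P]_(w in S i) T w = (f i x * fine (P (S i)))%:E)%E.
Proof.
move=> tf f1; have L0 : 0 <= L by case: tf.
have fbd j y : `|f j y| <= L by case: tf => _ _ _ _ [].
set K := f i x * fine (P (S i)).
have e0 u : discount 0 u = 1 :> R by rewrite /discount mul0r oppr0 expR0.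
pose I t := E (fun w => \1_(S i) w * tau t w).
pose A t := E (fun w => \1_(S i) w * alive t w).
have bI t : 0 < t -> bounded_mfun (fun w => \1_(S i) w * tau t w) by move=> t0; apply: bmfM => //; exact: btau.
have bA t : bounded_mfun (fun w => \1_(S i) w * alive t w) by exact: bmfM.
have dk t : 0 < t -> `|K - I t| <= L * A t.
  move=> t0; have [eG bG] := dynkin lam_gt0 gam_gt0 a_gam eps_meas eps_right eps_left p_trans p_small
    X_meas X_ou x_ge i (lexx 0) (or_intror erefl) tf t0.
  rewrite /K -eG /I -ExB//; last exact: bI.
  rewrite /A -ExZ//; apply: Ex_norm_le; [by apply: bmfB => //; exact: bI|exact: bmfZ|].
  move=> w; rewrite -/(S i) -mulrBr /stopped_gain mul1r !e0 !mul1r f1 /alive_ind [l0 <= _]leNgt.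
  case: (ind01 i w) => ->; first by rewrite !mul0r mulr0 normr0.
  rewrite !mul1r; case: ltP => _ /=; first by rewrite addr0 subrr normr0 mulr0.
  by rewrite addrAC subrr add0r mulr1.
have A1 t : A t <= 1.
  have := Ex_bound P (bA t) (M := 1); rewrite -/(A t) => h.
  apply: le_trans (ler_norm _) (h _) => w.
  by case: (ind01 i w) => ->; case: (alive01 t w) => ->; rewrite ?mulr0 ?mul0r ?mul1r ?normr0 ?normr1.
have A0 t : 0 <= A t.
  have -> : 0 = E (fun=> 0) by rewrite Ex_cst.
  apply: Ex_le => //; first exact: bmf_cst.
  move=> w; by case: (ind01 i w) => ->; case: (alive01 t w) => ->; rewrite ?mulr0 ?mul0r ?mul1r.
have tA t : 0 < t -> t * A t <= `|K| + L.
  move=> t0; apply: le_trans (_ : I t <= _).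
    rewrite -ExZ//; apply: Ex_le; [exact: bmfZ|exact: bI|move=> w].
    case: (ind01 i w) => ->; first by rewrite !mul0r mulr0.
    have /andP[u0 _] := tau_itv w (ltW t0).
    rewrite !mul1r /alive_ind; case: (leP l0 (X t w)) => Xt; last by rewrite mulr0.
    by rewrite mulr1 tau_alive// ltW.
  have := dk t t0; have := ler_norm (- (K - I t)); have := ler_norm K; rewrite normrN.
  have := ler_piMr L0 (A1 t); lra.
have I_cvg : I n.+1%:R @[n --> \oo] --> K.
  apply/cvgrPdist_le => e ee; near=> n.
  have n0 : 0 < n.+1%:R :> R by [].
  apply: le_trans (dk _ n0) _.
  rewrite -(ler_pM2l n0) mulrCA.
  apply: le_trans (_ : _ <= L * (`|K| + L)) _; first by rewrite ler_wpM2l// tA.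
  rewrite -ler_pdivrMr//; apply: (@le_trans _ _ n%:R); last by rewrite ler_nat.
  near: n; exact: nbhs_infty_ger.
have mono w : {homo (fun n => (tau n.+1%:R w)%:E) : n m / (n <= m)%N >-> (n <= m)%E}.
  move=> n m nm; rewrite !tauE// le_min !ge_min lexx/=.
  by rewrite lee_fin ler_nat ltnS nm orbT.
have := @cvg_monotone_convergence _ _ R P (S i) (mS i) (fun n w => (tau n.+1%:R w)%:E) _ _ _.
have -> : (fun w => limn (fun n => (tau n.+1%:R w)%:E)) = T.
  by apply/funext => w; apply/cvg_lim => //; exact: tauS_cvg.
move=> mc; apply: (cvg_unique _ (mc _ _ _)) => //.
- move=> n; apply/measurable_EFinP; apply: measurable_funTS.
  by have [] := btau (ltr0Sn R n).
- by move=> n w _; rewrite lee_fin; have /andP[] := tau_itv w (ler0n R n.+1).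
- have -> : (fun n => \int[P]_(w in S i) (tau n.+1%:R w)%:E)%E = (fun n => (I n.+1%:R)%:E).
    by apply/funext => n; rewrite integral_bmf//; exact: btau.
  by apply: cvg_EFin => //; exact: nearW.
Unshelve. all: by end_near. Qed.

Lemma discount_nat_cvg q : 0 < q -> discount q n.+1%:R @[n --> \oo] --> (0 : R).
Proof.
move=> q0; apply: (@squeeze_cvgr _ _ _ _ (fun=> 0) (fun n => q^-1 * harmonic n)).
- near=> n; rewrite /= expR_ge0/= /discount expRN -invfM lef_pV2 ?posrE ?expR_gt0 ?mulr_gt0//.
  by apply: le_trans (expR_ge1Dx _); rewrite lerDr.
- exact: cvg_cst.
- by rewrite -[X in _ --> X](mulr0 q^-1); apply: cvgM; [exact: cvg_cst|exact: cvg_harmonic].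
Unshelve. all: by end_near. Qed.

Lemma discount_hit_cvg q w : 0 < q -> (discount q (tau n.+1%:R w))%:E @[n --> \oo] --> expeR (- (q%:E * T w)).
Proof.
move=> q0; have := @tauS_cvg w; have e n : (tau n.+1%:R w)%:E = Order.min (T w) n.+1%:R%:E by rewrite tauE.
case TE : (T w) => [r| |].
- move=> h; apply: cvg_EFin; first exact: nearW.
  apply: (@cvg_comp _ _ _ (fun n => - (q * tau n.+1%:R w)) expR); last exact: continuous_expR.
  apply: cvgN; apply: cvgM; first exact: cvg_cst.
  by move/fine_cvgP: h => [].
- move=> _; rewrite gt0_muley ?lte_fin//=; apply: cvg_EFin; first exact: nearW.
  apply: cvg_trans (discount_nat_cvg q0); apply: near_eq_cvg; apply: nearW => n /=.
  congr discount; apply: (@EFin_inj R); by rewrite e TE min_r// leey.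
- by have := T_ge0 w; rewrite TE.
Qed.

(** Here the discount makes the contribution of the paths that have not crossed
    at time t at most exp(-qt) (L + 1). *)
Lemma hit_laplace i q L C h0 (f : 'I_2 -> R -> R) : 0 < q ->
  test_fun lam gam a x q 0 f L C h0 -> f 1 l0 = 1 ->
  (\int[P]_(w in S i) expeR (- (q%:E * T w)) = (f i x * fine (P (S i)))%:E)%E.
Proof.
move=> q0 tf f1; have L0 : 0 <= L by case: tf.
have fbd j y : `|f j y| <= L by case: tf => _ _ _ _ [].
set K := f i x * fine (P (S i)).
pose g w := fine (expeR (- (q%:E * T w))).
have gfin w : expeR (- (q%:E * T w))%E = (g w)%:E.
  rewrite /g; have := T_ge0 w; case: (T w) => [r| |] //.
  by rewrite gt0_muley ?lte_fin.
have g_cvg w : discount q (tau n.+1%:R w) @[n --> \oo] --> g w.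
  by have := @discount_hit_cvg q w q0; rewrite gfin => /fine_cvg.
have ex01 t : 0 <= t -> 0 <= discount q t <= 1.
  by move=> t0; rewrite /discount expR_ge0/= -expR0 ler_expR oppr_le0 mulr_ge0// ltW.
have bex t : 0 < t -> bounded_mfun (fun w => discount q (tau t w)).
  move=> t0; split; last first.
    exists 1 => w; have /andP[u0 _] := tau_itv w (ltW t0).
    by have /andP[v0 v1] := ex01 _ u0; rewrite ger0_norm.
  apply: (@measurableT_comp _ _ _ _ _ _ expR _ (fun w => - (q * tau t w))).
    exact: measurable_expR.
  have [m _] := bmfZ (- q) (btau t0).
  by apply: eq_measurable_fun m => w _; rewrite mulNr.
have bd n w : `|discount q (tau n.+1%:R w)| <= 1.
  have /andP[u0 _] := tau_itv w (ler0n R n.+1).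
  by have /andP[v0 v1] := ex01 _ u0; rewrite ger0_norm.
have bg : bounded_mfun g := bmf_lim (fun n => bex _ (ltr0Sn R n)) bd g_cvg.
under eq_integral do rewrite gfin.
rewrite integral_bmf//; congr EFin.
pose I t := E (fun w => \1_(S i) w * discount q (tau t w)).
have bI t : 0 < t -> bounded_mfun (fun w => \1_(S i) w * discount q (tau t w)) by move=> t0; apply: bmfM => //; exact: bex.
have c1 : I n.+1%:R @[n --> \oo] --> E (fun w => \1_(S i) w * g w).
  apply: (Ex_dct (M := 1)) => [n|n w|w]; first exact: bI.
    case: (ind01 i w) => ->; first by rewrite mul0r normr0.
    by rewrite mul1r.
  by apply: cvgM; [exact: cvg_cst|exact: g_cvg].
apply: (cvg_unique _ c1) => //.
have dk t : 0 < t -> `|K - I t| <= discount q t * (L + 1).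
  move=> t0; have [eG bG] := dynkin lam_gt0 gam_gt0 a_gam eps_meas eps_right eps_left p_trans p_small
    X_meas X_ou x_ge i (ltW q0) (or_introl erefl) tf t0.
  have /andP[v0 v1] := ex01 _ (ltW t0).
  have B0 : 0 <= discount q t * (L + 1) by apply: mulr_ge0 => //; apply: addr_ge0.
  rewrite /K -eG /I -ExB//; last exact: bI.
  apply: Ex_bound; first by apply: bmfB => //; exact: bI.
  move=> w; rewrite -/(S i) -mulrBr /stopped_gain mul0r add0r f1 mulr1.
  case: (ind01 i w) => ->; first by rewrite mul0r normr0.
  rewrite mul1r; case: ltP => Xt; first by rewrite subrr normr0.
  rewrite (tau_alive (ltW t0) Xt).
  have -> : discount q t * f (eps t w) (X t w) - discount q t = discount q t * (f (eps t w) (X t w) - 1) by ring.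
  rewrite normrM (ger0_norm v0); apply: ler_wpM2l => //.
  by rewrite (le_trans (ler_normB _ _))// normr1 lerD2r.
have ec := discount_nat_cvg q0.
apply/cvgrPdist_le => e e0; have L1 : 0 < L + 1 by lra.
have /cvgrPdist_le/(_ _ (divr_gt0 e0 L1)) := ec; apply: filterS => n.
rewrite sub0r normrN => en; apply: le_trans (dk _ (ltr0Sn R n)) _.
by rewrite -ler_pdivlMr//; apply: le_trans en; exact: ler_norm.
Qed.

End HittingLaw.

(** * The two solutions, and the theorem *)

Section TestFunctions.
Variables (R : realType) (lam gam a : 'I_2 -> R).
Hypotheses (lam_gt0 : forall i, 0 < lam i) (gam_gt0 : forall i, 0 < gam i).
Hypothesis a_gam : a 1 / gam 1 < a 0 / gam 0.
Variable x : R.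
Hypothesis x_ge : level gam a 0 <= x.
Implicit Types (q z : R) (i : 'I_2).
Local Notation c0 := (lam 0 / gam 0).
Local Notation c1 := (lam 1 / gam 1).

Let c_ge0 i : 0 <= lam i / gam i. Proof. by rewrite divr_ge0// ltW. Qed.

Definition unit_source_sol i q z := if i == 0 then U0 lam gam q z else U1 lam gam q z.
Definition Qhat_state i := if i == 0 then Qhat0 lam gam a x else Qhat1 lam gam a x.

Let z_at_lvl : wz (zvar gam a (level gam a 0)) = 0.
Proof. by rewrite /wz /zvar subrr !mul0r. Qed.

Lemma mean_test_fun : exists f L C r, test_fun lam gam a x 0 1 f L C r /\
  f 1 (level gam a 0) = 0 /\ forall i, f i x = unit_source_sol i 0 (zvar gam a x).
Proof.
have B0 : 0 < c0 + 0 * (gam 0)^-1 by rewrite mul0r addr0 divr_gt0.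
pose s0 := (gam 0)^-1; pose s1 := (gam 1)^-1.
have sys z : z < 1 / 2 -> zsys (beta lam gam 0 0) (beta lam gam 1 0) c0 c1 (1 / gam 0) (1 / gam 1)
    (U0 lam gam 0) (U1 lam gam 0)
    (dW0 c0 c1 s0 s1 (c0 + 0 * s0) (c1 + 0 * s1)) (dW1 c0 c1 s0 s1 (c0 + 0 * s0) (c1 + 0 * s1)) z.
  move=> z12; have := W_zsys s0 s1 (c_ge0 0) (c_ge0 1) (c1 + 0 * s1) B0 z12.
  by rewrite beta0E beta1E !div1r.
have cont z (z12 : z < 1 / 2) := dW_continuous s0 s1 (c_ge0 0) (c_ge0 1) (c1 + 0 * s1) B0 z12.
have [f [L [C [r [tf hf]]]]] := zsys_test_fun lam_gt0 gam_gt0 a_gam x_ge sys cont.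
exists f, L, C, r; split => //.
have [_ ->] := hf _ (introT andP (conj (lexx _) x_ge)).
split; first by rewrite /U1 z_at_lvl /W1 psum_at0.
move=> i; have [e0 e1] := hf _ (introT andP (conj x_ge (lexx _))).
by rewrite /unit_source_sol; case: (I2E i) => ->.
Qed.

Lemma laplace_test_fun q : 0 < q -> exists f L C r, test_fun lam gam a x q 0 f L C r /\
  f 1 (level gam a 0) = 1 /\ forall i, f i x = 1 - q * unit_source_sol i q (zvar gam a x).
Proof.
move=> q0; have B0 : 0 < c0 + q * (gam 0)^-1 by rewrite addr_gt0// divr_gt0.
pose s0 := (gam 0)^-1; pose s1 := (gam 1)^-1.
pose b := c0 + q * s0; pose b' := c1 + q * s1.
have sys z : z < 1 / 2 -> zsys (beta lam gam 0 q) (beta lam gam 1 q) c0 c1 (0 / gam 0) (0 / gam 1)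
    (Q0 b b' c0 c1 s0 s1 q) (Q1 b b' c0 c1 s0 s1 q)
    (dQ0 b b' c0 c1 s0 s1 q) (dQ1 b b' c0 c1 s0 s1 q) z.
  move=> z12; rewrite beta0E beta1E !mul0r.
  by apply: Q_zsys => //; rewrite divr_gt0.
have cont z : z < 1 / 2 -> {for z, continuous (dQ0 b b' c0 c1 s0 s1 q)} /\
    {for z, continuous (dQ1 b b' c0 c1 s0 s1 q)}.
  move=> z12; have [k0 k1] := dW_continuous s0 s1 (c_ge0 0) (c_ge0 1) b' B0 z12.
  by split; apply: cvgB; [exact: cvg_cst|apply: cvgM; [exact: cvg_cst|exact: k0]|
    exact: cvg_cst|apply: cvgM; [exact: cvg_cst|exact: k1]].
have [f [L [C [r [tf hf]]]]] := zsys_test_fun lam_gt0 gam_gt0 a_gam x_ge sys cont.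
exists f, L, C, r; split => //.
have [_ ->] := hf _ (introT andP (conj (lexx _) x_ge)).
split; first by rewrite /Q1 z_at_lvl /W1 psum_at0 /= mulr0 subr0.
move=> i; have [e0 e1] := hf _ (introT andP (conj x_ge (lexx _))).
by rewrite /unit_source_sol; case: (I2E i) => ->.
Qed.

Lemma QhatE i q : - lam 0 < q -> Qhat_state i q = 1 - q * unit_source_sol i q (zvar gam a x).
Proof.
move=> q0; have z0 := zvar_ge0P a_gam x_ge.
by rewrite /Qhat_state /unit_source_sol; case: (I2E i) => ->; [exact: Qhat0E|exact: Qhat1E].
Qed.

End TestFunctions.

Section HittingExpectations.
Context {R : realType} {d : measure_display} {Omega : measurableType d}.
Variable P : probability Omega R.
Variables (lam gam a : 'I_2 -> R) (eps : R -> Omega -> 'I_2).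
Hypothesis lam_gt0 : forall i, 0 < lam i.
Hypothesis gam_gt0 : forall i, 0 < gam i.
Hypothesis a_gam : a 1 / gam 1 < a 0 / gam 0.
Hypothesis eps_markov : two_state_markov P lam eps.
Variables (x : R) (X : R -> Omega -> R).
Hypothesis X_meas : forall t, measurable_fun setT (X t).
Hypothesis X_ou : forall w, ou_path a gam x (eps ^~ w) (fun t => X t w).
Hypothesis x_ge : level gam a 0 <= x.
Variable i : 'I_2.
Hypothesis charged : (0 < P (in_state eps 0 i))%E.

Notation T := (fun w : Omega => hitting_time (level gam a 0) (fun s => X s w)).

Let mS : measurable (in_state eps 0 i). Proof. exact: (tsm_measurable eps_markov). Qed.

Let PS_gt0 : 0 < fine (P (in_state eps 0 i)).
Proof.
apply: fine_gt0; rewrite charged/=.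
by apply: (@le_lt_trans _ _ 1%E); [exact: probability_le1|exact: ltry].
Qed.

Let cancelP (k : R) : ((fine (P (in_state eps 0 i)))^-1%:E * (k * fine (P (in_state eps 0 i)))%:E = k%:E)%E.
Proof. by rewrite -EFinM mulrC mulfK// gt_eqF. Qed.

Lemma mean_hitting_time : cond_expect P (in_state eps 0 i) T = (unit_source_sol lam gam i 0 (zvar gam a x))%:E.
Proof.
have [p [pt ps]] := tsm_transition eps_markov.
have [f [L [C [r [tf [f1 fx]]]]]] := mean_test_fun lam_gt0 gam_gt0 a_gam x_ge.
rewrite /cond_expect (hit_mean lam_gt0 gam_gt0 a_gam (tsm_measurable eps_markov)
  (tsm_right_continuous eps_markov) (tsm_left_limit eps_markov) pt ps X_meas X_ou x_ge i tf f1).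
by rewrite cancelP fx.
Qed.

Lemma laplace_hitting_time q : 0 <= q ->
  cond_expect P (in_state eps 0 i) (fun w => expeR (- (q%:E * T w))) = (Qhat_state lam gam a x i q)%:E.
Proof.
rewrite le_eqVlt => /orP[/eqP <-|q0].
  rewrite QhatE//; last by rewrite oppr_lt0.
  rewrite mul0r subr0 /cond_expect.
  under eq_integral do rewrite mul0e oppe0 expeR0.
  rewrite integral_cst// mul1e -[X in (_ * X)%E]fineK; last exact: fin_num_measure.
  by have := cancelP 1; rewrite mul1r.
have [p [pt ps]] := tsm_transition eps_markov.
have [f [L [C [r [tf [f1 fx]]]]]] := laplace_test_fun lam_gt0 gam_gt0 a_gam x_ge q0.
rewrite /cond_expect (hit_laplace lam_gt0 gam_gt0 a_gam (tsm_measurable eps_markov)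
  (tsm_right_continuous eps_markov) (tsm_left_limit eps_markov) pt ps X_meas X_ou x_ge i q0 tf f1).
rewrite cancelP fx QhatE//; apply: lt_trans q0; by rewrite oppr_lt0.
Qed.

End HittingExpectations.

Theorem theorem3p2 (R : realType) (d : measure_display)
    (Omega : measurableType d) (P : probability Omega R)
    (lam gam a : 'I_2 -> R) (eps : R -> Omega -> 'I_2)
    (x : R) (X : R -> {RV P >-> R})
    (lam_gt0 : forall i, 0 < lam i) (gam_gt0 : forall i, 0 < gam i)
    (a_gam : a 1 / gam 1 < a 0 / gam 0)
    (eps_markov : two_state_markov P lam eps)
    (X_ou : forall w, ou_path a gam x (eps ^~ w) (fun t => X t w))
    (x_ge : a 0 / gam 0 <= x) :
  let T := fun w : Omega => hitting_time (a 0 / gam 0) (fun t => X t w) in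
  let start := in_state eps 0 in
  let charged := fun i => (0 < P (start i))%E in
  let z := zvar gam a x in
  let b' := b0'0 lam gam in
  let S0 := mean_series lam gam (1 + lam 0 / gam 0) z in
  let S1 := mean_series lam gam (lam 0 / gam 0) z in
  let xstar := 2 * (a 0 / gam 0) - a 1 / gam 1 in
  let E0_holds := cvgn S0 /\ (charged 0 ->
        cond_expect P (start 0) T = (- b' * limn S0 + 1 / lam 0)%:E) in
  let E1_holds := cvgn S1 /\ (charged 1 ->
        cond_expect P (start 1) T = (- b' * limn S1)%:E) in
  let caseA := x < xstar \/ (x = xstar /\ lam 1 < gam 1) in
  (0 < b' /\ is_derive (0 : R) (1 : R) (b0 lam gam) b') /\
  (caseA -> E0_holds /\ E1_holds) /\
  (x = xstar -> gam 1 <= lam 1 < 2 * gam 1 -> E0_holds /\ ~ cvgn S1) /\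
  (~ caseA ->
     (charged 0 ->
        (forall q, 0 <= q ->
           cond_expect P (start 0) (fun w => expeR (- (q%:E * T w)))
             = (Qhat0 lam gam a x q)%:E) /\
        derivable (Qhat0 lam gam a x) 0 1 /\
        cond_expect P (start 0) T = (- derive1 (Qhat0 lam gam a x) 0)%:E) /\
     (charged 1 ->
        (forall q, 0 <= q ->
           cond_expect P (start 1) (fun w => expeR (- (q%:E * T w)))
             = (Qhat1 lam gam a x q)%:E) /\
        derivable (Qhat1 lam gam a x) 0 1 /\
        cond_expect P (start 1) T = (- derive1 (Qhat1 lam gam a x) 0)%:E)).

Proof.
move=> T start charged z b' S0 S1 xstar E0_holds E1_holds caseA.
have X_meas t : measurable_fun setT (X t : Omega -> R) by exact: measurable_funPT.
have mean i : charged i -> cond_expect P (start i) T = (unit_source_sol lam gam i 0 z)%:E.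
  exact: (mean_hitting_time lam_gt0 gam_gt0 a_gam eps_markov X_meas X_ou x_ge).
have laplace i q : charged i -> 0 <= q ->
    cond_expect P (start i) (fun w => expeR (- (q%:E * T w))) = (Qhat_state lam gam a x i q)%:E.
  by move=> ch; apply: (laplace_hitting_time lam_gt0 gam_gt0 a_gam eps_markov X_meas X_ou x_ge).
have z0 : z <= 0 := zvar_ge0P a_gam x_ge.
have dl : 0 < a 0 / gam 0 - a 1 / gam 1 by rewrite subr_gt0.
have zstar : x = xstar -> z = -1.
  rewrite /z /zvar => ->.
  rewrite (_ : _ - xstar = - (a 0 / gam 0 - a 1 / gam 1)); last by rewrite /xstar; ring.
  by rewrite mulNr divff// gt_eqF.
have z_gt : x < xstar -> -1 < z.
  by move=> xx; rewrite /z /zvar ltr_pdivlMr// mulN1r; move: xx; rewrite /xstar; lra.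
have E0 : (-1 < z /\ z <= 0) \/ (z = -1 /\ lam 1 / gam 1 < 2) -> E0_holds.
  move=> /(U_mean0 lam_gt0 gam_gt0)[c e]; split=> // ch.
  by rewrite mean// /unit_source_sol /= e.
have E1 : (-1 < z /\ z <= 0) \/ (z = -1 /\ lam 1 / gam 1 < 1) -> E1_holds.
  move=> /(U_mean1 lam_gt0 gam_gt0)[c e]; split=> // ch.
  by rewrite mean// /unit_source_sol /= e.
have [D0 D1] := Qhat_derive lam_gt0 gam_gt0 z0.
split; first by split; [exact: b0'0_gt0|exact: b0_derive].
split.
  case=> [/z_gt z1|[/zstar z1 lg]]; first by split; [apply: E0|apply: E1]; left.
  have c1 : lam 1 / gam 1 < 1 by rewrite ltr_pdivrMr// mul1r.
  by split; [apply: E0|apply: E1]; right; split=> //; lra.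
split.
  move=> /zstar z1 /andP[g1 g2]; split.
    by apply: E0; right; split=> //; rewrite ltr_pdivrMr.
  by rewrite /S1 z1; apply: mean_diverges => //; rewrite ler_pdivlMr// mul1r.
move=> _; split=> ch; (split; first by move=> q q0; exact: laplace); split.
- by have [] := D0.
- by rewrite mean// derive1E; have [_ ->] := D0; rewrite opprK.
- by have [] := D1.
- by rewrite mean// derive1E; have [_ ->] := D1; rewrite opprK.
Qed.
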